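(* Let $\mathcal{G}$ be a locally compact, Hausdorff, étale groupoid, let $\mathcal{G}'$ be an open subgroupoid of $\mathcal{G}$ with the same base space, and let $\mathcal{A}$ be a $\mathcal{G}$-sheaf on $\mathcal{G}^{(0)}$, also considered as a $\mathcal{G}'$-sheaf on $(\mathcal{G}')^{(0)}=\mathcal{G}^{(0)}$. Then there is a long exact sequence of homology groups $$\cdots\leftarrow H_{n-1}(\mathcal{G}';\mathcal{A})\leftarrow H_n(\mathcal{G}/\mathcal{G}';\mathcal{A})\leftarrow H_n(\mathcal{G};\mathcal{A})\leftarrow H_n(\mathcal{G}';\mathcal{A})\leftarrow H_{n+1}(\mathcal{G}/\mathcal{G}';\mathcal{A})\leftarrow\cdots$$
   Context: Groupoid homology (Crainic–Moerdijk): for a locally compact Hausdorff étale groupoid $\mathcal{G}$, a $\mathcal{G}$-sheaf is a sheaf of abelian groups $\mathcal{S}$ on $\mathcal{G}^{(0)}$ with a continuous $\mathcal{G}$-action on its étale space whose anchor map is the projection to $\mathcal{G}^{(0)}$ (so each $g$ gives an isomorphism of stalks $\mathcal{S}_{s(g)}\to\mathcal{S}_{r(g)}$). A sheaf is $c$-soft if any section over a neighbourhood of a compact set $K$ agrees on some neighbourhood of $K$ with a global section. $\Gamma_c$ denotes compactly supported sections. $\mathcal{G}^{(n)}$ is the space of composable strings $x_0\stackrel{g_1}{\leftarrow}x_1\leftarrow\cdots\stackrel{g_n}{\leftarrow}x_n$, $\tau_n:\mathcal{G}^{(n)}\to\mathcal{G}^{(0)}$ sends it to $x_0$, and $\mathcal{S}_n:=\tau_n^*\mathcal{S}$.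 With face maps $d_i:\mathcal{G}^{(n)}\to\mathcal{G}^{(n-1)}$ ($d_0$ drops $g_1$, $d_n$ drops $g_n$, $d_i$ multiplies $g_i,g_{i+1}$ otherwise; $d_0=s$, $d_1=r$ if $n=1$), identify $\mathcal{S}_n$ with $d_i^*\mathcal{S}_{n-1}$ (using the action of $g_1$ if $i=0$), put $(\delta_it)(\underline{h})=\sum_{\underline{g}\in d_i^{-1}(\underline{h})}t(\underline{g})$ and $\delta=\sum_i(-1)^i\delta_i$. For a resolution $0\to\mathcal{A}\to\mathcal{S}^0\to\mathcal{S}^1\to\cdots$ of a $\mathcal{G}$-sheaf $\mathcal{A}$ by $c$-soft $\mathcal{G}$-sheaves, $H_n(\mathcal{G};\mathcal{A})$ is the $n$th homology of the direct sum total complex with $n$-chains $\bigoplus_{p-q=n}\Gamma_c(\mathcal{G}^{(p)};\mathcal{S}^q_p)$ and differential $\delta+(-1)^p\partial$ ($\partial$ from the resolution). Relative homology: each $(\mathcal{G}')^{(p)}$ is open in $\mathcal{G}^{(p)}$; let $F^{(p)}=\mathcal{G}^{(p)}\setminus(\mathcal{G}')^{(p)}$. For a sheaf $\mathcal{S}$ on $\mathcal{G}^{(p)}$, let $\mathcal{S}_{(\mathcal{G}')^{(p)}}$ be the subsheaf of $\mathcal{S}$ with all stalks outside $(\mathcal{G}')^{(p)}$ set to zero, and let $\mathcal{S}_{F^{(p)}}=\mathcal{S}/\mathcal{S}_{(\mathcal{G}')^{(p)}}$. Then $H_n(\mathcal{G}/\mathcal{G}';\mathcal{A})$ is the $n$th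 homology of the total complex of the double complex $\Gamma_c(\mathcal{G}^{(p)};(\mathcal{S}^q_p)_{F^{(p)}})$ ($p,q\ge0$, total degree $p-q$), which is the quotient of the double complex for $H_*(\mathcal{G};\mathcal{A})$ by that for $H_*(\mathcal{G}';\mathcal{A})$. *)

(* Defs.v *)
From HB Require Import structures.
From mathcomp Require Import all_boot all_order all_algebra.
From mathcomp Require Import all_classical.
From mathcomp Require Import topology.

Set Implicit Arguments.
Unset Strict Implicit.
Unset Printing Implicit Defensive.

Import Order.TTheory GRing.Theory Num.Theory.
Local Open Scope classical_set_scope.
Local Open Scope ring_scope.
Local Open Scope quotient_scope.

Record subgroup (V : zmodType) := Subgroup {
  subgroup_set :> V -> Prop;
  subgroup0 : subgroup_set 0;
  subgroupB : forall x y, subgroup_set x -> subgroup_set y ->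
    subgroup_set (x - y) }.

Section Subgroup.
Variables (V : zmodType) (A : subgroup V).

Definition subgroup_pred : {pred V} := fun x => `[< A x >].

Lemma subgroup_predP x : reflect (A x) (x \in subgroup_pred).
Proof. exact: asboolP. Qed.

Lemma subgroup_pred_closed : zmod_closed subgroup_pred.
Proof.
split; first exact/subgroup_predP/subgroup0.
by move=> x y /subgroup_predP Ax /subgroup_predP Ay; apply/subgroup_predP/subgroupB.
Qed.

HB.instance Definition _ :=
  GRing.isZmodClosed.Build V subgroup_pred subgroup_pred_closed.

Definition subgroup_type := {x : V | x \in subgroup_pred}.
HB.instance Definition _ := SubChoice.on subgroup_type.
HB.instance Definition _ := [SubChoice_isSubZmodule of subgroup_type by <:].

Definition quotient_group : zmodType := Quotient.quot subgroup_pred.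

End Subgroup.

Definition dprod (I : Type) (V : I -> zmodType) : Type := forall i, V i.

Section Dprod.
Variables (I : Type) (V : I -> zmodType).
Implicit Types f g h : dprod V.

HB.instance Definition _ := Choice.copy (dprod V) (forall i, V i).

Let dadd f g : dprod V := fun i => f i + g i.
Let dopp f : dprod V := fun i => - f i.
Let d0 : dprod V := fun=> 0.

Let daddA : associative dadd.
Proof. by move=> f g h; apply: functional_extensionality_dep => i; exact: addrA. Qed.
Let daddC : commutative dadd.
Proof. by move=> f g; apply: functional_extensionality_dep => i; exact: addrC. Qed.
Let dadd0 : left_id d0 dadd.
Proof. by move=> f; apply: functional_extensionality_dep => i; exact: add0r. Qed.
Let daddN : left_inverse d0 dopp dadd.
Proof. by move=> f; apply: functional_extensionality_dep => i; exact: addNr. Qed.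

HB.instance Definition _ := GRing.isZmodule.Build (dprod V) daddA daddC dadd0 daddN.

Lemma dprod0E i : (0 : dprod V) i = 0. Proof. by []. Qed.
Lemma dprodBE f g i : (f - g) i = f i - g i. Proof. by []. Qed.

End Dprod.

Definition local_homeo (X Y : topologicalType) (f : X -> Y) : Prop :=
  forall x, exists U : set X, [/\ open_nbhs x U, set_inj U f,
    {within U, continuous f} &
    forall V, open V -> V `<=` U -> open (f @` V)].

Section Local_homeo.
Variables (X Y : topologicalType) (f : X -> Y).

Lemma local_homeoI : continuous f ->
  (forall (x : X) (V : set X), nbhs x V -> nbhs (f x) (f @` V)) ->
  (forall x : X, exists2 U : set X, nbhs x U & set_inj U f) -> local_homeo f.
Proof.
move=> cf of_ injf x; have [U nU iU] := injf x.
exists U°; split.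
- by split; [exact: open_interior|].
- by move=> y z /[!inE] /interior_subset Uy /interior_subset Uz; apply: iU; rewrite inE.
- exact: continuous_subspaceT.
- move=> V oV _; rewrite openE => _ [y Vy <-]; apply: of_.
  exact: open_nbhs_nbhs.
Qed.

Hypothesis lhf : local_homeo f.

Lemma local_homeo_continuous : continuous f.
Proof.
move=> x; have [U [[oU Ux] _ cU _]] := lhf x.
by rewrite continuous_open_subspace // in cU; apply: cU; rewrite inE.
Qed.

Lemma local_homeo_nbhs (x : X) (V : set X) : nbhs x V -> nbhs (f x) (f @` V).
Proof.
move=> nV; have [U [[oU Ux] _ _ ofU]] := lhf x.
have nUV : nbhs x (U `&` V) by apply: filterI => //; exact: open_nbhs_nbhs.
apply: (@filterS _ _ _ (f @` (U `&` V)°)).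
  by apply: image_subset => y /interior_subset [].
apply: open_nbhs_nbhs; split; last by exists x.
by apply: ofU; [exact: open_interior|move=> y /interior_subset []].
Qed.

Lemma local_homeo_inj (x : X) : exists2 U : set X, nbhs x U & set_inj U f.
Proof. by have [U [oU iU _ _]] := lhf x; exists U => //; exact: open_nbhs_nbhs. Qed.

End Local_homeo.

Record etale_data (X : choiceType) := EtaleData {
  stalk : X -> zmodType;
  etale_open : set (set {x : X & stalk x});
  etale_openT : etale_open setT;
  etale_openI : setI_closed etale_open;
  etale_open_bigU : forall (I : Type) (f : I -> set {x : X & stalk x}),
    (forall i, etale_open (f i)) -> etale_open (\bigcup_i f i) }.

Definition etale (X : choiceType) (S : etale_data X) : Type :=
  {x : X & stalk S x}.

HB.instance Definition _ (X : choiceType) (S : etale_data X) :=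
  Choice.copy (etale S) {x : X & stalk S x}.
HB.instance Definition _ (X : choiceType) (S : etale_data X) :=
  isOpenTopological.Build (etale S)
    (@etale_openT _ S) (@etale_openI _ S) (@etale_open_bigU _ S).

Definition germ (X : choiceType) (S : etale_data X) (x : X) (a : stalk S x) :
  etale S := existT _ x a.

Definition etale_proj (X : choiceType) (S : etale_data X) (e : etale S) : X :=
  projT1 e.

(* The element of the stalk at [x] given by [e]; junk value [0] if [e] does
   not lie over [x]. *)
Definition stalk_at (X : choiceType) (S : etale_data X) (x : X) (e : etale S) :
    stalk S x :=
  match pselect (projT1 e = x) with
  | left E => ecast y (stalk S y) E (projT2 e)
  | right _ => 0
  end.

(* The fibre product of the étale space with itself over [X]. *)
Definition etale_pair_val (X : choiceType) (S : etale_data X)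
    (e : {x : X & (stalk S x * stalk S x)%type}) : etale S * etale S :=
  (germ (projT2 e).1, germ (projT2 e).2).

Definition etale_pair (X : choiceType) (S : etale_data X) : topologicalType :=
  initial_topology (@etale_pair_val X S).

Definition sub_continuous (X : choiceType) (S : etale_data X) : Prop :=
  continuous (fun e : etale_pair S => germ ((projT2 e).1 - (projT2 e).2)).

Record sheaf (X : topologicalType) := Sheaf {
  sheaf_data :> etale_data X;
  sheaf_proj : local_homeo (@etale_proj X sheaf_data);
  sheaf_sub : sub_continuous sheaf_data }.

Section Etale_data_theory.
Variables (X : choiceType) (S : etale_data X).

Lemma stalk_at_germ x (a : stalk S x) : stalk_at x (germ a) = a.
Proof.
rewrite /stalk_at; case: pselect => [E|//].
by rewrite (Prop_irrelevance E erefl).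
Qed.

Lemma germ_stalk_at x (e : etale S) : etale_proj e = x ->
  germ (stalk_at x e) = e.
Proof. by move=> <-; case: e => y a; rewrite stalk_at_germ. Qed.

Lemma germ_inj x (a b : stalk S x) : germ a = germ b -> a = b.
Proof. by move=> /(congr1 (stalk_at x)); rewrite !stalk_at_germ. Qed.

Lemma stalk_at_zmod x y : zmod_morphism (fun a : stalk S y => stalk_at x (germ a)).
Proof.
move=> a b; rewrite /stalk_at; case: pselect => [E|_] /=; last by rewrite subr0.
by case: x / E.
Qed.

Lemma sub_continuousI :
  (forall x (a b : stalk S x) (W : set (etale S)), nbhs (germ (a - b)) W ->
     exists U V : set (etale S), [/\ nbhs (germ a) U, nbhs (germ b) V &
       forall y (a' b' : stalk S y),
         U (germ a') -> V (germ b') -> W (germ (a' - b'))]) ->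
  sub_continuous S.
Proof.
move=> H [x [a b]] W /= /H [U [V [Ua Vb sUV]]].
have nUV : nbhs (etale_pair_val (existT _ x (a, b))) (U `*` V).
  by exists (U, V).
suff : nbhs (existT _ x (a, b) : etale_pair S) (@etale_pair_val X S @^-1` (U `*` V)).
  by apply: filterS => -[y [a' b']] /= [Ua' Vb']; exact: sUV.
exact: (@initial_continuous _ _ (@etale_pair_val X S)).
Qed.

End Etale_data_theory.

Section Sections.
Variables (X : topologicalType) (S : sheaf X).
Implicit Types s t : dprod (stalk S).

Definition section_over (U : set X) s : Prop :=
  forall x, U x -> {for x, continuous (fun y => germ (s y))}.

Definition support s : set X := closure [set x | s x != 0].

(* [s] only matters on [U], where it is a section. *)
Definition c_soft : Prop := forall (K U : set X) s,
  compact K -> open U -> K `<=` U -> section_over U s ->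
  exists t, section_over setT t /\
    exists V, [/\ open V, K `<=` V, V `<=` U & forall x, V x -> t x = s x].

Definition compact_section s : Prop :=
  section_over setT s /\ compact (support s).

Lemma sheaf_sub_nbhs x (a b : stalk S x) (W : set (etale S)) :
  nbhs (germ (a - b)) W -> exists U V : set (etale S),
  [/\ nbhs (germ a) U, nbhs (germ b) V & forall y (a' b' : stalk S y),
    U (germ a') -> V (germ b') -> W (germ (a' - b'))].
Proof.
move=> /(@sheaf_sub _ S (existT _ x (a, b))) /=.
rewrite nbhsE => -[_ [[B oB <-] Bab] sB].
have : nbhs (germ a, germ b) B by exact: open_nbhs_nbhs.
move=> -[[U V] /= [Ua Vb] sUV]; exists U, V; split=> // y a' b' Ua' Vb'.
by apply: (sB (existT _ y (a', b'))); exact: sUV.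
Qed.

Lemma section_at_sub s t x : {for x, continuous (fun y => germ (s y))} ->
  {for x, continuous (fun y => germ (t y))} ->
  {for x, continuous (fun y => germ ((s - t) y))}.
Proof.
move=> cs ct W /sheaf_sub_nbhs [U [V [nU nV sUV]]].
have Us : nbhs x [set y | U (germ (s y))] := cs _ nU.
have Vt : nbhs x [set y | V (germ (t y))] := ct _ nV.
apply: (@filterS2 _ _ _ _ _ _ _ Us Vt) => y /=; exact: sUV.
Qed.

Lemma local_section (e : etale S) : exists s U, [/\ open U, U (etale_proj e),
  section_over U s & germ (s (etale_proj e)) = e].
Proof.
have [U [[oU Ue] iU cU ofU]] := @sheaf_proj _ S e.
pose s : dprod (stalk S) := fun y =>
  stalk_at y (xget e [set e' | U e' /\ etale_proj e' = y]).
have sE e' : U e' -> germ (s (etale_proj e')) = e'.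
  move=> Ue'; rewrite /s; case: xgetP => [e'' _ [Ue'' pe'']|/(_ e')]; last first.
    by move=> H; exfalso; apply: H.
  rewrite germ_stalk_at //; apply: iU; rewrite ?inE //.
exists s, (@etale_proj X S @` U); split.
- exact: ofU.
- by exists e.
- move=> _ [e' Ue' <-] W; rewrite sE // => nW.
  have nUW : nbhs e' (U `&` W) by apply: filterI => //; exact: open_nbhs_nbhs.
  have := local_homeo_nbhs (@sheaf_proj _ S) nUW.
  by apply: filterS => _ [e'' [Ue'' We''] <-]; rewrite /= sE.
- exact: sE.
Qed.

Lemma section_over0 U : section_over U 0.
Proof.
move=> x _; have [s [V [oV Vx sV _]]] := local_section (germ (0 : stalk S x)).
by rewrite -(subrr s); apply: section_at_sub; exact: sV.
Qed.

Lemma open_zero : open [set e : etale S | projT2 e = 0].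
Proof.
rewrite openE => -[x a] /= ->.
have [U nU iU] := local_homeo_inj (@sheaf_proj _ S) (germ (0 : stalk S x)).
have n0 : \forall y \near x, U (germ (0 : stalk S y)).
  by apply: (@section_over0 setT x I).
have := local_homeo_continuous (@sheaf_proj _ S) (x := germ (0 : stalk S x)) n0.
rewrite /interior; move: nU; apply: filterS2 => -[y b] /= Ub U0.
by apply: germ_inj; apply: iU; rewrite ?inE.
Qed.

Lemma support_sub s t : support (s - t) `<=` support s `|` support t.
Proof.
have clU : closed (support s `|` support t) by apply: closedU; exact: closed_closure.
rewrite [X in _ `<=` X]((closure_id _).1 clU); apply: closureS => x /= st0.
have [s0|s0] := eqVneq (s x) 0.
  right; apply: subset_closure => /=; apply: contra_neq st0 => t0.
  by rewrite dprodBE s0 t0 subr0.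
by left; exact: subset_closure.
Qed.

Lemma support0 : support 0 = set0.
Proof.
rewrite /support (_ : [set _ | _] = set0) ?closure0 //.
by rewrite -subset0 => x /=; rewrite eqxx.
Qed.

Lemma compact_section0 : compact_section 0.
Proof. by split; [exact: section_over0|rewrite support0; exact: compact0]. Qed.

Lemma compact_sectionB s t :
  compact_section s -> compact_section t -> compact_section (s - t).
Proof.
move=> [cs ks] [ct kt]; split.
  by move=> x xT; apply: section_at_sub; [exact: cs|exact: ct].
apply: subclosed_compact (compactU ks kt) (@support_sub s t).
exact: closed_closure.
Qed.

Definition Gammac : zmodType :=
  subgroup_type (Subgroup compact_section0 compact_sectionB).

Definition Gammac_val (s : Gammac) : dprod (stalk S) := val s.

Lemma GammacP (s : Gammac) : compact_section (Gammac_val s).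
Proof. by apply: asboolW; exact: (valP s). Qed.

End Sections.

Section Pullback.
Variables (X Y : topologicalType) (f : Y -> X) (cf : continuous f) (S : sheaf X).

Let E : choiceType := {y : Y & stalk S (f y)}.
Let m (e : E) : Y * etale S := (projT1 e, germ (projT2 e)).

Definition pullback_data : etale_data Y :=
  @EtaleData Y (fun y => stalk S (f y)) (@open (initial_topology m))
    openT (@openI (initial_topology m))
    (fun I F oF => bigcup_open (fun i _ => oF i)).

Let nbhs_pull (y : Y) (a : stalk S (f y)) (W : set (etale pullback_data)) :
  nbhs (germ (a : stalk pullback_data y)) W <->
  exists A B, [/\ nbhs y A, nbhs (germ a) B & forall z (b : stalk S (f z)),
    A z -> B (germ b) -> W (germ (b : stalk pullback_data z))].
Proof.
split.
  move=> nW; have [_ [[B oB <-] Bab] sB] : exists2 B,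
    open_nbhs (germ (a : stalk pullback_data y)) B & B `<=` W
    by move: nW; rewrite nbhsE.
  have : nbhs (y, germ a) B by exact: open_nbhs_nbhs.
  move=> [[U V] /= [Uy Va] sUV]; exists U, V; split=> // z b Uz Vb.
  by apply: (sB (existT _ z b)); exact: sUV.
move=> [A [B [nA nB sAB]]]; rewrite nbhsE.
exists (m @^-1` (A° `*` B°)); last first.
  by move=> [z b] [/interior_subset Az /interior_subset Bb]; exact: sAB.
split=> //; exists (A° `*` B°) => //.
rewrite openE => -[u v] /= [Au Bv]; exists (A°, B°) => //=.
by split; apply: open_nbhs_nbhs; split=> //; exact: open_interior.
Qed.

Lemma pullback_proj : local_homeo (@etale_proj Y pullback_data).
Proof.
apply: local_homeoI.
- move=> [y a] W nW; apply/nbhs_pull; exists W, setT; split=> //.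
  exact: filterT.
- move=> [y a] W /nbhs_pull [A [B [nA nB sAB]]].
  have [s [U [oU Ux cs sE]]] := local_section (germ (a : stalk S (f y))).
  have nsB : \forall x \near f y, B (germ (s x)).
    by apply: (cs (f y) Ux); rewrite sE.
  have := cf nsB; move: nA; apply: filterS2 => z Az Bz.
  by exists (germ (s (f z) : stalk pullback_data z)) => //; exact: sAB.
- move=> [y a]; have [U nU iU] := local_homeo_inj (@sheaf_proj _ S) (germ (a : stalk S (f y))).
  exists [set e | U (germ (projT2 e : stalk S (f (projT1 e))))].
    by apply/nbhs_pull; exists setT, U; split=> //; exact: filterT.
  move=> [z b] [z' b'] /[!inE] /= Ub Ub'; rewrite /etale_proj /= => zz'.
  case: z' / zz' b' Ub' => b' Ub'; congr existT.
  apply: (@germ_inj _ S).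
  by apply: iU; rewrite ?inE.
Qed.

Lemma pullback_sub : sub_continuous pullback_data.
Proof.
apply: sub_continuousI => y a b W /nbhs_pull [A [B [nA nB sAB]]].
have [U [V [nU nV sUV]]] := sheaf_sub_nbhs nB.
exists [set e | A (projT1 e) /\ U (germ (projT2 e : stalk S (f (projT1 e))))].
exists [set e | V (germ (projT2 e : stalk S (f (projT1 e))))]; split.
- by apply/nbhs_pull; exists A, U.
- by apply/nbhs_pull; exists setT, V; split=> //; exact: filterT.
- by move=> z a' b' /= [Az Ua'] Vb'; apply: sAB => //; exact: sUV.
Qed.

Definition pullback : sheaf Y := Sheaf pullback_proj pullback_sub.

End Pullback.

Record subsheaf (X : topologicalType) (S : sheaf X) := Subsheaf {
  subsheaf_stalk : forall x, subgroup (stalk S x);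
  subsheaf_open :
    open [set e : etale S | subsheaf_stalk (projT1 e) (projT2 e)] }.

Section Quotient_sheaf.
Variables (X : topologicalType) (S : sheaf X) (N : subsheaf S).

Let qstalk x : zmodType := quotient_group (subsheaf_stalk N x).

Definition quotient_class x (a : stalk S x) : qstalk x := \pi_(qstalk x) a.

Let q (e : etale S) : {x : X & qstalk x} :=
  existT _ (projT1 e) (quotient_class (projT2 e)).

Definition quotient_data : etale_data X :=
  @EtaleData X qstalk (fun U => open (q @^-1` U)) openT
    (fun U V oU oV => openI oU oV)
    (fun I F oF => bigcup_open (fun i _ => oF i)).

Let pi_eq x (a b : stalk S x) :
  quotient_class a = quotient_class b -> subsheaf_stalk N x (a - b).
Proof.
by move/eqP; rewrite /quotient_class -Quotient.idealrBE => /subgroup_predP.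
Qed.

Let Q := quotient_data.

Let qe (e : etale S) : etale Q := q e.

Let qcont (W : set (etale Q)) (e : etale S) :
  nbhs (qe e) W -> nbhs e (qe @^-1` W).
Proof.
have : continuous qe by apply/continuousP => A; apply.
exact.
Qed.

Let qopen (e : etale S) (W : set (etale S)) : nbhs e W -> nbhs (qe e) (qe @` W).
Proof.
move=> nW; apply: (@filterS _ _ _ (qe @` W°)).
  by apply: image_subset; exact: interior_subset.
apply: open_nbhs_nbhs; split; last by exists e => //; exact: nbhs_singleton (nbhs_interior nW).
change (open (qe @^-1` (qe @` W°))).
rewrite openE => -[x b] /= [[y a] Wa] /[dup] /(congr1 (@etale_proj _ Q)).
rewrite /etale_proj /= => yx; case: x / yx b => b /(@germ_inj _ Q) /esym /pi_eq Nba.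
have nWa : nbhs (germ (b - (b - a))) W° by rewrite subKr; apply: open_nbhs_nbhs; split=> //; exact: open_interior.
have [U [V [nU nV sUV]]] := sheaf_sub_nbhs nWa.
have [t [O [oO Oy ct tE]]] := local_section (germ (b - a)).
have nN : nbhs (germ (b - a))
    (V `&` [set e : etale S | subsheaf_stalk N (projT1 e) (projT2 e)]).
  apply: filterI => //; apply: open_nbhs_nbhs; split=> //; exact: subsheaf_open.
rewrite -tE in nN.
have n1 := ct _ Oy _ nN.
have n2 := local_homeo_continuous (@sheaf_proj _ S) (x := germ b) n1.
have : nbhs (germ b) [set e : etale S | V (germ (t (projT1 e))) /\
  subsheaf_stalk N (projT1 e) (t (projT1 e))] by exact: n2.
rewrite /interior; move: nU; apply: filterS2 => -[z b'] Ub' /= [Vt Nt].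
exists (germ (b' - t z)); first exact: sUV.
congr existT; apply/eqP; rewrite /quotient_class -Quotient.idealrBE.
apply/subgroup_predP; rewrite addrAC subrr add0r -sub0r.
by apply: subgroupB => //; exact: subgroup0.
Qed.

Let qE (e : etale Q) : exists e', qe e' = e.
Proof.
by case: e => x a; exists (germ (repr a)); congr existT; exact: reprK.
Qed.

Lemma quotient_proj : local_homeo (@etale_proj X Q).
Proof.
apply: local_homeoI.
- apply/continuousP => A oA.
  change (open (@etale_proj X S @^-1` A)).
  by move/continuousP : (local_homeo_continuous (@sheaf_proj _ S)); exact.
- move=> e; have [e' <-] := qE e => V /qcont nV.
  have := local_homeo_nbhs (@sheaf_proj _ S) nV.
  by apply: filterS => _ [z Vz <-]; exists (qe z).
- move=> e; have [e' <-] := qE e.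
  have [U nU iU] := local_homeo_inj (@sheaf_proj _ S) e'.
  exists (qe @` U); first exact: qopen.
  move=> _ _ /[!inE] -[u Uu <-] [v Vv <-] uv; congr (qe _).
  by apply: iU; rewrite ?inE.
Qed.

Lemma quotient_sub : sub_continuous Q.
Proof.
apply: sub_continuousI => x a b W nW.
have [a' aE] : exists a', quotient_class a' = a by exists (repr a); exact: reprK.
have [b' bE] : exists b', quotient_class b' = b by exists (repr b); exact: reprK.
have qB y (u v : stalk S y) :
  qe (germ (u - v)) = germ ((quotient_class u : stalk Q y) - quotient_class v).
  by congr existT; rewrite /quotient_class raddfB.
have nW' : nbhs (qe (germ (a' - b'))) W by rewrite qB aE bE.
have [U [V [/qopen nU /qopen nV sUV]]] := sheaf_sub_nbhs (qcont nW').
exists (qe @` U), (qe @` V); split; rewrite -?aE -?bE // => y u v.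
move=> [[z u'] Uu'] /[dup] /(congr1 (@etale_proj _ Q)); rewrite /etale_proj /=.
move=> zy; case: y / zy u v => u v /(@germ_inj _ Q) <-.
move=> [[z' v'] Uv'] /[dup] /(congr1 (@etale_proj _ Q)); rewrite /etale_proj /=.
move=> zy; case: z / zy v u u' Uu' => v u u' Uu' /(@germ_inj _ Q) <-.
by rewrite -qB; exact: sUV.
Qed.

Definition quotient_sheaf : sheaf X := Sheaf quotient_proj quotient_sub.

End Quotient_sheaf.

(* The subsheaf of [S] with the same stalks on the open set [U] and zero stalks
   outside [U]. *)
Section Zero_outside.
Variables (X : topologicalType) (S : sheaf X) (U : set X) (oU : open U).

Let zstalk x : stalk S x -> Prop := fun a => U x \/ a = 0.

Let zstalk0 x : @zstalk x 0. Proof. by right. Qed.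

Let zstalkB x (a b : stalk S x) : zstalk a -> zstalk b -> zstalk (a - b).
Proof. by move=> [Ux|->]; [left|move=> [Ux|->]; [left|right; rewrite subr0]]. Qed.

Let zstalk_open : open [set e : etale S | zstalk (projT2 e)].
Proof.
rewrite (_ : [set _ | _] =
  (@etale_proj X S @^-1` U) `|` [set e : etale S | projT2 e = 0]) //.
apply: openU; last exact: open_zero.
by move/continuousP : (local_homeo_continuous (@sheaf_proj _ S)); exact.
Qed.

Definition zero_outside : subsheaf S :=
  @Subsheaf _ S (fun x => Subgroup (@zstalk0 x) (@zstalkB x)) zstalk_open.

End Zero_outside.

(* The space of units [obj] is kept apart from the space of arrows [arr], the
   embedding being [gid]; [gmul] is only meaningful on composable pairs. *)
Record etale_groupoid := EtaleGroupoid {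
  obj : topologicalType;
  arr : topologicalType;
  gsrc : arr -> obj;
  grng : arr -> obj;
  gid : obj -> arr;
  gmul : arr -> arr -> arr;
  ginv : arr -> arr;
  gsrc_id : forall x, gsrc (gid x) = x;
  grng_id : forall x, grng (gid x) = x;
  gsrc_mul : forall g h, gsrc g = grng h -> gsrc (gmul g h) = gsrc h;
  grng_mul : forall g h, gsrc g = grng h -> grng (gmul g h) = grng g;
  gmulA : forall g h k, gsrc g = grng h -> gsrc h = grng k ->
    gmul g (gmul h k) = gmul (gmul g h) k;
  gmul_idl : forall g, gmul (gid (grng g)) g = g;
  gmul_idr : forall g, gmul g (gid (gsrc g)) = g;
  gsrc_inv : forall g, gsrc (ginv g) = grng g;
  grng_inv : forall g, grng (ginv g) = gsrc g;
  gmul_inv : forall g, gmul g (ginv g) = gid (grng g);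
  ginv_mul : forall g, gmul (ginv g) g = gid (gsrc g);
  gid_continuous : continuous gid;
  gmul_continuous : {within [set gh : arr * arr | gsrc gh.1 = grng gh.2],
    continuous (fun gh => gmul gh.1 gh.2)};
  ginv_continuous : continuous ginv;
  gsrc_local_homeo : local_homeo gsrc;
  grng_local_homeo : local_homeo grng }.

Record open_subgroupoid (G : etale_groupoid) := OpenSubgroupoid {
  subarr : set (arr G);
  subarr_open : open subarr;
  subarr_id : forall x, subarr (gid x);
  subarr_mul : forall g h, subarr g -> subarr h -> gsrc g = grng h ->
    subarr (gmul g h);
  subarr_inv : forall g, subarr g -> subarr (ginv g) }.

Section Subgroupoid.
Variables (G : etale_groupoid) (G' : open_subgroupoid G).

Let T : topologicalType := set_type (subarr G').

Let val_cont : continuous (val : T -> arr G).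
Proof. exact: initial_continuous. Qed.

Let T_in (g : T) : subarr G' (val g). Proof. by apply: set_mem; exact: valP. Qed.

Let ssrc (g : T) : obj G := gsrc (val g).
Let srng (g : T) : obj G := grng (val g).
Let sid (x : obj G) : T := SigSub (mem_set (subarr_id G' x)).
Let sinv (g : T) : T := SigSub (mem_set (subarr_inv (T_in g))).
Let smul (g h : T) : T := insubd g (gmul (val g) (val h)).

Let smulE g h : ssrc g = srng h -> val (smul g h) = gmul (val g) (val h).
Proof.
move=> gh; rewrite insubdK //; apply: mem_set.
exact: (subarr_mul (T_in g) (T_in h) gh).
Qed.

Let ssrc_id x : ssrc (sid x) = x. Proof. exact: gsrc_id. Qed.
Let srng_id x : srng (sid x) = x. Proof. exact: grng_id. Qed.
Let ssrc_mul g h : ssrc g = srng h -> ssrc (smul g h) = ssrc h.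
Proof. by move=> gh; rewrite /ssrc smulE // gsrc_mul. Qed.
Let srng_mul g h : ssrc g = srng h -> srng (smul g h) = srng g.
Proof. by move=> gh; rewrite /srng smulE // grng_mul. Qed.
Let smulA g h k : ssrc g = srng h -> ssrc h = srng k ->
  smul g (smul h k) = smul (smul g h) k.
Proof.
move=> gh hk; apply: val_inj.
by rewrite !smulE ?ssrc_mul ?srng_mul // gmulA.
Qed.
Let smul_idl g : smul (sid (srng g)) g = g.
Proof. by apply: val_inj; rewrite smulE ?ssrc_id // gmul_idl. Qed.
Let smul_idr g : smul g (sid (ssrc g)) = g.
Proof. by apply: val_inj; rewrite smulE ?srng_id // gmul_idr. Qed.
Let ssrc_inv g : ssrc (sinv g) = srng g. Proof. exact: gsrc_inv. Qed.
Let srng_inv g : srng (sinv g) = ssrc g. Proof. exact: grng_inv. Qed.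
Let smul_inv g : smul g (sinv g) = sid (srng g).
Proof. by apply: val_inj; rewrite smulE ?srng_inv // gmul_inv. Qed.
Let sinv_mul g : smul (sinv g) g = sid (ssrc g).
Proof. by apply: val_inj; rewrite smulE ?ssrc_inv // ginv_mul. Qed.

Let sid_continuous : continuous sid.
Proof. by apply: continuous_comp_initial; exact: gid_continuous. Qed.

Let sinv_continuous : continuous sinv.
Proof.
apply: continuous_comp_initial => g.
apply: (@continuous_comp _ _ _ (val : T -> arr G) (@ginv G)).
  exact: val_cont.
exact: ginv_continuous.
Qed.

Let nbhs_val (g : T) (W : set T) : nbhs g W <->
  exists2 B : set (arr G), nbhs (val g) B & forall h : T, B (val h) -> W h.
Proof.
split.
  move=> nW; have [_ [[B oB <-] Bg] sB] : exists2 B, open_nbhs g B & B `<=` W.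
    by move: nW; rewrite nbhsE.
  by exists B; [exact: open_nbhs_nbhs|exact: sB].
move=> [B nB sB]; apply: (@filterS _ _ _ (val @^-1` B)); first exact: sB.
exact: val_cont.
Qed.

Let smul_continuous : {within [set gh : T * T | ssrc gh.1 = srng gh.2],
  continuous (fun gh => smul gh.1 gh.2)}.
Proof.
apply/subspace_continuousP => -[g h] /= gh W /nbhs_val [B nB sB].
have /subspace_continuousP /(_ (val g, val h) gh _) := @gmul_continuous G.
move: nB; rewrite /= smulE // => nB /(_ _ nB) [[U V] /= [nU nV] sUV].
exists (val @^-1` U, val @^-1` V); first by split; exact: val_cont.
move=> [g1 h1] /= [Ug1 Vh1] c1; apply: sB => /=; rewrite smulE //.
exact: (sUV (val g1, val h1)).
Qed.

Let val_local_homeo (f : arr G -> obj G) : local_homeo f ->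
  local_homeo (fun g : T => f (val g)).
Proof.
move=> lf; apply: local_homeoI.
- move=> g; apply: (@continuous_comp _ _ _ (val : T -> arr G) f).
    exact: val_cont.
  exact: local_homeo_continuous.
- move=> g V /nbhs_val [B nB sB].
  have nBG : nbhs (val g) (B `&` subarr G').
    apply: filterI => //; apply: open_nbhs_nbhs; split=> //.
    exact: subarr_open.
  have := local_homeo_nbhs lf nBG; apply: filterS => _ [h [Bh Gh] <-].
  by exists (SigSub (mem_set Gh)) => //; exact: sB.
- move=> g; have [U nU iU] := local_homeo_inj lf (val g).
  exists (val @^-1` U); first exact: val_cont.
  by move=> h k /[!inE] Uh Uk hk; apply: val_inj; apply: iU; rewrite ?inE.
Qed.

Definition subgroupoid : etale_groupoid :=
  EtaleGroupoid ssrc_id srng_id ssrc_mul srng_mul smulA smul_idl smul_idr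
    ssrc_inv srng_inv smul_inv sinv_mul sid_continuous smul_continuous
    sinv_continuous (val_local_homeo (@gsrc_local_homeo G))
    (val_local_homeo (@grng_local_homeo G)).

Definition subgroupoid_val (g : arr subgroupoid) : arr G := val (g : T).

End Subgroupoid.

Section Action.
Variables (G : etale_groupoid) (S : sheaf (obj G)).
Variable act : forall g : arr G, stalk S (gsrc g) -> stalk S (grng g).

(* The action on the étale space, meaningful on the [e] over [gsrc g]. *)
Definition etale_act (g : arr G) (e : etale S) : etale S :=
  germ (act (stalk_at (gsrc g) e)).

Definition act_pair_val (x : {g : arr G & stalk S (gsrc g)}) :
    arr G * etale S :=
  (projT1 x, germ (projT2 x)).

(* The fibre product of [arr G] and the étale space over [obj G]. *)
Definition act_pair : topologicalType := initial_topology act_pair_val.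

Definition act_continuous : Prop :=
  continuous (fun x : act_pair => germ (act (projT2 x))).

End Action.

Record gsheaf (G : etale_groupoid) := Gsheaf {
  gsheaf_sheaf :> sheaf (obj G);
  act : forall g : arr G, stalk gsheaf_sheaf (gsrc g) ->
    stalk gsheaf_sheaf (grng g);
  act_zmod : forall g, zmod_morphism (@act g);
  act_id : forall x (a : stalk gsheaf_sheaf x),
    etale_act act (gid x) (germ a) = germ a;
  act_mul : forall g h, gsrc g = grng h ->
    forall a : stalk gsheaf_sheaf (gsrc h),
    etale_act act (gmul g h) (germ a) =
    etale_act act g (etale_act act h (germ a));
  act_cont : act_continuous act }.

Record gmorphism (G : etale_groupoid) (A B : gsheaf G) := Gmorphism {
  gmor :> forall x, stalk A x -> stalk B x;
  gmor_zmod : forall x, zmod_morphism (@gmor x);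
  gmor_cont : continuous (fun e : etale A => germ (gmor (projT2 e)) : etale B);
  gmor_act : forall g (a : stalk A (gsrc g)), gmor (act a) = act (gmor a) }.

Record soft_resolution (G : etale_groupoid) (A : gsheaf G) := SoftResolution {
  res : nat -> gsheaf G;
  res_soft : forall q, c_soft (res q);
  res_aug : gmorphism A (res 0);
  res_d : forall q, gmorphism (res q) (res q.+1);
  res_aug_inj : forall x, injective (res_aug x);
  res_exact0 : forall x (b : stalk (res 0) x),
    res_d 0 x b = 0 <-> exists a, res_aug x a = b;
  res_exact : forall q x (b : stalk (res q.+1) x),
    res_d q.+1 x b = 0 <-> exists a, res_d q x a = b }.

Section Restriction.
Variables (G : etale_groupoid) (G' : open_subgroupoid G).

Section Sheaf.
Variable A : gsheaf G.

Let ract (g : arr (subgroupoid G')) (a : stalk A (gsrc g)) :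
  stalk A (grng g) := @act G A (subgroupoid_val g) a.

Let ract_cont : @act_continuous (subgroupoid G') A ract.
Proof.
pose j (x : act_pair (G := subgroupoid G') A) : act_pair A :=
  existT _ (subgroupoid_val (projT1 x)) (projT2 x).
suff cj : continuous j.
  move=> x; apply: (@continuous_comp _ _ _ j
    (fun x : act_pair A => germ (act (projT2 x)) : etale A)); first exact: cj.
  exact: act_cont.
apply: continuous_comp_initial => -[g a] W [[U V] [/= nU nV] sUV].
have nU' : nbhs g (@subgroupoid_val _ G' @^-1` U).
  by apply: (@initial_continuous _ _ (val : set_type (subarr G') -> arr G)).
suff : nbhs (existT _ g a : act_pair (G := subgroupoid G') A)
    (@act_pair_val (subgroupoid G') A @^-1`
       ((@subgroupoid_val _ G' @^-1` U) `*` V)).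
  by apply: filterS => -[h b] /= [Uh Vb]; exact: sUV.
apply: (@initial_continuous _ _ (@act_pair_val (subgroupoid G') A)).
by exists (@subgroupoid_val _ G' @^-1` U, V).
Qed.

Definition restrict : gsheaf (subgroupoid G').
Proof.
refine (@Gsheaf (subgroupoid G') A ract _ _ _ ract_cont).
- by move=> g; exact: (@act_zmod G A (subgroupoid_val g)).
- by move=> x a; exact: (@act_id G A x a).
- move=> g h gh a.
  have := @act_mul _ A (subgroupoid_val g) (subgroupoid_val h) gh a.
  rewrite /etale_act /ract.
  have : subgroupoid_val (@gmul (subgroupoid G') g h) =
    gmul (subgroupoid_val g) (subgroupoid_val h).
    rewrite /subgroupoid_val insubdK //; apply: mem_set.
    by apply: subarr_mul => //; apply: set_mem; exact: valP.
  by move=> <-.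
Defined.

End Sheaf.

Definition restrict_mor (A B : gsheaf G) (f : gmorphism A B) :
    gmorphism (restrict A) (restrict B) :=
  @Gmorphism (subgroupoid G') (restrict A) (restrict B) (gmor f)
    (@gmor_zmod _ _ _ f) (@gmor_cont _ _ _ f)
    (fun g => @gmor_act _ _ _ f (subgroupoid_val g)).

Definition restrict_res (A : gsheaf G) (R : soft_resolution A) :
    soft_resolution (restrict A) :=
  @SoftResolution (subgroupoid G') (restrict A) (fun q => restrict (res R q))
    (@res_soft _ _ R) (restrict_mor (res_aug R)) (fun q => restrict_mor (res_d R q))
    (@res_aug_inj _ _ R) (@res_exact0 _ _ R) (@res_exact _ _ R).

End Restriction.

Definition ordl n (i : 'I_n) : 'I_n.+1 := widen_ord (leqnSn n) i.
Definition ordr n (i : 'I_n) : 'I_n.+1 := lift ord0 i.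

(* [x_0 <- x_1 <- ... <- x_n], where the arrow [i] (counted from 0) goes from
   [x_(i+1)] to [x_i]. *)
Record string (G : etale_groupoid) (n : nat) := String {
  sobj : 'I_n.+1 -> obj G;
  sarr : 'I_n -> arr G;
  sarr_rng : forall i, grng (sarr i) = sobj (ordl i);
  sarr_src : forall i, gsrc (sarr i) = sobj (ordr i) }.

HB.instance Definition _ G n := gen_eqMixin (string G n).
HB.instance Definition _ G n := gen_choiceMixin (string G n).

Section Nerve.
Variable G : etale_groupoid.

Definition obj_tuple n : topologicalType := prod_topology (fun=> obj G) (I := 'I_n).
Definition arr_tuple n : topologicalType := prod_topology (fun=> arr G) (I := 'I_n).

Definition string_val n (g : string G n) : obj_tuple n.+1 * arr_tuple n :=
  (sobj g, sarr g).

(* The subspace of the product of the spaces of objects and of arrows. *)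
Definition nerve n : topologicalType := initial_topology (@string_val n).

Lemma string_eq n (g h : string G n) :
  sobj g = sobj h -> sarr g = sarr h -> g = h.
Proof.
case: g h => [x a r s] [x' a' r' s'] /= E E'.
by case: x' / E r' s' => r' s'; case: a' / E' r' s' => r' s';
  congr String; exact: Prop_irrelevance.
Qed.

Lemma sobj_continuous n i : continuous (fun g : nerve n => sobj g i).
Proof.
have ci : continuous (fun z : obj_tuple n.+1 => z i).
  exact: (@proj_continuous _ (fun=> obj G : topologicalType) i).
move=> g; apply: (@continuous_comp _ _ _ (@string_val n : nerve n -> _)
  (fun z : obj_tuple n.+1 * arr_tuple n => z.1 i)).
  exact: initial_continuous.
apply: (@continuous_comp _ _ _ (fun z : obj_tuple n.+1 * arr_tuple n => z.1)
  (fun z : obj_tuple n.+1 => z i)); last exact: ci.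
exact: cvg_fst.
Qed.

Lemma sarr_continuous n i : continuous (fun g : nerve n => sarr g i).
Proof.
have ci : continuous (fun z : arr_tuple n => z i).
  exact: (@proj_continuous _ (fun=> arr G : topologicalType) i).
move=> g; apply: (@continuous_comp _ _ _ (@string_val n : nerve n -> _)
  (fun z : obj_tuple n.+1 * arr_tuple n => z.2 i)).
  exact: initial_continuous.
apply: (@continuous_comp _ _ _ (fun z : obj_tuple n.+1 * arr_tuple n => z.2)
  (fun z : arr_tuple n => z i)); last exact: ci.
exact: cvg_snd.
Qed.

Section Face.
Variables (n : nat) (i : 'I_n.+2) (g : string G n.+1).

Let fobj (j : 'I_n.+1) : obj G := sobj g (lift i j).

Let farr (j : 'I_n) : arr G :=
  if (j.+1 < i)%N then sarr g (ordl j)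
  else if (j.+1 == i)%N then gmul (sarr g (ordl j)) (sarr g (ordr j))
  else sarr g (ordr j).

Let farr_comp (j : 'I_n) : gsrc (sarr g (ordl j)) = grng (sarr g (ordr j)).
Proof. by rewrite sarr_src sarr_rng; congr sobj; apply: val_inj. Qed.

Let farr_rng j : grng (farr j) = fobj (ordl j).
Proof.
rewrite /farr /fobj; case: ltngtP => ji.
- rewrite sarr_rng; congr sobj; apply: val_inj; rewrite /= /bump.
  by rewrite leqNgt (ltn_trans _ ji).
- rewrite sarr_rng; congr sobj; apply: val_inj; rewrite /= /bump.
  by move: ji; rewrite ltnS => ->.
- rewrite (grng_mul (farr_comp j)) sarr_rng; congr sobj; apply: val_inj.
  by rewrite /= /bump -ji ltnn.
Qed.

Let farr_src j : gsrc (farr j) = fobj (ordr j).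
Proof.
rewrite /farr /fobj; case: ltngtP => ji.
- rewrite sarr_src; congr sobj; apply: val_inj; rewrite /= /bump /= !add1n.
  by rewrite leqNgt ji.
- rewrite sarr_src; congr sobj; apply: val_inj; rewrite /= /bump /= !add1n.
  by rewrite (ltnW ji).
- rewrite (gsrc_mul (farr_comp j)) sarr_src; congr sobj; apply: val_inj.
  by rewrite /= /bump /= !add1n -ji leqnn.
Qed.

Definition face : string G n := String farr_rng farr_src.

End Face.
End Nerve.

Section Face_fibres.
Variables (G : etale_groupoid) (n : nat) (i : 'I_n.+2).

Lemma face_locally_inj (g : nerve G n.+1) :
  exists2 U, nbhs g U & set_inj U (face i).
Proof.
have H (k : 'I_n.+1) : exists U : set (arr G),
    [/\ nbhs (sarr g k) U, set_inj U (@gsrc G) & set_inj U (@grng G)].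
  have [U nU iU] := local_homeo_inj (@gsrc_local_homeo G) (sarr g k).
  have [V nV iV] := local_homeo_inj (@grng_local_homeo G) (sarr g k).
  exists (U `&` V); split; first exact: filterI.
  - by move=> x y /[!inE] -[Ux _] [Uy _]; apply: iU; rewrite inE.
  - by move=> x y /[!inE] -[_ Vx] [_ Vy]; apply: iV; rewrite inE.
pose U k := projT1 (cid (H k)).
exists [set h : nerve G n.+1 | forall k, U k (sarr h k)].
  have nb k : nbhs g [set h : nerve G n.+1 | U k (sarr h k)].
    apply: (@sarr_continuous G n.+1 k g).
    by rewrite /U; case: cid => /= W [].
  exact: (@filter_forall (nerve G n.+1) 'I_n.+1
    (fun k => [set h : nerve G n.+1 | U k (sarr h k)]) (nbhs g) _ nb).
move=> h h' /[!inE] /= Uh Uh' hh'.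
have eqobj (k : 'I_n.+2) : k != i -> sobj h k = sobj h' k.
  case: (unliftP i k) => [j -> _|->]; last by rewrite eqxx.
  by have := congr1 (fun z => sobj z j) hh'.
have eqarr : sarr h = sarr h'.
  apply/funext => k; have := Uh k; have := Uh' k; rewrite /U.
  case: cid => /= W [_ iS iR] Wh' Wh.
  have [ki|ki] := eqVneq (ordl k) i.
    apply: iS; rewrite ?inE // !sarr_src; apply: eqobj.
    by rewrite -ki -(inj_eq val_inj) /= /bump add1n gtn_eqF.
  by apply: iR; rewrite ?inE // !sarr_rng; exact: eqobj.
apply: string_eq => //; apply/funext => k.
have [->|//] := eqVneq k i; last by move=> ki; exact: eqobj.
case: (unliftP ord0 i) => [j ->|->].
  by rewrite -![sobj _ (lift _ _)]sarr_src eqarr.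
by rewrite (_ : ord0 = ordl ord0) -?sarr_rng ?eqarr //; exact: val_inj.
Qed.

Lemma face_fibre_finite (h : nerve G n) (K : set (nerve G n.+1)) :
  compact K -> finite_set ([set g : nerve G n.+1 | face i g = h] `&` K).
Proof.
set S := _ `&` K => cK; apply: contrapT => Sinf.
pose F : set_system (nerve G n.+1) := [set A | finite_set (S `\` A)].
have FF : ProperFilter F.
  apply: Build_ProperFilter_ex.
    move=> A FA; apply: contrapT => noA; apply: Sinf.
    by apply: sub_finite_set FA => g Sg; split=> // Ag; apply: noA; exists g.
  split; first by rewrite /F /= setDT.
    by move=> A B FA FB; rewrite /F /= setDIr finite_setU.
  by move=> A B AB; apply: sub_finite_set => g [Sg nBg]; split=> // /AB.
have FK : F K by rewrite /F /= (_ : S `\` K = set0) // -subset0 => g [[_ Kg]].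
have [g [_ clg]] := cK _ FF FK.
have [U nU iU] := face_locally_inj g.
have FSU : F (S `\` U).
  rewrite /F /= setDD.
  have [[d Sd]|noSU] := pselect (exists d, (S `&` U) d); last first.
    by rewrite (_ : _ `&` _ = set0) // -subset0 => d Sd; apply: noSU; exists d.
  apply: (sub_finite_set _ (finite_set1 d)) => d' Sd' /=.
  case: Sd Sd' => -[fd _] Ud [[fd' _] Ud'].
  by apply: iU; rewrite ?inE // fd fd'.
by have [d [[_ nUd] Ud]] := clg _ _ FSU nU.
Qed.

End Face_fibres.

(* The data of a double complex [Gammac (csheaf p q)]: [cface] gives the stalk
   maps [csheaf p.+1 q -> (face i)^* (csheaf p q)], [cdiff] the vertical
   differential. *)
Record coefficients (G : etale_groupoid) := Coefficients {
  csheaf : forall p : nat, nat -> sheaf (nerve G p);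
  cface : forall p q (i : 'I_p.+2) (g : nerve G p.+1),
    stalk (csheaf p.+1 q) g -> stalk (csheaf p q) (face i g);
  cdiff : forall p q (h : nerve G p),
    stalk (csheaf p q) h -> stalk (csheaf p q.+1) h;
  cface_zmod : forall p q i g, zmod_morphism (@cface p q i g);
  cdiff_zmod : forall p q h, zmod_morphism (@cdiff p q h) }.

Section Total_complex.
Variables (G : etale_groupoid) (C : coefficients G).

(* The sum over the fibre of [face i] has finitely many nonzero terms when [t] has
   compact support (cf. [face_fibre_finite]); [stalk_at h] only transports along
   the equality [face i g = h]. *)
Definition delta_face p q (i : 'I_p.+2) (t : dprod (stalk (csheaf C p.+1 q))) :
    dprod (stalk (csheaf C p q)) :=
  fun h => \sum_(g \in [set g : nerve G p.+1 | face i g = h])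
    stalk_at h (germ (cface i (t g))).

Definition delta p q (t : dprod (stalk (csheaf C p.+1 q))) :
    dprod (stalk (csheaf C p q)) :=
  \sum_(i < p.+2) delta_face i t *~ (-1) ^+ i.

Lemma delta_faceB p q (i : 'I_p.+2) (s t : dprod (stalk (csheaf C p.+1 q))) :
  compact_section s -> compact_section t ->
  delta_face i (s - t) = delta_face i s - delta_face i t.
Proof.
move=> [_ ks] [_ kt]; apply: functional_extensionality_dep => h.
rewrite dprodBE /delta_face; set P := [set g | _].
have Ff := face_fibre_finite i h (compactU ks kt); rewrite -/P in Ff.
have fB g (a b : stalk (csheaf C p.+1 q) g) :
  stalk_at h (germ (cface i (a - b))) =
  stalk_at h (germ (cface i a)) - stalk_at h (germ (cface i b)).
  by rewrite cface_zmod stalk_at_zmod.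
have f0 g : stalk_at h (germ (cface i (0 : stalk (csheaf C p.+1 q) g))) = 0.
  by rewrite -(subrr 0) fB subrr.
have W (r : dprod (stalk (csheaf C p.+1 q))) :
    (forall g, r g != 0 -> (support s `|` support t) g) ->
    \sum_(g \in P) stalk_at h (germ (cface i (r g))) =
    \sum_(g <- finmap.enum_fset (fset_set (P `&` (support s `|` support t))))
      stalk_at h (germ (cface i (r g))).
  move=> rst; rewrite -fsbig_finite //; apply/esym/fsbig_widen; first by move=> g [].
  move=> g [Pg nPg] /=; have [->|/rst stg] := eqVneq (r g) 0; first exact: f0.
  by exfalso; apply: nPg.
rewrite !W.
- by rewrite -sumrB; apply: eq_bigr => g _; rewrite -fB.
- by move=> g tg; right; exact: subset_closure.
- by move=> g sg; left; exact: subset_closure.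
- by move=> g stg; apply: (@support_sub _ _ s t); exact: subset_closure.
Qed.

Lemma deltaB p q (s t : dprod (stalk (csheaf C p.+1 q))) :
  compact_section s -> compact_section t ->
  delta (s - t) = delta s - delta t.
Proof.
move=> cs ct; rewrite /delta -sumrB; apply: eq_bigr => i _.
by rewrite delta_faceB // mulrzBl.
Qed.

Definition vertical p q (t : dprod (stalk (csheaf C p q))) :
    dprod (stalk (csheaf C p q.+1)) :=
  fun h => cdiff (t h).

Lemma verticalB p q (s t : dprod (stalk (csheaf C p q))) :
  vertical (s - t) = vertical s - vertical t.
Proof.
by apply: functional_extensionality_dep => h; exact: cdiff_zmod.
Qed.

(* Families of elements of the stalks, with no condition of continuity or of
   support: a common target for the differentials in all degrees. *)
Definition families : zmodType :=
  dprod (fun p => dprod (fun q => dprod (stalk (csheaf C p q)) : zmodType)).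

Definition Gammac_families : zmodType :=
  dprod (fun p => dprod (fun q => Gammac (csheaf C p q))).

Definition component (c : Gammac_families) p q : Gammac (csheaf C p q) := c p q.

Section Degree.
Variable n : int.

Definition chain_set (c : Gammac_families) : Prop :=
  finite_set [set pq : nat * nat | c pq.1 pq.2 != 0] /\
  forall p q : nat, c p q != 0 -> p%:Z - q%:Z = n.

Lemma chain_set0 : chain_set 0.
Proof.
split; last by move=> p q; rewrite !dprod0E eqxx.
by rewrite (_ : [set _ | _] = set0) // -subset0 => -[p q] /=; rewrite !dprod0E eqxx.
Qed.

Lemma chain_setB c d : chain_set c -> chain_set d -> chain_set (c - d).
Proof.
have cd p q : (c - d) p q != 0 -> c p q != 0 \/ d p q != 0.
  have [c0|] := eqVneq (c p q) 0; last by left.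
  by right; apply: contra_neq H => d0; rewrite !dprodBE c0 d0 subr0.
move=> [cf cn] [df dn]; split; last by move=> p q /cd [/cn|/dn].
apply: (sub_finite_set _ (_ : finite_set ([set pq | c pq.1 pq.2 != 0] `|`
  [set pq | d pq.1 pq.2 != 0]))); first by move=> [p q] /cd.
by rewrite finite_setU.
Qed.

(* The direct sum of the [Gammac (csheaf C p q)] with [p - q = n]. *)
Definition chains : zmodType := subgroup_type (Subgroup chain_set0 chain_setB).

Definition chain_val (c : chains) p q : dprod (stalk (csheaf C p q)) :=
  Gammac_val (component (val c) p q).
Arguments chain_val c p q : clear implicits.

(* The total differential, which is [delta + (-1)^p vertical] on bidegree
   [(p, q)], read off at its target. For a locally compact Hausdorff [G] and the
   [groupoid_coefficients] and [relative_coefficients] below, its values are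
   chains of degree [n - 1], but homology only needs the kernel and the image
   of [tot_d]. *)
Definition tot_d (c : chains) : families := fun p q =>
  delta (chain_val c p.+1 q) +
  match q return dprod (stalk (csheaf C p q)) with
  | 0%N => 0
  | q'.+1 => vertical (chain_val c p q') *~ (-1) ^+ p
  end.

Definition chain_families (c : chains) : families := chain_val c.

Lemma tot_dB c d : tot_d (c - d) = tot_d c - tot_d d.
Proof.
have cvB p q : chain_val (c - d) p q = chain_val c p q - chain_val d p q by [].
have cK p q : compact_section (chain_val c p q).
  exact: GammacP.
have dK p q : compact_section (chain_val d p q).
  exact: GammacP.
apply: functional_extensionality_dep => p.
apply: functional_extensionality_dep => q.
rewrite !dprodBE /tot_d cvB deltaB // opprD addrACA; congr (_ + _).
by case: q => [|q]; rewrite ?subr0 // cvB verticalB mulrzBl.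
Qed.

Lemma tot_d0 : tot_d 0 = 0.
Proof. by rewrite -[0 in LHS](subrr 0) tot_dB subrr. Qed.

Definition cycle_set (c : chains) : Prop := tot_d c = 0.

Lemma cycle_setB c d : cycle_set c -> cycle_set d -> cycle_set (c - d).
Proof. by rewrite /cycle_set tot_dB => -> ->; rewrite subrr. Qed.

Definition cycles : zmodType := subgroup_type (Subgroup tot_d0 cycle_setB).

Definition cycle_chain (z : cycles) : chains := val z.

End Degree.

Section Homology.
Variable n : int.

Definition boundary_set (z : cycles n) : Prop :=
  exists c : chains (n + 1), tot_d c = chain_families (cycle_chain z).

Lemma boundary_set0 : boundary_set 0.
Proof. by exists 0; rewrite tot_d0. Qed.

Lemma boundary_setB y z :
  boundary_set y -> boundary_set z -> boundary_set (y - z).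
Proof.
move=> [c cy] [d dz]; exists (c - d).
by rewrite tot_dB cy dz.
Qed.

Definition homology : zmodType :=
  quotient_group (Subgroup boundary_set0 boundary_setB).

Definition homology_class (z : cycles n) : homology := \pi_homology z.

End Homology.

End Total_complex.

Arguments chain_val {G C n} c p q.

Section Absolute.
Variables (G : etale_groupoid) (A : gsheaf G) (R : soft_resolution A).

Definition tau p (g : nerve G p) : obj G := sobj g ord0.

Lemma tau_continuous p : continuous (@tau p).
Proof. exact: sobj_continuous. Qed.

Definition res_pullback p q : sheaf (nerve G p) :=
  pullback (@tau_continuous p) (res R q).

(* The identification of stalks of [tau^* S] and of [(face i)^* tau^* S]; if
   [i = 0] it is the action [S_(x_0) -> S_(x_1)] of the inverse of the first
   arrow [x_0 <- x_1], and otherwise [tau (face i g)] is equal to [tau g]. *)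
Definition res_face p q (i : 'I_p.+2) (g : nerve G p.+1)
    (a : stalk (res_pullback p.+1 q) g) :
    stalk (res_pullback p q) (face i g) :=
  @stalk_at (obj G) (res R q) (tau (face i g))
    (if i == ord0
     then etale_act (@act G (res R q)) (ginv (sarr g ord0))
            (@germ (obj G) (res R q) (tau g) a)
     else @germ (obj G) (res R q) (tau g) a).

Lemma res_face_zmod p q i g : zmod_morphism (@res_face p q i g).
Proof.
move=> a b; rewrite /res_face; case: ifP => _; last first.
  exact: (@stalk_at_zmod (obj G) (res R q) _ (tau g) a b).
rewrite /etale_act.
have -> := @stalk_at_zmod (obj G) (res R q) (gsrc (ginv (sarr g ord0))) (tau g) a b.
by rewrite act_zmod stalk_at_zmod.
Qed.

Definition res_diff p q (h : nerve G p) (a : stalk (res_pullback p q) h) :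
  stalk (res_pullback p q.+1) h := res_d R q (tau h) a.

Lemma res_diff_zmod p q h : zmod_morphism (@res_diff p q h).
Proof. exact: gmor_zmod. Qed.

Definition groupoid_coefficients : coefficients G :=
  Coefficients res_face_zmod res_diff_zmod.

Definition groupoid_chains (n : int) : zmodType :=
  chains groupoid_coefficients n.
Definition groupoid_cycles (n : int) : zmodType :=
  cycles groupoid_coefficients n.

(* H_n(G; A), computed by the resolution [R]. *)
Definition groupoid_homology (n : int) : zmodType :=
  homology groupoid_coefficients n.

End Absolute.

Section Relative.
Variables (G : etale_groupoid) (G' : open_subgroupoid G).
Variables (A : gsheaf G) (R : soft_resolution A).

Definition subnerve p : set (nerve G p) :=
  [set g | forall i, subarr G' (sarr g i)].

Lemma subnerve_open p : open (@subnerve p).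
Proof.
rewrite openE => g gU.
have nb i : nbhs g [set h : nerve G p | subarr G' (sarr h i)].
  apply: (@sarr_continuous G p i g); apply: open_nbhs_nbhs.
  by split; [exact: subarr_open|exact: gU].
exact: (@filter_forall (nerve G p) 'I_p
  (fun i => [set h : nerve G p | subarr G' (sarr h i)]) (nbhs g) _ nb).
Qed.

Lemma subnerve_face p (i : 'I_p.+2) (g : nerve G p.+1) :
  subnerve g -> subnerve (face i g).
Proof.
move=> gU j; rewrite /=; case: ifP => _; first exact: gU.
case: ifP => _; last exact: gU.
apply: subarr_mul; [exact: gU|exact: gU|].
by rewrite sarr_src sarr_rng; congr sobj; apply: val_inj.
Qed.

Section Induced.
Variables (V W : zmodType) (K : subgroup V) (L : subgroup W) (f : V -> W).

Definition induced (x : quotient_group K) : quotient_group L :=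
  \pi_(quotient_group L) (f (repr x)).

Hypotheses (fB : zmod_morphism f) (fKL : forall a, K a -> L (f a)).

Lemma induced_zmod : zmod_morphism induced.
Proof.
move=> x y; rewrite /induced -raddfB; apply/eqP.
rewrite -Quotient.idealrBE -!fB; apply/subgroup_predP; apply: fKL.
by apply/subgroup_predP; rewrite Quotient.idealrBE !raddfB /= !reprK.
Qed.

End Induced.

Definition relative_subsheaf p q : subsheaf (res_pullback R p q) :=
  zero_outside (res_pullback R p q) (@subnerve_open p).

Definition relative_sheaf p q : sheaf (nerve G p) :=
  quotient_sheaf (relative_subsheaf p q).

(* Both maps are induced, on the quotient stalks, by those of the complex of
   [G], which preserve the subsheaves (cf. [relative_face_sub] and
   [relative_diff_sub]). *)
Definition relative_face p q (i : 'I_p.+2) (g : nerve G p.+1)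
    (a : stalk (relative_sheaf p.+1 q) g) :
    stalk (relative_sheaf p q) (face i g) :=
  @induced _ _ (subsheaf_stalk (relative_subsheaf p.+1 q) g)
    (subsheaf_stalk (relative_subsheaf p q) (face i g))
    (@res_face G A R p q i g) a.

Definition relative_diff p q (h : nerve G p) (a : stalk (relative_sheaf p q) h) :
    stalk (relative_sheaf p q.+1) h :=
  @induced _ _ (subsheaf_stalk (relative_subsheaf p q) h)
    (subsheaf_stalk (relative_subsheaf p q.+1) h) (@res_diff G A R p q h) a.

Lemma relative_face_sub p q i (g : nerve G p.+1) (a : stalk (res_pullback R p.+1 q) g) :
  subsheaf_stalk (relative_subsheaf p.+1 q) g a ->
  subsheaf_stalk (relative_subsheaf p q) (face i g) (res_face i a).
Proof.
case=> [gU|->]; first by left; exact: subnerve_face.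
by right; rewrite -(subrr 0) res_face_zmod subrr.
Qed.

Lemma relative_diff_sub p q (h : nerve G p) (a : stalk (res_pullback R p q) h) :
  subsheaf_stalk (relative_subsheaf p q) h a ->
  subsheaf_stalk (relative_subsheaf p q.+1) h (res_diff a).
Proof.
case=> [hU|->]; first by left.
by right; rewrite -(subrr 0) res_diff_zmod subrr.
Qed.

Lemma relative_face_zmod p q i g : zmod_morphism (@relative_face p q i g).
Proof.
apply: induced_zmod; first exact: res_face_zmod.
exact: relative_face_sub.
Qed.

Lemma relative_diff_zmod p q h : zmod_morphism (@relative_diff p q h).
Proof.
apply: induced_zmod; first exact: res_diff_zmod.
exact: relative_diff_sub.
Qed.

Definition relative_coefficients : coefficients G :=
  Coefficients relative_face_zmod relative_diff_zmod.

Definition relative_chains (n : int) : zmodType :=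
  chains relative_coefficients n.
Definition relative_cycles (n : int) : zmodType :=
  cycles relative_coefficients n.

(* H_n(G / G'; A), computed by the resolution [R]. *)
Definition relative_homology (n : int) : zmodType :=
  homology relative_coefficients n.

Definition string_incl p (g : nerve (subgroupoid G') p) : nerve G p :=
  @String G p (sobj g) (fun i => subgroupoid_val (sarr g i))
    (fun i => sarr_rng g i) (fun i => sarr_src g i).

(* [c] is the extension of [c'] by zero. *)
Definition extends_by_zero n
    (c' : groupoid_chains (restrict_res G' R) n) (c : groupoid_chains R n) :
    Prop :=
  forall p q,
    (forall g : nerve (subgroupoid G') p,
       chain_val c p q (string_incl g) = chain_val c' p q g) /\
    (forall g : nerve G p, ~ subnerve g -> chain_val c p q g = 0).

(* [c'] is the class of [c] in the quotient double complex. *)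
Definition reduces_to n (c : groupoid_chains R n) (c' : relative_chains n) :
    Prop :=
  forall p q (g : nerve G p), chain_val c' p q g =
    quotient_class (relative_subsheaf p q) (chain_val c p q g).

End Relative.

Definition exact_at (U V W : zmodType) (f : U -> V) (g : V -> W) : Prop :=
  forall y, g y = 0 <-> exists x, f x = y.

(* Main.v *)
Require Import Defs.
From HB Require Import structures.
From mathcomp Require Import all_boot all_order all_algebra.
From mathcomp Require Import all_classical.
From mathcomp Require Import topology zify.

Import Order.TTheory GRing.Theory Num.Theory.
Local Open Scope classical_set_scope.
Local Open Scope ring_scope.

Set Implicit Arguments.
Unset Strict Implicit.
Unset Printing Implicit Defensive.

(* A compactly supported section of the quotient by the part of [S] over an
   open set [U] lifts to a compactly supported section of [S] when [S] is soft:
   local lifts exist, two of them agree outside [U], and softness allows one to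
   modify a lift near one compact set without changing it, outside [U], on a
   closed set where it is already right. The pullbacks of the sheaves of the
   resolution to the nerve are soft because the maps [tau] to the space of
   objects are local homeomorphisms. Hence, in each bidegree, extension by zero
   and reduction form a short exact sequence. It consists of chain maps, and the
   differential of a chain of [G] is again a chain, with [d d = 0] by the
   simplicial identities of the nerve. The snake lemma then applies; its three
   maps are induced by additive relations between cycles. *)

(** * Compact sets and local homeomorphisms *)

(** A sheaf of abelian groups has no cut-off functions, hence no partitions of unity. Softness
    replaces them in two places: in lifting sections through the quotient, and in proving that
    summing a compactly supported section over the fibres of a face map gives a compactly supported
    section again. Both are inductions over a compact set in which one piece is handled inside a
    chart, and in both the piece must vanish on a prescribed closed set; this is why a local form of
    softness carrying such a vanishing condition is isolated. Stalks over points that are equal only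
    propositionally are different types, so equations between their elements are proved in the étale
    space of the unpulled sheaf, where no transport is visible. Extension by zero and reduction
    remain relations between chains. A total relation closed under differences already induces an
    additive map on quotients, so no lift has to be chosen additively. *)

Section Compactness.
Variable X : topologicalType.
Implicit Types A B C K L N O U V W Z : set X.

(** If [P K] failed, the sets whose complement in [K] satisfies [P] would form a proper filter
    containing [K]; at a cluster point of it the local hypothesis is contradicted. This does the
    work of extracting a finite subcover. *)
Lemma compact_union_ind (P : set X -> Prop) K :
  P set0 -> (forall A B, P A -> P B -> P (A `|` B)) ->
  (forall A B, A `<=` B -> P B -> P A) ->
  (forall x, K x -> exists2 U, nbhs x U & P U) -> compact K -> P K.
Proof.
move=> P0 PU Psub Ploc cK; apply: contrapT => nPK.
pose F : set_system X := [set A | P (K `\` A)].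
have FF : ProperFilter F.
  apply: Build_ProperFilter_ex.
    move=> A FA; apply: contrapT => noA; apply: nPK.
    by apply: Psub FA => x Kx; split=> // Ax; apply: noA; exists x.
  split; first by rewrite /F /= setDT.
    by move=> A B FA FB; rewrite /F /= setDIr; exact: PU.
  by move=> A B AB; apply: Psub; exact: setDS.
have [x [Kx clx]] : K `&` cluster F !=set0.
  by apply: cK; rewrite /F /= setDv.
have [U nU PUx] := Ploc _ Kx.
have FU : F (~` U) by apply: Psub PUx => y [_ /contrapT].
by have [y []] := clx _ _ FU nU.
Qed.

Hypothesis hX : hausdorff_space X.

(** The Hausdorff property separates points. As [P] is symmetric, induction over a compact set can
    be applied to each of the two arguments in turn. *)
Lemma disjoint_compact_separation K L : compact K -> compact L ->
  K `&` L `<=` set0 -> exists A B,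
    [/\ open A, open B, K `<=` A, L `<=` B & A `&` B `<=` set0].
Proof.
pose P K L := exists A B : set X,
  [/\ open A, open B, K `<=` A, L `<=` B & A `&` B `<=` set0].
have Psym K' L' : P K' L' -> P L' K'.
  by move=> [A [B [oA oB KA LB AB]]]; exists B, A; split=> //; rewrite setIC.
have Pind (M K' : set X) : (forall x, K' x -> exists2 U, nbhs x U & P U M) ->
    compact K' -> P K' M.
  apply: (@compact_union_ind (P ^~ M)) => //.
  - exists set0, setT; rewrite set0I; split=> //; [exact: open0|exact: openT].
  - move=> K1 K2 [A [B [oA oB KA LB AB]]] [A' [B' [oA' oB' KA' LB' AB']]].
    exists (A `|` A'), (B `&` B'); split; [exact: openU|exact: openI| | |].
    + by move=> x [/KA|/KA']; [left|right].
    + by move=> x Mx; split; [exact: LB|exact: LB'].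
    + by move=> x [[Ax|Ax] [Bx Bx']]; [apply: AB|apply: AB'].
  - move=> K1 K2 K12 [A [B [oA oB KA LB AB]]]; exists A, B; split=> //.
    exact: subset_trans KA.
move=> cK cL KL; apply: (Pind _ _ _ cK) => x Kx.
suff [A [B [oA oB xA LB AB]]] : P [set x] L.
  exists A; first by apply: open_nbhs_nbhs; split; [exact: oA|exact: (xA x erefl)].
  by exists A, B; split.
apply: Psym; apply: (Pind _ _ _ cL) => y Ly.
have xy : x != y.
  by apply/negP => /eqP xy; apply: (KL x); split=> //; rewrite xy.
move: hX; rewrite open_hausdorff => /(_ x y xy) [[A B] /= [/[!inE] Ax By]].
move=> [oA oB AB0].
exists B; first exact: open_nbhs_nbhs.
by exists B, A; split=> // [_ ->//|]; rewrite setIC AB0.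
Qed.

Hypothesis lX : locally_compact [set: X].

Lemma locally_compact_nbhs (x : X) : exists2 C, nbhs x C & compact C.
Proof.
have [U nU [cU _]] := @lX x I.
exists U => //; move: nU; rewrite /within /=; apply: filterS => y; exact.
Qed.

Lemma compact_nbhs_sub K O : compact K -> open O -> K `<=` O ->
  exists N, [/\ open N, K `<=` N, compact (closure N) & closure N `<=` O].
Proof.
pose P A := exists N,
  [/\ open N, A `<=` N, compact (closure N) & closure N `<=` O].
move=> cK oO KO; apply: (@compact_union_ind P K) => //.
- exists set0; rewrite closure0; split=> //; [exact: open0|exact: compact0].
- move=> A B [N [oN AN cN NO]] [N' [oN' BN' cN' NO']].
  exists (N `|` N'); rewrite closureU; split; [exact: openU|exact: setUSS| |].
    exact: compactU.
  by move=> y [/NO|/NO'].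
- by move=> A B AB [N [oN BN cN NO]]; exists N; split=> //; exact: subset_trans BN.
move=> x Kx; have [C nC cC] := locally_compact_nbhs x.
have nO : nbhs x O by apply: open_nbhs_nbhs; split; [|exact: KO].
have [W nW clW] := compact_regular hX cC nC nO.
have nN : nbhs x (W `&` C)° by apply: nbhs_interior; exact: filterI.
exists (W `&` C)° => //; exists (W `&` C)°; split=> //.
- exact: open_interior.
- apply: (subclosed_compact _ cC); first exact: closed_closure.
  rewrite [X in _ `<=` X]((closure_id C).1 (compact_closed hX cC)).
  by apply: closureS => y /interior_subset [].
- by apply: subset_trans clW; apply: closureS => y /interior_subset [].
Qed.

End Compactness.

Section Charts.
Variables (X Y : topologicalType) (f : Y -> X).

(** [rho] is the inverse of [f] on [U], made total by the default value [y]; its continuity is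
    therefore asserted only at images of points of [U]. *)
Lemma local_homeo_chart (y : Y) : local_homeo f -> exists U rho,
  [/\ open U, U y, (forall V, open V -> V `<=` U -> open (f @` V)) &
      forall z, U z -> rho (f z) = z /\ {for f z, continuous (rho : X -> Y)}].
Proof.
move=> lhf; have [U [[oU Uy] iU _ ofU]] := lhf y.
pose rho x := xget y [set z | U z /\ f z = x].
have rhoK z : U z -> rho (f z) = z.
  move=> Uz; rewrite /rho; case: xgetP => [z' _ [Uz' fz']|/(_ z) H]; last first.
    by exfalso; apply: H.
  by apply: iU; rewrite ?inE.
exists U, rho; split=> // z Uz; split; first exact: rhoK.
move=> W; rewrite rhoK // => nW.
have nUW : nbhs z (U `&` W) by apply: filterI => //; exact: open_nbhs_nbhs.
apply: filterS (local_homeo_nbhs lhf nUW) => _ [z' [Uz' Wz'] <-] /=.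
by rewrite rhoK.
Qed.

Hypotheses (hX : hausdorff_space X) (hY : hausdorff_space Y).

Lemma local_homeo_locally_compact : local_homeo f ->
  locally_compact [set: X] -> locally_compact [set: Y].
Proof.
move=> lhf lX y _; have [U [rho [oU Uy ofU rhoK]]] := local_homeo_chart y lhf.
have [|||N [oN yN cN NU]] := @compact_nbhs_sub _ hX lX [set f y] (f @` U).
- exact: compact_set1.
- exact: ofU.
- by move=> _ ->; exists y.
have cC : compact (rho @` closure N).
  apply: continuous_compact cN; apply: continuous_in_subspaceT => x /[!inE].
  by move=> /NU [z Uz <-]; have [] := rhoK _ Uz.
exists (rho @` closure N); last by split=> //; exact: compact_closed.
have nN : nbhs (f y) N by apply: open_nbhs_nbhs; split=> //; exact: yN.
have := local_homeo_continuous lhf nN.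
have : nbhs y U by exact: open_nbhs_nbhs.
rewrite /within /=; apply: filterS2 => z Uz Nz _.
exists (f z); first exact: subset_closure.
by have [] := rhoK _ Uz.
Qed.

End Charts.

Lemma local_homeo_image_locally_compact (X Y : topologicalType) (f : Y -> X) :
  hausdorff_space X -> local_homeo f -> range f = setT ->
  locally_compact [set: Y] -> locally_compact [set: X].
Proof.
move=> hX lhf fT lY x _; have [y _ <-] : range f x by rewrite fT.
have [C nC cC] := locally_compact_nbhs lY y.
have cfC : compact (f @` C).
  apply: continuous_compact cC; apply: continuous_subspaceT.
  exact: local_homeo_continuous.
exists (f @` C); last by split=> //; exact: compact_closed.
have := local_homeo_nbhs lhf nC; rewrite /within /=.
by apply: filterS.
Qed.

(** * Sections of sheaves *)

Notation section_at s x := {for x, continuous (fun y => germ (s y))}.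

Lemma dprod_eq (I : Type) (V : I -> zmodType) (s t : dprod V) :
  (forall x, s x = t x) -> s = t.
Proof. exact: functional_extensionality_dep. Qed.

Section Section_theory.
Variables (X : topologicalType) (S : sheaf X).
Implicit Types (s t : dprod (stalk S)) (x : X) (K L N U V W Z : set X).

Lemma section_at_near_eq s t x :
  (\forall y \near x, s y = t y) -> section_at s x -> section_at t x.
Proof.
move=> st cs W; rewrite -(nbhs_singleton st) => nW.
have Ws : \forall y \near x, W (germ (s y)) := cs _ nW.
by move: st Ws; apply: filterS2 => y /= <-.
Qed.

Lemma section_at0 x : section_at (0 : dprod (stalk S)) x.
Proof. exact: (@section_over0 X S setT). Qed.

(** The zero section is open in the étale space. Consequently two sections that agree at a point
    agree near it, and the set where a section is nonzero is already closed. *)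
Lemma section_at_eq0 s x : section_at s x -> s x = 0 ->
  \forall y \near x, s y = 0.
Proof.
move=> cs s0.
have nZ : nbhs (germ (s x)) [set e : etale S | projT2 e = 0].
  by apply: open_nbhs_nbhs; split; [exact: open_zero|].
exact: cs nZ.
Qed.

Lemma section_at_eq s t x : section_at s x -> section_at t x -> s x = t x ->
  \forall y \near x, s y = t y.
Proof.
move=> cs ct st; have := section_at_eq0 (section_at_sub cs ct).
rewrite dprodBE st subrr => /(_ erefl); apply: filterS => y.
by rewrite dprodBE => /eqP; rewrite subr_eq0 => /eqP.
Qed.

Lemma section_support s : section_over setT s -> Defs.support s = [set x | s x != 0].
Proof.
move=> cs; apply/esym/closure_id; rewrite -openC openE => x /= /negP/negPn/eqP s0.
apply: filterS (section_at_eq0 (cs x I) s0) => y /= ->.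
by rewrite eqxx.
Qed.

Lemma compact_section_sub s K : compact K -> section_over setT s ->
  (forall x, s x != 0 -> K x) -> compact_section s.
Proof.
move=> cK cs sK; split=> //.
apply: (subclosed_compact _ cK); first exact: closed_closure.
by rewrite section_support.
Qed.

Lemma compact_sectionD s t :
  compact_section s -> compact_section t -> compact_section (s + t).
Proof.
move=> cs ct; rewrite -[t]opprK -[- t]add0r; apply: compact_sectionB => //.
by apply: compact_sectionB => //; exact: compact_section0.
Qed.

Definition cut N s : dprod (stalk S) := fun x => if pselect (N x) then s x else 0.

Lemma cutT N s x : N x -> cut N s x = s x.
Proof. by rewrite /cut; case: pselect. Qed.

Lemma cutF N s x : ~ N x -> cut N s x = 0.
Proof. by rewrite /cut; case: pselect. Qed.

(** At a boundary point of [N] the section is zero, hence zero in a neighbourhood, so the abrupt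
    truncation is not seen there. *)
Lemma cut_section N s : open N -> (forall x, closure N x -> section_at s x) ->
  (forall x, closure N x -> ~ N x -> s x = 0) -> section_over setT (cut N s).
Proof.
move=> oN cs s0 x _; have [Nx|nNx] := pselect (N x).
  apply: section_at_near_eq (cs _ (subset_closure Nx)).
  have : nbhs x N by exact: open_nbhs_nbhs.
  by apply: filterS => y Ny; rewrite cutT.
apply: (@section_at_near_eq 0); last exact: section_at0.
have [Cx|nCx] := pselect (closure N x).
  apply: filterS (section_at_eq0 (cs _ Cx) (s0 _ Cx nNx)) => y sy.
  by have [Ny|Ny] := pselect (N y); [rewrite cutT|rewrite cutF].
have : nbhs x (~` closure N).
  apply: open_nbhs_nbhs; split=> //; apply: closed_openC; exact: closed_closure.
by apply: filterS => y nCy; rewrite cutF // => /subset_closure.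
Qed.

Hypothesis hX : hausdorff_space X.

(** Agreement on the intersection of [K] and [L] spreads to an open set [O]. What remains of [K] and
    [L] outside [O] is compact and disjoint, hence separated by open sets [A] and [B]; adding [O] to
    each gives neighbourhoods that meet only inside [O]. *)
Lemma glue_sections K L U V s t : compact K -> compact L ->
  open U -> open V -> K `<=` U -> L `<=` V ->
  section_over U s -> section_over V t -> (forall x, K x -> L x -> s x = t x) ->
  exists W r, [/\ open W, K `|` L `<=` W, section_over W r,
    forall x, K x -> r x = s x & forall x, L x -> r x = t x].
Proof.
move=> cK cL oU oV KU LV cs ct st.
pose O : set X := [set x | [/\ U x, V x & s x = t x]]°.
have oO : open O := open_interior _.
have KLO x : K x -> L x -> O x.
  move=> Kx Lx; have Ux := KU _ Kx; have Vx := LV _ Lx.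
  have n1 : nbhs x U by exact: open_nbhs_nbhs.
  have n2 : nbhs x V by exact: open_nbhs_nbhs.
  have n3 := section_at_eq (cs _ Ux) (ct _ Vx) (st _ Kx Lx).
  rewrite /O /interior /=; apply: filterS3 n1 n2 n3; by split.
have cKO : compact (K `&` ~` O) by apply: compact_closedI => //; exact: open_closedC.
have cLO : compact (L `&` ~` O) by apply: compact_closedI => //; exact: open_closedC.
have [|A [B [oA oB KA LB AB]]] := disjoint_compact_separation hX cKO cLO.
  by move=> x [[Kx nOx] [Lx _]]; apply: nOx; exact: KLO.
pose A' := (A `|` O) `&` U; pose B' := (B `|` O) `&` V.
have oA' : open A' by apply: openI => //; exact: openU.
have oB' : open B' by apply: openI => //; exact: openU.
have KA' : K `<=` A'.
  move=> x Kx; split; last exact: KU.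
  by have [Ox|nOx] := pselect (O x); [right|left; apply: KA].
have LB' : L `<=` B'.
  move=> x Lx; split; last exact: LV.
  by have [Ox|nOx] := pselect (O x); [right|left; apply: LB].
have AB' x : A' x -> B' x -> s x = t x.
  have Os : O x -> s x = t x by move=> /interior_subset [].
  move=> [[Ax|/Os //] _] [[Bx|/Os //] _].
  by have := AB _ (conj Ax Bx).
pose r : dprod (stalk S) := fun x => if pselect (A' x) then s x else t x.
have rA x : A' x -> r x = s x by rewrite /r; case: pselect.
have rB x : B' x -> r x = t x.
  by move=> Bx; rewrite /r; case: pselect => // Ax; exact: AB'.
exists (A' `|` B'), r; split.
- exact: openU.
- by move=> x [/KA'|/LB']; [left|right].
- move=> x [Ax|Bx].
    apply: (@section_at_near_eq s); last by apply: cs; case: Ax.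
    have : nbhs x A' by exact: open_nbhs_nbhs.
    by apply: filterS => y /rA.
  apply: (@section_at_near_eq t); last by apply: ct; case: Bx.
  have : nbhs x B' by exact: open_nbhs_nbhs.
  by apply: filterS => y /rB.
- by move=> x /KA' /rA.
- by move=> x /LB' /rB.
Qed.

End Section_theory.

Section Pullback_sections.
Variables (X Y : topologicalType) (f : Y -> X) (cf : continuous f) (S : sheaf X).
Local Notation P := (pullback cf S).
Implicit Type s : dprod (stalk P).

(** Of the two maps defining the topology of the pullback, the projection to [Y] composed with a
    section is the identity, so only the germ in the étale space of [S] matters. *)
Lemma section_at_pullback s (y : Y) : section_at s y <->
  (fun z => germ (s z : stalk S (f z)) : etale S) @ y --> (germ (s y : stalk S (f y)) : etale S).
Proof.
pose m (e : etale P) : Y * etale S := (projT1 e, germ (projT2 e : stalk S (f (projT1 e)))).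
split=> cs W nW.
  have cm : continuous (m : etale P -> _) by exact: initial_continuous.
  have nP : nbhs (germ (s y)) (m @^-1` (setT `*` W)).
    apply: cm; exists (setT, W) => //=; split=> //; exact: filterT.
  have : nbhs y [set z | (m @^-1` (setT `*` W)) (germ (s z))] := cs _ nP.
  by apply: filterS => z [].
move: nW; rewrite nbhsE => -[_ [[B oB <-] Bab] sB].
have : nbhs (m (germ (s y))) B by exact: open_nbhs_nbhs.
move=> [[U V] /= [Uy Vb] sUV].
have Vy : nbhs y [set z | V (germ (s z : stalk S (f z)))] := cs _ Vb.
suff : nbhs y [set z | W (germ (s z))] by [].
move: Uy Vy; apply: filterS2 => z Uz Vz.
by apply: (sB (germ (s z))); apply: (sUV (z, germ (s z : stalk S (f z)))).
Qed.

End Pullback_sections.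

(** * Softness and lifting of sections *)

(** The set [Z] is where the extension must vanish: adding it to a given section then changes
    nothing on [Z]. Confining the support to [O] keeps the extension inside a chart. Both are needed
    for step-by-step corrections. *)
Definition locally_soft (Y : topologicalType) (S : sheaf Y) : Prop :=
  forall y : Y, exists O, [/\ open O, O y &
    forall (K W Z : set Y) (s : dprod (stalk S)), compact K -> K `<=` O ->
      open W -> K `<=` W -> section_over W s -> closed Z ->
      (forall x, K x -> Z x -> s x = 0) ->
      exists t : dprod (stalk S), [/\ compact_section t, Defs.support t `<=` O,
        forall x, K x -> t x = s x & forall x, Z x -> t x = 0]].

Section Soft_pullback.
Variables (X Y : topologicalType) (f : Y -> X) (cf : continuous f) (S : sheaf X).
Hypotheses (hY : hausdorff_space Y) (lY : locally_compact [set: Y]).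
Local Notation P := (pullback cf S).

(** Inside a chart, [s] on [K] is glued with zero on a second compact set [B], carried to [X] by the
    inverse of the chart, extended by softness, pulled back, and cut off outside a relatively
    compact [N]. *)
Lemma pullback_locally_soft : local_homeo f -> c_soft S -> locally_soft P.
Proof.
move=> lhf soft y; have [U [rho [oU Uy ofU rhoK]]] := local_homeo_chart y lhf.
exists U; split=> // K W Z s cK KU oW KW cs clZ s0.
have [N [oN KN cN NU]] := compact_nbhs_sub hY lY cK oU KU.
(* Besides the part of [Z] in the closure of [N], [B] contains the boundary of [N], where vanishing
   is what makes the final cut a section. *)
pose B := closure N `&` (Z `|` ~` N).
have cB : compact B.
  by apply: compact_closedI => //; apply: closedU => //; exact: open_closedC.
have [|||||W' [r [oW' KBW' cr rK rB]]] := @glue_sections _ P hY K B W U s 0 cK cB oW oU.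
- exact: KW.
- by move=> x [/NU].
- exact: cs.
- by move=> x _; exact: section_at0.
- by move=> x Kx [_ [Zx|[]]]; [exact: s0|exact: KN].
pose O := W' `&` U.
have oO : open O by exact: openI.
have KBO : K `|` B `<=` O.
  by move=> x KBx; split; [exact: KBW'|case: KBx => [/KU|[/NU]]].
(* Off the image of the chart [f (rho x)] may differ from [x]; [stalk_at] then gives zero. *)
pose sg : dprod (stalk S) := fun x => stalk_at x (germ (r (rho x) : stalk S (f (rho x)))).
have sgE z : U z -> sg (f z) = r z.
  by move=> /rhoK [rz _]; rewrite /sg rz stalk_at_germ.
have csg : section_over (f @` O) sg.
  move=> _ [z [W'z Uz] <-] G; rewrite sgE // => nG.
  have n1 : nbhs z [set z' | G (germ (r z' : stalk S (f z')))].
    exact: ((section_at_pullback r z).1 (cr _ W'z) _ nG).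
  have nO : nbhs z O by apply: open_nbhs_nbhs; split.
  suff : nbhs (f z) [set x | G (germ (sg x))] by [].
  apply: filterS (local_homeo_nbhs lhf (filterI nO n1)).
  by move=> _ [z' [[_ Uz'] Gz'] <-]; rewrite /= sgE.
have [|||t [ct [V [oV KV VO tV]]]] := soft (f @` (K `|` B)) (f @` O) sg _ _ _ csg.
- apply: continuous_compact; last exact: compactU.
  exact: continuous_subspaceT.
- by apply: ofU => // x [].
- by move=> _ [z /KBO Oz <-]; exists z.
pose p : dprod (stalk P) := fun z => t (f z).
have pE z : (K `|` B) z -> p z = r z.
  move=> KBz; rewrite /p tV; last by apply: KV; exists z.
  by rewrite sgE //; have [] := KBO _ KBz.
have cp z : section_at p z.
  apply/section_at_pullback => G nG.
  exact: (@cf z [set x | G (germ (t x))] (ct (f z) I G nG)).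
have bdN x : closure N x -> ~ N x -> p x = 0.
  by move=> Cx nNx; rewrite pE ?rB //; [split=> //; right|right; split=> //; right].
have ccut : section_over setT (cut N p) by exact: cut_section.
have cutN x : cut N p x != 0 -> closure N x.
  have [Nx _|nNx] := pselect (N x); first exact: subset_closure.
  by rewrite cutF // eqxx.
exists (cut N p); split.
- exact: compact_section_sub cN ccut cutN.
- by rewrite section_support // => x /cutN /NU.
- by move=> x Kx; rewrite cutT ?pE ?rK //; [left|exact: KN].
- move=> x Zx; have [Nx|nNx] := pselect (N x); last by rewrite cutF.
  have Bx : B x by split; [exact: subset_closure|left].
  by rewrite cutT // pE ?rB //; right.
Qed.

End Soft_pullback.

(** * Sections of a quotient sheaf and their local lifts *)

Section Quotient_sections.
Variables (X : topologicalType) (S : sheaf X) (N : subsheaf S).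
Local Notation Q := (quotient_sheaf N).

Lemma quotient_classP x (a b : stalk S x) :
  quotient_class N a = quotient_class N b <-> subsheaf_stalk N x (a - b).
Proof.
rewrite /quotient_class; split.
  by move/eqP; rewrite -Quotient.idealrBE => /subgroup_predP.
by move=> ab; apply/eqP; rewrite -Quotient.idealrBE; apply/subgroup_predP.
Qed.

Lemma quotient_class_zmod x : zmod_morphism (@quotient_class X S N x).
Proof. by move=> a b; rewrite /quotient_class raddfB. Qed.

Definition quotient_family (s : dprod (stalk S)) : dprod (stalk Q) :=
  fun x => quotient_class N (s x).

Lemma quotient_section_at s x : section_at s x -> section_at (quotient_family s) x.
Proof.
move=> cs W; rewrite nbhsE => -[B [oB Bx] BW].
have oB' : open [set e : etale S | B (germ (quotient_class N (projT2 e) : stalk Q (projT1 e)))].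
  exact: oB.
have : nbhs x [set y | B (germ (quotient_family s y))].
  by apply: (cs _ (open_nbhs_nbhs (conj oB' _))).
by apply: filterS => y /BW.
Qed.

(** A representative of [t x] extends to a local section of [S]; its class agrees with [t] at [x],
    hence near [x]. *)
Lemma quotient_local_lift t x : section_at (t : dprod (stalk Q)) x ->
  exists U s, [/\ open U, U x, section_over U s &
    forall y, U y -> quotient_class N (s y) = t y].
Proof.
move=> ct; have [s [U [oU Ux cs sx]]] := local_section (germ (repr (t x) : stalk S x)).
have {}sx : s x = repr (t x) by exact: germ_inj sx.
have nE : \forall y \near x, quotient_family s y = t y.
  apply: section_at_eq => //; first by apply: quotient_section_at; exact: cs.
  by rewrite /quotient_family sx; exact: reprK.
exists (U `&` [set y | quotient_family s y = t y]°), s; split.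
- by apply: openI => //; exact: open_interior.
- by split.
- by move=> y [Uy _]; exact: cs.
- by move=> y [_ /interior_subset].
Qed.

Lemma quotient_compact_section s :
  compact_section s -> compact_section (quotient_family s).
Proof.
move=> [cs ks]; apply: (compact_section_sub ks).
  by move=> x _; apply: quotient_section_at; exact: cs.
move=> x qs; apply: subset_closure; apply: contra_neq qs => s0.
by rewrite /quotient_family s0 -(subrr 0) quotient_class_zmod subrr.
Qed.

End Quotient_sections.

(** * Lifting compactly supported sections modulo the part over an open set *)

Section Lift.
Variables (X : topologicalType) (S : sheaf X) (U : set X) (oU : open U).
Hypotheses (hX : hausdorff_space X) (lX : locally_compact [set: X]).
Hypothesis softS : locally_soft S.
Local Notation N := (zero_outside S oU).
Local Notation Q := (quotient_sheaf N).

Lemma quotient_class_outside x (a b : stalk S x) : ~ U x ->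
  (quotient_class N a = quotient_class N b <-> a = b).
Proof.
move=> nUx; rewrite quotient_classP /=; split.
  by move=> [//|/eqP]; rewrite subr_eq0 => /eqP.
by move=> ->; right; rewrite subrr.
Qed.

Lemma quotient_class_inside x (a b : stalk S x) : U x ->
  quotient_class N a = quotient_class N b.
Proof. by move=> Ux; apply/quotient_classP; left. Qed.

Lemma quotient_lift (t : dprod (stalk Q)) : compact_section t ->
  exists2 s, compact_section s & quotient_family N s = t.
Proof.
move=> [ct kt]; pose q := quotient_family N.
(* The induction needs this stronger claim: any section already correct on part of [Z] can be
   corrected on [K] without changing its class on [Z]. *)
pose L K := forall s0 Z, compact_section s0 -> closed Z ->
  (forall x, K x -> Z x -> q s0 x = t x) ->
  exists s, [/\ compact_section s, forall x, K x -> q s x = t x &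
    forall x, Z x -> q s x = q s0 x].
(* [L] concerns closed sets, while the induction produces arbitrary ones; quantifying over all
   closed subsets of a closed superset makes the property pass to subsets and unions. *)
pose P A := exists2 C, A `<=` C /\ closed C & forall D, closed D -> D `<=` C -> L D.
have [W [oW KW cW _]] := compact_nbhs_sub hX lX kt openT (fun _ _ => I).
have [C [WC clC] LC] : P (closure W).
  apply: compact_union_ind cW.
  - exists set0; first by split=> //; exact: closed0.
    by move=> D _ D0 s0 Z cs0 _ _; exists s0; split=> // x /D0.
  - move=> A B [CA [ACA clA] LA] [CB [BCB clB] LB]; exists (CA `|` CB).
      by split; [move=> x [/ACA|/BCB]; [left|right]|exact: closedU].
    move=> D clD DC s0 Z cs0 clZ s0Z.
    have [|||s1 [cs1 s1A s1Z]] := LA (D `&` CA) _ _ s0 Z cs0 clZ.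
    + exact: closedI.
    + by move=> x [].
    + by move=> x [Dx _]; exact: s0Z.
    (* The second correction preserves not only [Z] but also the part where the first one was
       made. *)
    have [||||s2 [cs2 s2B s2Z]] := LB (D `&` CB) _ _ s1 (Z `|` (D `&` CA)) cs1.
    + exact: closedI.
    + by move=> x [].
    + by apply: closedU => //; exact: closedI.
    + move=> x [Dx Bx] [Zx|Ax]; last exact: s1A.
      by rewrite s1Z //; exact: s0Z.
    exists s2; split=> // x.
      move=> Dx; have [Ax|Bx] := DC _ Dx; last by apply: s2B.
      rewrite s2Z; [exact: s1A|by right].
    by move=> Zx; rewrite s2Z ?s1Z //; left.
  - move=> A B AB [CB [BCB clB] LB]; exists CB => //; split=> //.
    exact: subset_trans BCB.
  move=> x _; have [V [v [oV Vx cv vt]]] := quotient_local_lift (ct x I).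
  have [O [oO Ox softO]] := softS x.
  have VOx : [set x] `<=` V `&` O by move=> _ ->.
  have [A [oA xA cA AVO]] := compact_nbhs_sub hX lX (@compact_set1 _ x) (openI oV oO) VOx.
  exists A; first by apply: open_nbhs_nbhs; split; [|exact: xA].
  exists (closure A); first by split; [exact: subset_closure|exact: closed_closure].
  move=> D clD DA s0 Z cs0 clZ s0Z.
  have cD : compact (D `&` ~` U).
    apply: compact_closedI; last exact: open_closedC.
    exact: subclosed_compact cA DA.
  (* The correction [d] is the error [v - s0], prescribed only outside [U]: over [U] the quotient
     has zero stalks and any value is right. *)
  have [||||||d [cd _ dD dZ]] := softO (D `&` ~` U) V (Z `&` ~` U) (v - s0) cD.
  + by move=> y [/DA /AVO []].
  + exact: oV.
  + by move=> y [/DA /AVO []].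
  + move=> y Vy; apply: section_at_sub; first exact: cv.
    by case: cs0 => cs0 _; exact: cs0.
  + by apply: closedI => //; exact: open_closedC.
  + move=> y [Dy nUy] [Zy _]; rewrite dprodBE.
    apply/eqP; rewrite subr_eq0; apply/eqP; apply/(quotient_class_outside _ _ nUy).
    by rewrite vt; [rewrite -s0Z|have [] := AVO _ (DA _ Dy)].
  exists (s0 + d); split.
  + exact: compact_sectionD.
  + move=> y Dy; have [Uy|nUy] := pselect (U y).
      by rewrite -vt; [exact: quotient_class_inside|have [] := AVO _ (DA _ Dy)].
    rewrite -vt; last by have [] := AVO _ (DA _ Dy).
    apply/(quotient_class_outside _ _ nUy).
    change (s0 y + d y = v y).
    by rewrite dD // dprodBE addrC subrK.
  + move=> y Zy; have [Uy|nUy] := pselect (U y); first exact: quotient_class_inside.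
    apply/(quotient_class_outside _ _ nUy).
    change (s0 y + d y = s0 y).
    by rewrite dZ // addr0.
have t0 x : ~ W x -> t x = 0.
  move=> nWx; apply: contrapT => tx; apply: nWx; apply: KW.
  by apply: subset_closure; apply/eqP.
have q0 x : q 0 x = 0.
  by rewrite /q /quotient_family dprod0E -(subrr 0) quotient_class_zmod subrr.
(* Starting from zero with the complement of [W] preserved, the result is right on the closure of
   [W], and outside [W], where [t] vanishes. *)
have [||s [cs sW sZ]] := LC _ (@closed_closure _ W) WC 0 (~` W) (@compact_section0 _ S).
- exact: open_closedC.
- by move=> x _ nWx; rewrite t0.
exists s => //; apply: dprod_eq => x; have [Wx|nWx] := pselect (W x).
  by apply: sW; exact: subset_closure.
by rewrite t0 // -(q0 x); apply: sZ.
Qed.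

End Lift.

(** * The nerve of an étale groupoid *)

(** The sets containing a box around [z] form a filter, the index type being finite. The product
    topology is a supremum of initial topologies, so convergence of this filter is checked one
    coordinate at a time. *)
Lemma prod_topology_box (I : finType) (X : topologicalType)
    (z : prod_topology (fun _ : I => X)) (W : set (prod_topology (fun _ : I => X))) :
  nbhs z W -> exists A : I -> set X, (forall k, nbhs (z k) (A k)) /\
    forall z' : prod_topology (fun _ : I => X), (forall k, A k (z' k)) -> W z'.
Proof.
pose F : set_system (prod_topology (fun _ : I => X)) :=
  [set W | exists A : I -> set X, (forall k, nbhs (z k) (A k)) /\
    forall z', (forall k, A k (z' k)) -> W z'].
have FF : Filter F.
  split; first by exists (fun=> setT); split=> // k; exact: filterT.
  - move=> U V [A [nA AU]] [B [nB BV]]; exists (fun k => A k `&` B k); split.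
      by move=> k; exact: filterI.
    by move=> z' AB; split; [apply: AU => k|apply: BV => k]; case: (AB k).
  - by move=> U V UV [A [nA AU]]; exists A; split=> // z' /AU /UV.
suff : F --> z by exact.
apply/cvg_sup => i U; rewrite nbhsE => -[_ [[B oB <-] Bz] sB].
exists (fun k => if k == i then B else setT); split.
  move=> k; case: eqP => [->|_]; last exact: filterT.
  by apply: open_nbhs_nbhs; split.
by move=> z' /(_ i); rewrite eqxx => Bz'; apply: sB.
Qed.

Lemma continuous_inj_hausdorff (X Y : topologicalType) (f : X -> Y) :
  continuous f -> injective f -> hausdorff_space Y -> hausdorff_space X.
Proof.
move=> cf fi hY x y cl; apply: fi; apply: hY => A B nA nB.
by have [z [Az Bz]] := cl _ _ (cf _ _ nA) (cf _ _ nB); exists (f z).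
Qed.

Section Nerve_topology.
Variable G : etale_groupoid.

Lemma nerve_box n (g : nerve G n) (W : set (nerve G n)) : nbhs g W ->
  exists (A : 'I_n.+1 -> set (obj G)) (B : 'I_n -> set (arr G)),
    [/\ forall k, nbhs (sobj g k) (A k), forall k, nbhs (sarr g k) (B k) &
      forall h : nerve G n, (forall k, A k (sobj h k)) ->
        (forall k, B k (sarr h k)) -> W h].
Proof.
rewrite nbhsE => -[_ [[O oO <-] Og] sO].
have : nbhs (string_val g) O by exact: open_nbhs_nbhs.
move=> [[U V] /= [/prod_topology_box [A [nA AU]] /prod_topology_box [B [nB BV]]] UV].
exists A, B; split=> // h Ah Bh; apply: sO; apply: UV; split; [exact: AU|exact: BV].
Qed.

Lemma nerve_box_nbhs n (g : nerve G n) (A : 'I_n.+1 -> set (obj G))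
    (B : 'I_n -> set (arr G)) :
  (forall k, nbhs (sobj g k) (A k)) -> (forall k, nbhs (sarr g k) (B k)) ->
  nbhs g [set h : nerve G n | (forall k, A k (sobj h k)) /\ (forall k, B k (sarr h k))].
Proof.
move=> nA nB.
have n1 : nbhs g [set h : nerve G n | forall k, A k (sobj h k)].
  apply: (@filter_forall (nerve G n) 'I_n.+1 (fun k h => A k (sobj h k)) (nbhs g)).
  by move=> k; exact: (@sobj_continuous G n k g _ (nA k)).
have n2 : nbhs g [set h : nerve G n | forall k, B k (sarr h k)].
  apply: (@filter_forall (nerve G n) 'I_n (fun k h => B k (sarr h k)) (nbhs g)).
  by move=> k; exact: (@sarr_continuous G n k g _ (nB k)).
by move: n1 n2; apply: filterS2.
Qed.

Lemma nerve_continuousP (T : topologicalType) n (f : T -> nerve G n) (x : T) :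
  (forall k, {for x, continuous (fun y => sobj (f y) k)}) ->
  (forall k, {for x, continuous (fun y => sarr (f y) k)}) ->
  {for x, continuous f}.
Proof.
move=> co ca W /nerve_box [A [B [nA nB AB]]].
have n1 : nbhs x [set y | forall k, A k (sobj (f y) k)].
  apply: (@filter_forall T 'I_n.+1 (fun k y => A k (sobj (f y) k)) (nbhs x)).
  by move=> k; exact: (co k _ (nA k)).
have n2 : nbhs x [set y | forall k, B k (sarr (f y) k)].
  apply: (@filter_forall T 'I_n (fun k y => B k (sarr (f y) k)) (nbhs x)).
  by move=> k; exact: (ca k _ (nB k)).
suff : nbhs x [set y | W (f y)] by [].
by move: n1 n2; apply: filterS2 => y /AB.
Qed.

(** A string can be moved along with its first object: with a local inverse of the range map near
    each arrow, a nearby object [y] determines the first arrow, whose source determines the second,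
    and so on. The resulting string depends continuously on [y]. *)
Lemma tau_nbhs n (g : nerve G n) (W : set (nerve G n)) :
  nbhs g W -> nbhs (tau g) ((@tau G n) @` W).
Proof.
have lr := @grng_local_homeo G.
(* The index is a natural number, with a default beyond [n], so that the objects [x k y] can be
   defined by plain recursion on [k]. *)
have H (k : nat) : exists rho : obj G -> arr G, forall kn : (k < n)%N,
    [/\ rho (sobj g (ordl (Ordinal kn))) = sarr g (Ordinal kn),
      {for sobj g (ordl (Ordinal kn)), continuous rho} &
      \forall x \near sobj g (ordl (Ordinal kn)), grng (rho x) = x].
  have [kn|nk] := pselect (k < n)%N; last first.
    by exists (fun=> gid (sobj g ord0)) => kn; exfalso; apply: nk.
  have [U [rho [oU Ug ofU rhoK]]] := local_homeo_chart (sarr g (Ordinal kn)) lr.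
  exists rho => kn'; rewrite (bool_irrelevance kn' kn) -sarr_rng.
  have [rg crho] := rhoK _ Ug; split=> //.
  have : nbhs (grng (sarr g (Ordinal kn))) (@grng G @` U).
    by apply: open_nbhs_nbhs; split; [exact: ofU|exists (sarr g (Ordinal kn))].
  by apply: filterS => _ [a Ua <-]; have [->] := rhoK _ Ua.
have [rho rhoP] := choice H => /nerve_box [A [B [nA nB AB]]].
pose x := fix x (k : nat) (y : obj G) : obj G :=
  if k is k'.+1 then gsrc (rho k' (x k' y)) else y.
have xP (k : nat) : forall kn : (k < n.+1)%N,
    x k (tau g) = sobj g (Ordinal kn) /\ {for tau g, continuous (x k)}.
  elim: k => [|k IH] kn.
    split; last by [].
    by rewrite /tau /=; congr sobj; exact: val_inj.
  have kn' : (k < n.+1)%N by exact: ltnW.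
  have [xk cx] := IH kn'; have [rk crho _] := rhoP k kn.
  have E : ordl (Ordinal (kn : (k < n)%N)) = Ordinal kn' by exact: val_inj.
  rewrite E in rk crho; split.
    by rewrite /= xk rk sarr_src; congr sobj; exact: val_inj.
  have cr : {for tau g, continuous (rho k \o x k)}.
    by apply: continuous_comp => //; rewrite xk.
  apply: (@continuous_comp _ _ _ (rho k \o x k) (@gsrc G)) => //.
  exact: (local_homeo_continuous (@gsrc_local_homeo G)).
have xo (k : 'I_n.+1) : \forall y \near tau g, A k (x k y).
  case: k => k kn; have [xk cx] := xP k kn.
  have nk := nA (Ordinal kn); rewrite -xk in nk; exact: (cx _ nk).
have crho (k : 'I_n) : \forall y \near tau g, B k (rho k (x k y)) /\
    grng (rho k (x k y)) = x k y.
  have [xk cx] := xP k (ltn_ord (ordl k)).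
  have [rk cr gr] := rhoP k (ltn_ord k).
  have E1 : ordl (Ordinal (ltn_ord k)) = Ordinal (ltn_ord (ordl k)) by exact: val_inj.
  have E2 : Ordinal (ltn_ord k) = k by exact: val_inj.
  rewrite E1 -xk in rk cr gr; rewrite E2 in rk.
  have nBk := nB k; rewrite -rk in nBk.
  have n1 : nbhs (tau g) [set y | B k (rho k (x k y))] := cx _ (cr _ nBk).
  have n2 : nbhs (tau g) [set y | grng (rho k (x k y)) = x k y] := cx _ gr.
  by move: n1 n2; apply: filterS2.
have n1 : nbhs (tau g) [set y | forall k : 'I_n.+1, A k (x k y)].
  exact: (@filter_forall _ 'I_n.+1 (fun k y => A k (x k y)) (nbhs (tau g))).
have n2 : nbhs (tau g) [set y | forall k : 'I_n, B k (rho k (x k y)) /\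
    grng (rho k (x k y)) = x k y].
  exact: (@filter_forall _ 'I_n (fun k y => B k (rho k (x k y)) /\
    grng (rho k (x k y)) = x k y) (nbhs (tau g))).
move: n1 n2; apply: filterS2 => y Ay By.
pose h : nerve G n := @String G n (fun k => x k y) (fun k => rho k (x k y))
  (fun k => (By k).2) (fun k => erefl).
exists h => //; apply: AB => k; [exact: Ay|exact: (By k).1].
Qed.

(** When every arrow stays where the range map is injective, the first object determines the first
    arrow, its source the next one, and so on. *)
Lemma tau_locally_inj n (g : nerve G n) :
  exists2 U, nbhs g U & set_inj U (@tau G n).
Proof.
have H (k : 'I_n) : exists U : set (arr G), nbhs (sarr g k) U /\ set_inj U (@grng G).
  by have [U nU iU] := local_homeo_inj (@grng_local_homeo G) (sarr g k); exists U.
have [U UP] := choice H.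
exists [set h : nerve G n | (forall k, setT (sobj h k)) /\ (forall k, U k (sarr h k))].
  by apply: (@nerve_box_nbhs n g (fun=> setT) U) => k; [exact: filterT|case: (UP k)].
move=> h h' /[!inE] -[_ Uh] [_ Uh'] hh'.
have E (k : nat) : forall kn : (k < n.+1)%N, sobj h (Ordinal kn) = sobj h' (Ordinal kn).
  elim: k => [|k IH] kn.
    by rewrite (_ : Ordinal kn = ord0) //; exact: val_inj.
  have kn' : (k < n.+1)%N by exact: ltnW.
  have E1 : Ordinal kn' = ordl (Ordinal (kn : (k < n)%N)) by exact: val_inj.
  have E2 : Ordinal kn = ordr (Ordinal (kn : (k < n)%N)) by exact: val_inj.
  rewrite E2 -!sarr_src; congr gsrc.
  apply: (UP (Ordinal (kn : (k < n)%N))).2; rewrite ?inE //.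
  by rewrite !sarr_rng -E1.
have Eo : sobj h = sobj h' by apply/funext => -[k kn]; exact: E.
apply: string_eq => //; apply/funext => k.
by apply: (UP k).2; rewrite ?inE // !sarr_rng Eo.
Qed.

Lemma tau_local_homeo n : local_homeo (@tau G n).
Proof.
apply: local_homeoI.
- exact: tau_continuous.
- exact: tau_nbhs.
- exact: tau_locally_inj.
Qed.

(* Two-out-of-three: [a] is open since [e] and [e \o a] are local
   homeomorphisms. *)
Lemma open_of_local_homeo_comp (X Y Z : topologicalType) (a : X -> Y) (e : Y -> Z) :
  continuous a -> continuous e ->
  (forall x V, nbhs x V -> nbhs (e (a x)) ((e \o a) @` V)) ->
  (forall y : Y, exists2 U : set Y, nbhs y U & set_inj U e) ->
  forall x V, nbhs x V -> nbhs (a x) (a @` V).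
Proof.
move=> ca ce oea ie x V nV; have [U nU iU] := ie (a x).
have nVU : nbhs x (V `&` a @^-1` U) by apply: filterI => //; exact: ca.
have n1 : nbhs (a x) (e @^-1` ((e \o a) @` (V `&` a @^-1` U))).
  exact: ce (oea _ _ nVU).
move: n1 nU; apply: filterS2 => y [x' [Vx' Ux'] exy] Uy.
by exists x' => //; apply: iU; rewrite ?inE.
Qed.

Lemma sarr0_nbhs n (g : nerve G n.+1) (W : set (nerve G n.+1)) :
  nbhs g W -> nbhs (sarr g ord0) ((fun h : nerve G n.+1 => sarr h ord0) @` W).
Proof.
apply: (@open_of_local_homeo_comp (nerve G n.+1) (arr G) (obj G)
  (fun h : nerve G n.+1 => sarr h ord0) (@grng G)).
- exact: sarr_continuous.
- exact: (local_homeo_continuous (@grng_local_homeo G)).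
- move=> h V nV; rewrite sarr_rng (_ : ordl ord0 = ord0); last exact: val_inj.
  rewrite (_ : _ \o _ = @tau G n.+1); first exact: tau_nbhs.
  by apply/funext => h' /=; rewrite sarr_rng; congr sobj; exact: val_inj.
- exact: local_homeo_inj (@grng_local_homeo G).
Qed.

Lemma face_continuous n (i : 'I_n.+2) :
  continuous (face i : nerve G n.+1 -> nerve G n).
Proof.
move=> g; apply: nerve_continuousP => k.
  exact: (@sobj_continuous G n.+1 (lift i k)).
rewrite /=; case: (k.+1 < i)%N; first exact: sarr_continuous.
case: (k.+1 == i)%N; last exact: sarr_continuous.
move=> W.
have gc (h : nerve G n.+1) : gsrc (sarr h (ordl k)) = grng (sarr h (ordr k)).
  by rewrite sarr_src sarr_rng; congr sobj; exact: val_inj.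
have /subspace_continuousP /(_ (sarr g (ordl k), sarr g (ordr k)) (gc g)) := @gmul_continuous G.
move=> /(_ W) /[apply] -[[U V] /= [nU nV] UV].
have n1 : nbhs g [set h : nerve G n.+1 | U (sarr h (ordl k))].
  exact: (@sarr_continuous G n.+1 (ordl k) g _ nU).
have n2 : nbhs g [set h : nerve G n.+1 | V (sarr h (ordr k))].
  exact: (@sarr_continuous G n.+1 (ordr k) g _ nV).
suff : nbhs g [set h : nerve G n.+1 | W (gmul (sarr h (ordl k)) (sarr h (ordr k)))] by [].
move: n1 n2; apply: filterS2 => h Uh Vh.
exact: (UV (sarr h (ordl k), sarr h (ordr k)) (conj Uh Vh) (gc h)).
Qed.

(** Openness follows from that of [tau] composed with the face: this is [tau] itself when [i] is not
    zero, and the source of the first arrow when [i] is zero. *)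
Lemma face_local_homeo n (i : 'I_n.+2) :
  local_homeo (face i : nerve G n.+1 -> nerve G n).
Proof.
apply: local_homeoI.
- exact: face_continuous.
- apply: (@open_of_local_homeo_comp _ _ _ (face i : nerve G n.+1 -> nerve G n) (@tau G n)).
  + exact: face_continuous.
  + exact: tau_continuous.
  + move=> g V nV; have [i0|i0] := eqVneq i ord0.
      have E (h : nerve G n.+1) : tau (face i h) = gsrc (sarr h ord0).
        by rewrite sarr_src i0 /tau /=; congr sobj; exact: val_inj.
      rewrite E (_ : _ \o _ = @gsrc G \o (fun h : nerve G n.+1 => sarr h ord0)); last first.
        by apply/funext => h; exact: E.
      rewrite [X in nbhs _ X](_ : _ =
        @gsrc G @` ((fun h : nerve G n.+1 => sarr h ord0) @` V)); last by rewrite image_comp.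
      apply: (local_homeo_nbhs (@gsrc_local_homeo G)).
      exact: sarr0_nbhs.
    have E (h : nerve G n.+1) : tau (face i h) = tau h.
      rewrite /tau /=; congr sobj; apply: val_inj => /=.
      by rewrite /bump leqNgt lt0n; case: eqP i0 => // /eqP; rewrite -(inj_eq val_inj) /= => ->.
    rewrite E (_ : _ \o _ = @tau G n.+1); first exact: tau_nbhs.
    by apply/funext => h; exact: E.
  + exact: tau_locally_inj.
- exact: face_locally_inj.
Qed.

Hypotheses (hausG : hausdorff_space (arr G)) (lcG : locally_compact [set: arr G]).

(** The topological hypotheses bear on the arrows alone; the objects inherit this one because [gid]
    embeds them. *)
Lemma obj_hausdorff : hausdorff_space (obj G).
Proof.
apply: (continuous_inj_hausdorff (@gid_continuous G)) => //.
by move=> x y /(congr1 (@gsrc G)); rewrite !gsrc_id.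
Qed.

Lemma obj_locally_compact : locally_compact [set: obj G].
Proof.
apply: local_homeo_image_locally_compact lcG.
- exact: obj_hausdorff.
- exact: grng_local_homeo.
- by rewrite -subTset => x _; exists (gid x) => //; rewrite grng_id.
Qed.

Lemma nerve_hausdorff n : hausdorff_space (nerve G n).
Proof.
move=> g h cl; apply: string_eq; apply/funext => k.
  apply: obj_hausdorff => A B nA nB.
  have [z [Az Bz]] := cl _ _ (@sobj_continuous G n k g _ nA) (@sobj_continuous G n k h _ nB).
  by exists (sobj z k).
apply: hausG => A B nA nB.
have [z [Az Bz]] := cl _ _ (@sarr_continuous G n k g _ nA) (@sarr_continuous G n k h _ nB).
by exists (sarr z k).
Qed.

Lemma nerve_locally_compact n : locally_compact [set: nerve G n].
Proof.
apply: (local_homeo_locally_compact obj_hausdorff (@nerve_hausdorff n) (@tau_local_homeo n)).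
exact: obj_locally_compact.
Qed.

End Nerve_topology.

(** * Summation over the fibres of the faces *)

Section Delta_face_values.
Variables (G : etale_groupoid) (C : coefficients G).

Lemma cface0 p q i (g : nerve G p.+1) :
  cface i (0 : stalk (csheaf C p.+1 q) g) = 0.
Proof. by rewrite -(subrr 0) cface_zmod subrr. Qed.

Lemma stalk_at0 p q (h g : nerve G p) :
  stalk_at h (germ (0 : stalk (csheaf C p q) g)) = 0.
Proof. by rewrite -(subrr 0) stalk_at_zmod subrr. Qed.

Lemma delta_face_eq0 p q i (t : dprod (stalk (csheaf C p.+1 q))) h :
  (forall g, face i g = h -> t g = 0) -> delta_face i t h = 0.
Proof. by move=> t0; apply: fsbig1 => g /t0 ->; rewrite cface0 stalk_at0. Qed.

Lemma delta_face_eq1 p q i (t : dprod (stalk (csheaf C p.+1 q))) g :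
  (forall g', face i g' = face i g -> t g' != 0 -> g' = g) ->
  delta_face i t (face i g) = cface i (t g).
Proof.
move=> tg; rewrite /delta_face -(@fsbig_widen _ _ _ _ [set g]).
- by rewrite fsbig_set1 stalk_at_germ.
- by move=> _ ->.
- move=> g' [/= fg' g'g]; have [->|/(tg _ fg') //] := eqVneq (t g') 0.
  by rewrite cface0 stalk_at0.
Qed.

(** The list [r] may be longer than the support of [t] in the fibre, so that one list can serve two
    families compared term by term. *)
Lemma delta_face_sum p q i (t : dprod (stalk (csheaf C p.+1 q))) h
    (r : seq (nerve G p.+1)) : uniq r ->
  (forall g, g \in r -> face i g = h) ->
  (forall g, face i g = h -> t g != 0 -> g \in r) ->
  delta_face i t h = \sum_(g <- r) stalk_at h (germ (cface i (t g))).
Proof.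
move=> ur rh tr; rewrite fsbig_seq //; apply/esym/fsbig_widen.
  by move=> g /rh.
move=> g [/= gh gr]; have [->|/(tr _ gh) //] := eqVneq (t g) 0.
by rewrite /= cface0 stalk_at0.
Qed.

End Delta_face_values.

(** Continuity of the action is given on the fibre product [act_pair]; the point is that [a] and
    [e], matching at every point, define a continuous map into it. *)
Lemma etale_act_continuous (G : etale_groupoid) (S : gsheaf G)
    (T : topologicalType) (a : T -> arr G) (e : T -> etale S) (x : T) :
  (forall y, etale_proj (e y) = gsrc (a y)) ->
  {for x, continuous a} -> {for x, continuous e} ->
  {for x, continuous (fun y => etale_act (@act G S) (a y) (e y))}.
Proof.
move=> ea ca ce.
pose j y : act_pair S := existT _ (a y) (stalk_at (gsrc (a y)) (e y)).
have cj : {for x, continuous j}.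
  move=> W; rewrite nbhsE => -[_ [[B oB <-] Bx] sB].
  have : nbhs (a x, e x) B.
    by apply: open_nbhs_nbhs; split=> //; move: Bx; rewrite /act_pair_val /= germ_stalk_at.
  move=> [[U V] /= [Ux Vx] UV].
  have n1 : nbhs x [set y | U (a y)] := ca _ Ux.
  have n2 : nbhs x [set y | V (e y)] := ce _ Vx.
  suff : nbhs x [set y | W (j y)] by [].
  move: n1 n2; apply: filterS2 => y Uy Vy; apply: sB.
  rewrite /= /act_pair_val /= germ_stalk_at //.
  exact: (UV (a y, e y)).
exact: (@continuous_comp _ _ _ j (fun y : act_pair S => germ (act (projT2 y)) : etale S)
  x cj (@act_cont G S _)).
Qed.

Section Groupoid_delta.
Variables (G : etale_groupoid) (A : gsheaf G) (R : soft_resolution A).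
Local Notation C := (groupoid_coefficients R).

(* The germ in the étale space of the unpulled sheaf: a common home for the
   stalks over different strings. *)
Definition base_germ p q (g : nerve G p) (a : stalk (csheaf C p q) g) :
    etale (res R q) :=
  @germ (obj G) (res R q) (tau g) a.

Lemma base_germ_inj p q (g : nerve G p) : injective (@base_germ p q g).
Proof. by move=> a b; exact: germ_inj. Qed.

Lemma base_germ_stalk_at p q (g h : nerve G p) (a : stalk (csheaf C p q) g) :
  g = h -> base_germ (stalk_at h (germ a)) = base_germ a.
Proof. by move=> <-; rewrite stalk_at_germ. Qed.

Lemma tau_face0 p (g : nerve G p.+1) :
  tau (face ord0 g) = gsrc (sarr g ord0).
Proof. by rewrite sarr_src /tau /=; congr sobj; exact: val_inj. Qed.

Lemma tau_faceS p (i : 'I_p.+2) (g : nerve G p.+1) : i != ord0 ->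
  tau (face i g) = tau g.
Proof.
move=> i0; rewrite /tau /=; congr sobj; apply: val_inj => /=.
by rewrite /bump leqNgt lt0n; case: eqP i0 => // /eqP; rewrite -(inj_eq val_inj) /= => ->.
Qed.

Lemma grng_sarr0 p (g : nerve G p.+1) : grng (sarr g ord0) = tau g.
Proof. by rewrite sarr_rng /tau; congr sobj; exact: val_inj. Qed.

Lemma base_germ_face p q (i : 'I_p.+2) (g : nerve G p.+1)
    (a : stalk (csheaf C p.+1 q) g) :
  base_germ (cface i a) =
  if i == ord0 then etale_act (@act G (res R q)) (ginv (sarr g ord0)) (base_germ a)
  else base_germ a.
Proof.
rewrite /base_germ /cface /= /res_face; case: eqP => [->|/eqP i0].
  by rewrite germ_stalk_at // -[RHS]/(tau (face ord0 g)) tau_face0 -grng_inv.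
by rewrite germ_stalk_at // -[RHS]/(tau (face i g)) tau_faceS.
Qed.

Lemma base_germ_continuous p q (t : dprod (stalk (csheaf C p q))) g :
  section_at t g <-> {for g, continuous (fun g => base_germ (t g))}.
Proof. exact: section_at_pullback. Qed.

Lemma face_germ_continuous p q (i : 'I_p.+2)
    (t : dprod (stalk (csheaf C p.+1 q))) (g : nerve G p.+1) :
  section_at t g -> {for g, continuous (fun g => base_germ (cface i (t g)))}.
Proof.
move=> /base_germ_continuous ct.
have -> : (fun g : nerve G p.+1 => base_germ (cface i (t g))) = fun g =>
    if i == ord0
    then etale_act (@act G (res R q)) (ginv (sarr g ord0)) (base_germ (t g))
    else base_germ (t g).
  by apply/funext => h; exact: base_germ_face.
case: (i == ord0); last exact: ct.
apply: etale_act_continuous => //.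
  by move=> h; rewrite gsrc_inv grng_sarr0.
apply: (@continuous_comp _ _ _ (fun g : nerve G p.+1 => sarr g ord0) (@ginv G)).
  exact: sarr_continuous.
exact: ginv_continuous.
Qed.

Lemma vertical_compact p q (t : dprod (stalk (csheaf C p q))) :
  compact_section t -> compact_section (vertical t).
Proof.
move=> [ct kt]; apply: (compact_section_sub kt).
  move=> g _; apply/base_germ_continuous.
  have cg := (base_germ_continuous t g).1 (ct g I).
  exact: (@continuous_comp _ _ _ (fun g => base_germ (t g))
    (fun e : etale (res R q) => germ (res_d R q (projT1 e) (projT2 e)) : etale (res R q.+1))
    g cg (@gmor_cont _ _ _ (res_d R q) _)).
move=> g vt; apply: subset_closure; apply: contra_neq vt => t0.
by rewrite /vertical t0 -(subrr 0) cdiff_zmod subrr.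
Qed.

Hypotheses (hausG : hausdorff_space (arr G)) (lcG : locally_compact [set: arr G]).

Lemma res_pullback_locally_soft p q : locally_soft (csheaf C p q).
Proof.
apply: pullback_locally_soft.
- exact: nerve_hausdorff.
- exact: nerve_locally_compact.
- exact: tau_local_homeo.
- exact: res_soft.
Qed.

(** Each fibre meets the support at most once, so near the image of the support the sum is [t]
    carried along a local homeomorphism. The image is compact, hence closed, and the sum vanishes
    off it. *)
Lemma delta_face_chart p q (i : 'I_p.+2) (U : set (nerve G p.+1))
    (t : dprod (stalk (csheaf C p.+1 q))) :
  open U -> set_inj U (face i) ->
  compact_section t -> Defs.support t `<=` U -> compact_section (delta_face i t).
Proof.
move=> oU iU [ct kt] tU.
have tsupp g : t g != 0 -> Defs.support t g.
  by move=> tg; exact: subset_closure.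
have cK : compact (face i @` Defs.support t : set (nerve G p)).
  apply: continuous_compact kt; apply: continuous_subspaceT.
  exact: face_continuous.
have clK := compact_closed (@nerve_hausdorff G hausG p) cK.
have d0 h : ~ (face i @` Defs.support t : set (nerve G p)) h -> delta_face i t h = 0.
  move=> nh; apply: delta_face_eq0 => g gh; apply: contrapT => /eqP /tsupp tg.
  by apply: nh; exists g.
have dU g : U g -> delta_face i t (face i g) = cface i (t g).
  move=> Ug; apply: delta_face_eq1 => g' gg' /tsupp /tU Ug'.
  by apply: iU; rewrite ?inE.
apply: (compact_section_sub cK); last first.
  by move=> h dh; apply: contrapT => /d0 /eqP; rewrite (negbTE dh).
move=> h _; have [[g tg <-]|nh] := pselect ((face i @` Defs.support t : set (nerve G p)) h).
  apply/base_germ_continuous => W; rewrite dU; last exact: tU.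
  move=> nW.
  have n1 : nbhs g [set g | W (base_germ (cface i (t g)))].
    exact: (face_germ_continuous (i := i) (ct g I) nW).
  have n2 : nbhs g U by apply: open_nbhs_nbhs; split=> //; exact: tU.
  suff : nbhs (face i g : nerve G p) [set h | W (base_germ (delta_face i t h))] by [].
  apply: filterS (local_homeo_nbhs (@face_local_homeo G p i) (filterI n1 n2)).
  by move=> _ [g' [Wg' Ug'] <-]; rewrite /= dU.
apply: (@section_at_near_eq _ _ 0); last exact: section_at0.
have : nbhs h (~` (face i @` Defs.support t : set (nerve G p))).
  by apply: open_nbhs_nbhs; split=> //; exact: closed_openC.
by apply: filterS => h' /d0.
Qed.

(** Softness splits [t] into finitely many sections, each supported where the face is injective;
    [delta_face_chart] applies to each, and [delta_face] is additive on compact sections. *)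
Lemma delta_face_compact p q (i : 'I_p.+2) (t : dprod (stalk (csheaf C p.+1 q))) :
  compact_section t -> compact_section (delta_face i t).
Proof.
pose D (t : dprod (stalk (csheaf C p.+1 q))) := compact_section (delta_face i t).
(* [P K] lets a neighbourhood of [K] be added to any open set [O'] for whose sections the claim is
   known. Unions are then immediate, and the induction ends with [O'] empty. *)
pose P (K : set (nerve G p.+1)) := exists2 O : set (nerve G p.+1), open O /\ K `<=` O &
  forall O', open O' ->
    (forall t, compact_section t -> Defs.support t `<=` O' -> D t) ->
    forall t, compact_section t -> Defs.support t `<=` O `|` O' -> D t.
move=> ct; suff [O [oO tO] DO] : P (Defs.support t).
  apply: (DO set0) => //; first exact: open0.
  - move=> s cs s0; suff -> : s = 0.
      rewrite /D (_ : delta_face i 0 = 0); first exact: compact_section0.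
      by apply: dprod_eq => h; exact: delta_face_eq0.
    apply: dprod_eq => g; apply: contrapT => /eqP sg.
    exact: s0 g (@subset_closure _ [set x | s x != 0] g sg).
  - by move=> g /tO; left.
apply: compact_union_ind (ct.2).
- by exists set0; [split=> //; exact: open0|move=> O' _; rewrite set0U].
- move=> K1 K2 [O1 [oO1 KO1] D1] [O2 [oO2 KO2] D2]; exists (O1 `|` O2).
    by split; [exact: openU|move=> x [/KO1|/KO2]; [left|right]].
  move=> O' oO' DO' s cs; rewrite -setUA; apply: D1 => //; first exact: openU.
  exact: D2.
- move=> K1 K2 K12 [O2 [oO2 KO2] D2]; exists O2 => //; split=> //.
  exact: subset_trans KO2.
move=> g _; have [U [oU Ug iU]] : exists U, [/\ open U, U g & set_inj U (face i)].
  by have [U [[oU Ug] iU _ _]] := @face_local_homeo G p i g; exists U.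
have [O [oO Og softO]] := @res_pullback_locally_soft p.+1 q g.
exists (U `&` O); first by apply: open_nbhs_nbhs; split=> //; exact: openI.
exists (U `&` O); first by split=> //; exact: openI.
move=> O' oO' DO' s cs sO.
have cl' : closed (~` O') by exact: open_closedC.
have cK : compact (Defs.support s `&` ~` O') by apply: compact_closedI => //; case: cs.
have KUO : Defs.support s `&` ~` O' `<=` U `&` O.
  by move=> x [/sO [|]].
have [N [oN KN cN NUO]] := compact_nbhs_sub (@nerve_hausdorff G hausG p.+1)
  (@nerve_locally_compact G hausG lcG p.+1) cK (openI oU oO) KUO.
have s0 x : ~ O' x -> ~ N x -> s x = 0.
  move=> nO' nN; apply: contrapT => /eqP sx; apply: nN; apply: KN; split=> //.
  exact: subset_closure.
(* [s1] equals [s] on the closure of [N] outside [O'] and vanishes off [N]. Off both [O'] and [N],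
   [s] is zero, so [s - s1] is supported in [O']. *)
have [|||||||s1 [cs1 _ s1K s1Z]] := softO (closure N `&` ~` O') setT (~` N) s.
- exact: compact_closedI.
- by move=> x [/NUO []].
- exact: openT.
- by [].
- by case: cs.
- exact: open_closedC.
- by move=> x [_ nO'x] nNx; exact: s0.
have D1 : D s1.
  apply: (delta_face_chart oU iU cs1); rewrite section_support; last by case: cs1.
  move=> x /= s1x; have [/subset_closure/NUO [] //|/s1Z s1x0] := pselect (N x).
  by rewrite s1x0 eqxx in s1x.
have D2 : D (s - s1).
  have cs' := compact_sectionB cs cs1.
  apply: DO' => //; rewrite section_support; last by case: cs'.
  move=> x /= sx; apply: contrapT => nO'x; move/eqP: sx; apply.
  rewrite dprodBE; have [Cx|nCx] := pselect (closure N x).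
    by rewrite s1K ?subrr.
  have nNx : ~ N x by move=> /subset_closure.
  by rewrite s0 // s1Z // subrr.
have E : delta_face i s = delta_face i (s - s1) + delta_face i s1.
  by rewrite delta_faceB // subrK.
rewrite /D E.
exact: compact_sectionD.
Qed.

Lemma compact_section_sign (X : topologicalType) (S : sheaf X)
    (t : dprod (stalk S)) n :
  compact_section t -> compact_section (t *~ (-1) ^+ n).
Proof.
move=> ct; rewrite -signr_odd; case: (odd n); rewrite ?expr0 ?expr1 ?mulr1z //.
rewrite mulrN1z -sub0r; apply: compact_sectionB => //.
exact: compact_section0.
Qed.

Lemma delta_compact p q (t : dprod (stalk (csheaf C p.+1 q))) :
  compact_section t -> compact_section (delta t).
Proof.
move=> ct; rewrite /delta; apply: (@big_ind _ (@compact_section _ (csheaf C p q))).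
- exact: compact_section0.
- exact: compact_sectionD.
- by move=> i _; apply: compact_section_sign; exact: delta_face_compact.
Qed.

End Groupoid_delta.

(** * Simplicial identities *)

Section Partial_additivity.
Variables (V W : zmodType) (P : V -> Prop) (f : V -> W).
Hypotheses (P0 : P 0) (PB : forall x y, P x -> P y -> P (x - y)).
Hypothesis fB : forall x y, P x -> P y -> f (x - y) = f x - f y.

(** These rules serve [delta], whose additivity is known only on compact sections, since a sum with
    infinitely many nonzero terms takes a default value. With [P] constantly true they also cover
    [vertical] and the quotient maps. *)
Lemma partial_raddf0 : f 0 = 0.
Proof. by rewrite -[X in f X](subrr 0) fB // subrr. Qed.

Lemma partial_raddfN x : P x -> P (- x) /\ f (- x) = - f x.
Proof.
move=> Px; split; first by rewrite -sub0r; exact: PB.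
by rewrite -[in LHS]sub0r fB // partial_raddf0 sub0r.
Qed.

Lemma partial_raddfD x y : P x -> P y -> P (x + y) /\ f (x + y) = f x + f y.
Proof.
move=> Px Py; have [PNy fNy] := partial_raddfN Py.
by split; [rewrite -[y]opprK; exact: PB|rewrite -[y in LHS]opprK fB // fNy opprK].
Qed.

Lemma partial_raddf_sign x n : P x ->
  P (x *~ (-1) ^+ n) /\ f (x *~ (-1) ^+ n) = f x *~ (-1) ^+ n.
Proof.
move=> Px; rewrite -signr_odd; case: (odd n); rewrite ?expr0 ?expr1 ?mulr1z //.
by rewrite !mulrN1z; exact: partial_raddfN.
Qed.

Lemma partial_raddf_sum I (r : seq I) (F : I -> V) : (forall i, P (F i)) ->
  P (\sum_(i <- r) F i) /\ f (\sum_(i <- r) F i) = \sum_(i <- r) f (F i).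
Proof.
move=> PF; elim: r => [|i r [Pr fr]]; first by rewrite !big_nil partial_raddf0.
by rewrite !big_cons -fr; exact: partial_raddfD.
Qed.

End Partial_additivity.

Lemma zmod_morphism_sum (V W : zmodType) (f : V -> W) : zmod_morphism f ->
  forall I (r : seq I) (P : pred I) F, f (\sum_(i <- r | P i) F i) = \sum_(i <- r | P i) f (F i).
Proof.
move=> fB I r P F; have f0 : f 0 = 0 by rewrite -[X in f X](subrr 0) fB subrr.
apply: (big_morph f) => // x y.
by rewrite -[y in LHS]opprK fB -[- y]sub0r fB f0 sub0r opprK.
Qed.

Lemma sum_fibres (I J : eqType) (V : zmodType) (r : seq I) (s : seq J) (f : I -> J)
    (F : I -> V) : uniq s -> (forall i, i \in r -> f i \in s) ->
  \sum_(j <- s) \sum_(i <- r | f i == j) F i = \sum_(i <- r) F i.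
Proof.
move=> us fs; rewrite (exchange_big_dep xpredT) //= big_seq [RHS]big_seq.
apply: eq_bigr => i ir; rewrite -big_filter.
rewrite (eq_filter (a2 := pred1 (f i))) ?filter_pred1_uniq ?big_seq1 ?fs //.
Qed.

(* [D i j] plays the role of the composite of the [i]th and [j]th faces. *)
Lemma alternating_sum_eq0 (V : zmodType) n (D : 'I_n.+1 -> 'I_n.+2 -> V) :
  (forall i j : 'I_n.+1, (i <= j)%N ->
     D i (lift ord0 j) = D j (widen_ord (leqnSn n.+1) i)) ->
  \sum_(i < n.+1) \sum_(j < n.+2) D i j *~ (-1) ^+ j *~ (-1) ^+ i = 0.
Proof.
move=> DE; pose F (i : 'I_n.+1) (j : 'I_n.+2) := D i j *~ (-1) ^+ j *~ (-1) ^+ i.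
have E (i : 'I_n.+1) : \sum_(j < n.+2) F i j =
    \sum_(j < n.+1 | (i <= j)%N) F i (lift ord0 j) +
    \sum_(j < n.+1 | (j <= i)%N) F i (widen_ord (leqnSn n.+1) j).
  rewrite (bigID (fun j : 'I_n.+2 => (i < j)%N)) /=; congr (_ + _).
    rewrite big_mkcond big_ord_recl /= add0r [RHS]big_mkcond /=.
    by apply: eq_bigr => j _; rewrite /bump leq0n add1n ltnS.
  rewrite big_mkcond big_ord_recr /= (ltn_ord i) /= addr0 [RHS]big_mkcond /=.
  by apply: eq_bigr => j _; rewrite -leqNgt.
rewrite (eq_bigr _ (fun i _ => E i)) big_split /=.
rewrite (exchange_big_dep xpredT) //= -big_split big1 //= => j _.
have -> : \sum_(i < n.+1 | (i <= j)%N) F i (lift ord0 j) =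
    \sum_(i < n.+1 | (i <= j)%N) - F j (widen_ord (leqnSn n.+1) i).
  apply: eq_bigr => i ij; rewrite /F DE //= -!mulrzA /bump leq0n add1n exprS.
  by rewrite mulN1r mulNr mulrNz mulrC.
by rewrite sumrN addNr.
Qed.

Section Simplicial.
Variable G : etale_groupoid.

Section Arrows.
Variables (n : nat) (i : 'I_n.+2) (g : nerve G n.+1) (k : 'I_n).

Lemma sarr_face_lt : (k.+1 < i)%N -> sarr (face i g) k = sarr g (ordl k).
Proof. by move=> ki; rewrite /= ki. Qed.

Lemma sarr_face_eq : k.+1 = i ->
  sarr (face i g) k = gmul (sarr g (ordl k)) (sarr g (ordr k)).
Proof. by move=> ki; rewrite /= ki ltnn eqxx. Qed.

Lemma sarr_face_gt : (i < k.+1)%N -> sarr (face i g) k = sarr g (ordr k).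
Proof. by move=> ki; rewrite /= ltnNge (ltnW ki) /= gtn_eqF. Qed.

End Arrows.

Lemma sarr_composable n (g : nerve G n.+1) (k : 'I_n) :
  gsrc (sarr g (ordl k)) = grng (sarr g (ordr k)).
Proof. by rewrite sarr_src sarr_rng; congr sobj; exact: val_inj. Qed.

(** This is the identity for the faces [i] and [j + 1]. The arrows are compared according to the
    position of [k + 1] relative to [i] and [j]; associativity enters only when all three
    coincide. *)
Lemma face_face n (g : nerve G n.+2) (i j : 'I_n.+2) : (i <= j)%N ->
  face i (face (lift ord0 j) g) = face j (face (widen_ord (leqnSn n.+2) i) g).
Proof.
move=> ij; set j' := lift ord0 j; set i' := widen_ord _ i.
have j'E : j' = j.+1 :> nat by [].
have i'E : i' = i :> nat by [].
have lr (k : 'I_n) : ordl (ordr k) = ordr (ordl k) by exact: val_inj.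
have vl m (k : 'I_m) : ordl k = k :> nat by [].
have vr m (k : 'I_m) : ordr k = k.+1 :> nat by [].
apply: string_eq; apply/funext => k.
  rewrite /=; congr sobj; apply: val_inj; rewrite /= /bump leq0n add1n.
  case: (leqP i k) => ik; case: (leqP j k) => jk /=; rewrite ?add0n ?add1n ?ltnS;
  (try case: leqP); (try case: leqP); lia.
case: (ltngtP k.+1 i) => ki.
- rewrite sarr_face_lt // sarr_face_lt ?vl ?j'E; last by lia.
  by rewrite sarr_face_lt; [rewrite sarr_face_lt // vl|lia].
- rewrite sarr_face_gt //; case: (ltngtP k.+1 j) => kj.
  + rewrite sarr_face_lt ?vr ?j'E //; rewrite [RHS]sarr_face_lt //.
    by rewrite sarr_face_gt ?vl ?i'E // lr.
  + rewrite sarr_face_gt ?vr ?j'E //; rewrite [RHS]sarr_face_gt //.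
    by rewrite sarr_face_gt ?vr ?i'E //; lia.
  + rewrite sarr_face_eq ?vr ?j'E ?kj //; rewrite [RHS]sarr_face_eq //.
    rewrite !(@sarr_face_gt n.+1 i') ?vl ?vr ?i'E ?lr //; lia.
- rewrite sarr_face_eq // sarr_face_lt ?vl ?j'E; last by lia.
  case: (ltngtP k.+1 j) => kj; [|lia|].
  + rewrite sarr_face_lt ?vr ?j'E //; rewrite [RHS]sarr_face_lt //.
    by rewrite sarr_face_eq ?vl ?i'E // lr.
  + rewrite sarr_face_eq ?vr ?j'E ?kj //; rewrite [RHS]sarr_face_eq //.
    rewrite (@sarr_face_eq n.+1 i') ?vl ?i'E // (@sarr_face_gt n.+1 i') ?vr ?i'E; last by lia.
    rewrite lr; apply: gmulA; [|rewrite -lr]; exact: (@sarr_composable n.+1).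
Qed.

(** Needed because the face of index zero acts by the inverse of the first arrow, which may be a
    product. The proposed inverse is a right inverse of [c], and multiplying on the left by [ginv c]
    identifies it. *)
Lemma ginvM (a b : arr G) : gsrc a = grng b ->
  ginv (gmul a b) = gmul (ginv b) (ginv a).
Proof.
move=> ab; set c := gmul a b.
have sc : gsrc c = gsrc b by exact: gsrc_mul.
have rc : grng c = grng a by exact: grng_mul.
have ba : gsrc (ginv b) = grng (ginv a) by rewrite gsrc_inv grng_inv.
have E : gmul c (gmul (ginv b) (ginv a)) = gid (grng a).
  have cb : gmul c (ginv b) = a by rewrite /c -gmulA ?grng_inv // gmul_inv -ab gmul_idr.
  by rewrite gmulA ?cb ?gmul_inv // sc grng_inv.
rewrite -[LHS]gmul_idr gsrc_inv rc -E gmulA; last first.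
- by rewrite sc grng_mul // grng_inv.
- by rewrite gsrc_inv.
by rewrite ginv_mul sc -[gsrc b]grng_inv -[grng (ginv b)](grng_mul ba) gmul_idl.
Qed.

End Simplicial.

(** * The double complex of a groupoid *)

Lemma finite_set_seq (T : choiceType) (B : set T) : finite_set B ->
  exists r : seq T, uniq r /\ forall k, (k \in r) = (k \in B).
Proof.
move=> fB; exists (finmap.enum_fset (fset_set B)); split; first exact: finmap.fset_uniq.
by move=> k; rewrite -(in_fset_set fB).
Qed.

Section Delta_face_comp.
Variables (G : etale_groupoid) (C : coefficients G).

Lemma finite_face_support p q (i : 'I_p.+2) (h : nerve G p)
    (t : dprod (stalk (csheaf C p.+1 q))) : compact_section t ->
  finite_set ([set g : nerve G p.+1 | face i g = h] `&` [set g | t g != 0]).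
Proof.
move=> [_ kt]; apply: (sub_finite_set _ (face_fibre_finite i h kt)).
by move=> g [gh tg]; split=> //; apply: (@subset_closure _ [set g | t g != 0]).
Qed.

Lemma finite_face_face_support p q (i : 'I_p.+2) (j : 'I_p.+3) (h : nerve G p)
    (t : dprod (stalk (csheaf C p.+2 q))) : compact_section t ->
  finite_set ([set g : nerve G p.+2 | face i (face j g) = h] `&` [set g | t g != 0]).
Proof.
move=> ct; have [_ kt] := ct.
have ck : compact (face j @` Defs.support t : set (nerve G p.+1)).
  apply: continuous_compact kt; apply: continuous_subspaceT.
  exact: face_continuous.
apply: (sub_finite_set _ (bigcup_finite (face_fibre_finite i h ck)
  (fun g _ => finite_face_support j g ct))).
move=> g [gh tg]; exists (face j g) => //; split=> //; exists g => //.
exact: (@subset_closure _ [set g | t g != 0]).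
Qed.

Lemma delta_face_comp p q (i : 'I_p.+2) (j : 'I_p.+3) (h : nerve G p)
    (t : dprod (stalk (csheaf C p.+2 q))) (r : seq (nerve G p.+2)) : uniq r ->
  (forall k, k \in r -> face i (face j k) = h) ->
  (forall k, face i (face j k) = h -> t k != 0 -> k \in r) ->
  delta_face i (delta_face j t) h =
  \sum_(k <- r) stalk_at h (germ (cface i (cface j (t k)))).
Proof.
(* [s] lists the intermediate strings. It contains every string of the fibre over [h] at which the
   inner sum is nonzero, and regrouping [r] over [s] turns the double sum into a single one. *)
move=> ur rh tr; pose s := undup [seq (face j k : nerve G p.+1) | k <- r].
rewrite (@delta_face_sum _ _ _ _ _ _ _ s); first last.
- move=> g gh; apply: contra_neqT => gs; apply: delta_face_eq0 => k kg.
  apply: contrapT => /eqP tk; move/negP: gs; apply.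
  by rewrite mem_undup -kg; apply: map_f; apply: tr; rewrite ?kg.
- by move=> g; rewrite mem_undup => /mapP [k kr ->]; exact: rh.
- exact: undup_uniq.
rewrite -(@sum_fibres _ _ _ r s (fun k => face j k : nerve G p.+1)) ?undup_uniq //; last first.
  by move=> k kr; rewrite mem_undup; exact: map_f.
rewrite big_seq [RHS]big_seq; apply: eq_bigr => g; rewrite mem_undup => /mapP [k0 k0r gE].
have gh : face i g = h by rewrite gE; exact: rh.
rewrite (@delta_face_sum _ _ _ _ _ _ _ [seq k <- r | (face j k : nerve G p.+1) == g]); first last.
- by move=> k kg tk; rewrite mem_filter kg eqxx /=; apply: tr; rewrite ?kg.
- by move=> k; rewrite mem_filter => /andP [/eqP].
- exact: filter_uniq.
have fB : zmod_morphism (fun a : stalk (csheaf C p.+1 q) g => stalk_at h (germ (cface i a))).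
  by move=> a b; rewrite cface_zmod stalk_at_zmod.
rewrite (zmod_morphism_sum fB) big_filter; apply: eq_bigr => k /eqP kg.
by rewrite -kg stalk_at_germ.
Qed.

End Delta_face_comp.

Section Double_complex.
Variables (G : etale_groupoid) (A : gsheaf G) (R : soft_resolution A).
Local Notation C := (groupoid_coefficients R).

Lemma etale_actM (S : gsheaf G) (a b : arr G) (e : etale S) : gsrc a = grng b ->
  etale_proj e = gsrc b ->
  etale_act (@act G S) (gmul a b) e = etale_act (@act G S) a (etale_act (@act G S) b e).
Proof.
case: e => x u; rewrite /etale_proj /= => ab xb; move: u; rewrite xb => u.
exact: act_mul.
Qed.

(** Only a face of index zero moves the germ. If [i] and [j] are both zero, the inverse of a product
    acts on one side and the two inverses act successively on the other; if only [i] is zero, both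
    sides act by the inverse of the same first arrow. *)
Lemma base_germ_face_face p q (k : nerve G p.+2) (i j : 'I_p.+2)
    (a : stalk (csheaf C p.+2 q) k) : (i <= j)%N ->
  base_germ (cface i (cface (lift ord0 j) a)) =
  base_germ (cface j (cface (widen_ord (leqnSn p.+2) i) a)).
Proof.
move=> ij; rewrite !base_germ_face.
have -> : (lift ord0 j == ord0) = false by [].
have -> : (widen_ord (leqnSn p.+2) i == ord0) = (i == ord0) by [].
have [i0|i0] := eqVneq i ord0; last first.
  by case: eqP ij => // ->; rewrite leqn0 => /eqP iz; case/eqP: i0; exact: val_inj.
have [j0|j0] := eqVneq j ord0.
  rewrite i0 j0 sarr_face_eq // sarr_face_gt // ginvM; last exact: sarr_composable.
  have -> : ordl (ord0 : 'I_p.+1) = ord0 by exact: val_inj.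
  rewrite etale_actM //.
    rewrite gsrc_inv grng_inv; apply/esym.
    by have := sarr_composable k (ord0 : 'I_p.+1); congr (gsrc (sarr _ _) = _); exact: val_inj.
  by rewrite gsrc_inv grng_sarr0.
rewrite sarr_face_lt; last by rewrite /= /bump /= add1n ltnS lt0n.
by congr (etale_act _ (ginv (sarr _ _))); exact: val_inj.
Qed.

Lemma delta_face_face p q (i j : 'I_p.+2) (t : dprod (stalk (csheaf C p.+2 q))) :
  (i <= j)%N -> compact_section t ->
  delta_face i (delta_face (lift ord0 j) t) =
  delta_face j (delta_face (widen_ord (leqnSn p.+2) i) t).
Proof.
move=> ij ct; apply: dprod_eq => h.
have [r [ur rB]] := finite_set_seq (finite_face_face_support i (lift ord0 j) h ct).
rewrite (@delta_face_comp _ _ _ _ _ _ _ _ r); first last.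
- by move=> k kh tk; rewrite rB inE.
- by move=> k; rewrite rB inE => -[].
- exact: ur.
rewrite (@delta_face_comp _ _ _ _ _ _ _ _ r); first last.
- by move=> k kh tk; rewrite rB inE; split=> //=; rewrite face_face.
- by move=> k; rewrite rB inE => -[/= <- _]; rewrite face_face.
- exact: ur.
rewrite big_seq [RHS]big_seq; apply: eq_bigr => k; rewrite rB inE => -[/= kh _].
apply: base_germ_inj; rewrite !base_germ_stalk_at //.
  exact: base_germ_face_face.
by rewrite -face_face.
Qed.

Definition base_diff q (e : etale (res R q)) : etale (res R q.+1) :=
  germ (res_d R q (projT1 e) (projT2 e)).

Lemma base_diff_act q (g : arr G) (e : etale (res R q)) : etale_proj e = gsrc g ->
  base_diff (etale_act (@act G _) g e) = etale_act (@act G _) g (base_diff e).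
Proof.
case: e => x u; rewrite /etale_proj /= => xg; move: u; rewrite xg => u.
by rewrite /etale_act /base_diff !stalk_at_germ /= gmor_act.
Qed.

Lemma base_germ_diff p q (g : nerve G p) (a : stalk (csheaf C p q) g) :
  base_germ (cdiff a) = base_diff (base_germ a).
Proof. by []. Qed.

Lemma delta_face_vertical p q (i : 'I_p.+2) (t : dprod (stalk (csheaf C p.+1 q))) :
  compact_section t -> delta_face i (vertical t) = vertical (delta_face i t).
Proof.
move=> ct; apply: dprod_eq => h.
have [r [ur rB]] := finite_set_seq (finite_face_support i h ct).
rewrite (@delta_face_sum _ _ _ _ _ _ _ r); first last.
- move=> k kh tk; rewrite rB inE; split=> //=; apply: contra_neq tk => tk.
  by rewrite /vertical tk -(subrr 0) cdiff_zmod subrr.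
- by move=> k; rewrite rB inE => -[].
- exact: ur.
rewrite /vertical (@delta_face_sum _ _ _ _ _ _ _ r); first last.
- by move=> k kh tk; rewrite rB inE.
- by move=> k; rewrite rB inE => -[].
- exact: ur.
rewrite (zmod_morphism_sum (@cdiff_zmod _ C _ _ h)) big_seq [RHS]big_seq.
apply: eq_bigr => k; rewrite rB inE => -[/= kh _].
apply: base_germ_inj; rewrite base_germ_diff !base_germ_stalk_at // !base_germ_face.
rewrite base_germ_diff; case: eqP => // _.
by rewrite base_diff_act // gsrc_inv grng_sarr0.
Qed.

Lemma vertical_vertical p q (t : dprod (stalk (csheaf C p q))) :
  vertical (vertical t) = 0.
Proof.
apply: dprod_eq => h; rewrite /vertical /= /res_diff.
by apply/(res_exact (s := R)); exists (t h).
Qed.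

Hypotheses (hausG : hausdorff_space (arr G)) (lcG : locally_compact [set: arr G]).

Let cs0 p q := @compact_section0 _ (csheaf C p q).
Let csB p q := @compact_sectionB _ (csheaf C p q).

Lemma delta_face_delta p q (i : 'I_p.+2) (t : dprod (stalk (csheaf C p.+2 q))) :
  compact_section t ->
  delta_face i (delta t) = \sum_(j < p.+3) delta_face i (delta_face j t) *~ (-1) ^+ j.
Proof.
move=> ct; have cf j := @delta_face_compact _ _ R hausG lcG _ q j t ct.
have dB (x y : dprod (stalk (csheaf C p.+1 q))) := @delta_faceB _ C p q i x y.
rewrite /delta (partial_raddf_sum (@cs0 p.+1 q) (@csB p.+1 q) dB _ _).2; last first.
  by move=> j; exact: compact_section_sign.
apply: eq_bigr => j _.
by rewrite (partial_raddf_sign (@cs0 p.+1 q) (@csB p.+1 q) dB j (cf j)).2.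
Qed.

Lemma delta_delta p q (t : dprod (stalk (csheaf C p.+2 q))) :
  compact_section t -> delta (delta t) = 0.
Proof.
move=> ct; pose D (i : 'I_p.+2) (j : 'I_p.+3) := delta_face i (delta_face j t).
rewrite -[RHS](@alternating_sum_eq0 _ p.+1 D); last first.
  by move=> i j ij; exact: delta_face_face.
apply: eq_bigr => i _; rewrite delta_face_delta //.
by rewrite mulrz_suml.
Qed.

Lemma delta_vertical p q (t : dprod (stalk (csheaf C p.+1 q))) :
  compact_section t -> delta (vertical t) = vertical (delta t).
Proof.
move=> ct; have cf i := @delta_face_compact _ _ R hausG lcG _ q i t ct.
have vB (x y : dprod (stalk (csheaf C p q))) (_ : True) (_ : True) := @verticalB _ C p q x y.
rewrite /delta (partial_raddf_sum I (fun _ _ _ _ => I) vB _ _).2 //.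
apply: eq_bigr => i _; rewrite delta_face_vertical //.
by rewrite (partial_raddf_sign I (fun _ _ _ _ => I) vB i I).2.
Qed.

End Double_complex.

(** * Chains and the total differential *)

Section Chains.
Variables (G : etale_groupoid) (C : coefficients G).

Lemma Gammac_ex (X : topologicalType) (S : sheaf X) (s : dprod (stalk S)) :
  compact_section s -> exists s' : Gammac S, Gammac_val s' = s.
Proof.
move=> cs; exists (exist _ s (introT (subgroup_predP
  (Subgroup (@compact_section0 _ S) (@compact_sectionB _ S)) s) cs)).
by [].
Qed.

Lemma Gammac_val_eq0 (X : topologicalType) (S : sheaf X) (s : Gammac S) :
  (Gammac_val s != 0) = (s != 0).
Proof.
apply/idP/idP; first by apply: contra_neq => ->.
by apply: contra_neq => s0; exact: val_inj.
Qed.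

Variable n : int.

(** Apart from group operations, chains are constructed only through this lemma, which hides the
    nested subtypes. *)
Lemma chain_ex (f : families C) :
  (forall p q, compact_section (f p q)) ->
  finite_set [set pq : nat * nat | f pq.1 pq.2 != 0] ->
  (forall p q : nat, f p q != 0 -> p%:Z - q%:Z = n) ->
  exists c : chains C n, chain_families c = f.
Proof.
move=> cf ff fn; pose c : Gammac_families C := fun p q => projT1 (cid (Gammac_ex (cf p q))).
have cE p q : Gammac_val (component c p q) = f p q.
  by rewrite /component /c; case: cid.
have c0 p q : (c p q != 0) = (f p q != 0) by rewrite -Gammac_val_eq0 -cE.
have cc : chain_set n c.
  split; last by move=> p q; rewrite c0; exact: fn.
  by apply: sub_finite_set ff => -[p q] /=; rewrite c0.
exists (exist _ c (introT (subgroup_predP (Subgroup (chain_set0 C n) (@chain_setB _ C n)) c) cc)).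
by apply: dprod_eq => p; apply: dprod_eq => q; exact: cE.
Qed.

Implicit Type c : chains C n.

Lemma chain_set_val c : chain_set n (val c).
Proof. by apply: asboolW; exact: (valP c). Qed.

Lemma chain_val_compact c p q : compact_section (chain_val c p q).
Proof. exact: GammacP. Qed.

Lemma chain_val_finite c : finite_set [set pq : nat * nat | chain_val c pq.1 pq.2 != 0].
Proof.
apply: sub_finite_set (chain_set_val c).1 => -[p q] /=.
by rewrite /chain_val Gammac_val_eq0.
Qed.

Lemma chain_val_degree c (p q : nat) : chain_val c p q != 0 -> p%:Z - q%:Z = n.
Proof. by rewrite /chain_val Gammac_val_eq0; exact: (chain_set_val c).2. Qed.

Lemma chain_eq c c' : chain_families c = chain_families c' -> c = c'.
Proof.
move=> cc'; apply: val_inj; apply: dprod_eq => p; apply: dprod_eq => q; apply: val_inj.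
exact: (congr1 (fun f : families C => f p q) cc').
Qed.

Lemma delta0 p q : delta (0 : dprod (stalk (csheaf C p.+1 q))) = 0.
Proof.
have c0 := @compact_section0 _ (csheaf C p.+1 q).
by rewrite -[X in delta X](subrr 0) deltaB // subrr.
Qed.

Lemma vertical0 p q : vertical (0 : dprod (stalk (csheaf C p q))) = 0.
Proof. by rewrite -[X in vertical X](subrr 0) verticalB subrr. Qed.

(** Both the degree and the finiteness of the differential are read off from the two bidegrees that
    contribute to [(p, q)]. *)
Lemma tot_d_neq0 c p q : (tot_d c : families C) p q != 0 ->
  chain_val c p.+1 q != 0 \/ exists2 q', q = q'.+1 & chain_val c p q' != 0.
Proof.
have [c0|c0] := eqVneq (chain_val c p.+1 q) 0; last by move=> _; left.
rewrite /tot_d c0 delta0 add0r; case: q c0 => [|q] _; first by rewrite eqxx.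
have [v0|v0] := eqVneq (chain_val c p q) 0; last by move=> _; right; exists q.
by rewrite v0 vertical0 mul0rz eqxx.
Qed.

Lemma tot_d_finite c : finite_set [set pq : nat * nat | (tot_d c : families C) pq.1 pq.2 != 0].
Proof.
pose S := [set pq : nat * nat | chain_val c pq.1 pq.2 != 0].
have fS : finite_set S := chain_val_finite c.
apply: (@sub_finite_set _ _ ((fun pq : nat * nat => (pq.1.-1, pq.2)) @` S `|`
    (fun pq : nat * nat => (pq.1, pq.2.+1)) @` S)).
  move=> [p q] /= /tot_d_neq0 [cpq|[q' -> cpq]]; first by left; exists (p.+1, q).
  by right; exists (p, q').
by rewrite finite_setU; split; exact: finite_image.
Qed.

End Chains.

Section Total_differential.
Variables (G : etale_groupoid) (A : gsheaf G) (R : soft_resolution A).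
Hypotheses (hausG : hausdorff_space (arr G)) (lcG : locally_compact [set: arr G]).
Local Notation C := (groupoid_coefficients R).

(** The differential takes values in unrestricted families; the connecting map needs the boundary of
    a lifted chain to be a chain. *)
Lemma tot_d_chain n (c : chains C (n + 1)) : exists b : chains C n, chain_families b = tot_d c.
Proof.
apply: chain_ex.
- move=> p q; rewrite /tot_d; apply: compact_sectionD.
    by apply: delta_compact => //; exact: chain_val_compact.
  case: q => [|q]; first exact: compact_section0.
  by apply: compact_section_sign; apply: vertical_compact; exact: chain_val_compact.
- exact: tot_d_finite.
- move=> p q /tot_d_neq0 [/chain_val_degree|[q' -> /chain_val_degree]]; lia.
Qed.

(** The mixed terms carry the sign of [p + 1] when [vertical] is applied before [delta], and that of
    [p] in the other order; since the two commute, they cancel. *)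
Lemma tot_d_tot_d n m (c : chains C n) (b : chains C m) :
  chain_families b = tot_d c -> tot_d b = 0.
Proof.
move=> bc; have bE p q : chain_val b p q = (tot_d c : families C) p q.
  exact: (congr1 (fun f : families C => f p q) bc).
apply: dprod_eq => p; apply: dprod_eq => q; rewrite [LHS]/tot_d.
have cc p' q' := chain_val_compact c p' q'.
have cs0 := @compact_section0 _ (csheaf C p.+1 q).
have csB := @compact_sectionB _ (csheaf C p.+1 q).
have dB := @deltaB _ C p q.
have cd : compact_section (delta (chain_val c p.+2 q)) by exact: delta_compact.
rewrite !bE /tot_d; case: q cs0 csB dB cd => [|q] cs0 csB dB cd.
  by rewrite !addr0 delta_delta.
have cv : compact_section (vertical (chain_val c p.+1 q)) by exact: vertical_compact.
have [cvs dvs] := partial_raddf_sign cs0 csB dB p.+1 cv.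
rewrite (partial_raddfD cs0 csB dB cd cvs).2 dvs delta_delta // add0r delta_vertical //.
rewrite bE /tot_d.
have vB (x y : dprod (stalk (csheaf C p q))) (_ : True) (_ : True) := @verticalB _ C p q x y.
rewrite (partial_raddfD I (fun _ _ _ _ => I) vB I I).2.
rewrite (_ : vertical (match q with 0%N => _ | _.+1 => _ end) = 0); last first.
  case: q {cs0 csB dB cd cv cvs dvs} vB => [|q] vB; first exact: vertical0.
  by rewrite (partial_raddf_sign I (fun _ _ _ _ => I) vB p I).2 vertical_vertical mul0rz.
by rewrite addr0 exprS mulN1r mulrNz addNr.
Qed.

End Total_differential.

(** * Reduction modulo the subgroupoid *)

(** A filter on the preimage is pushed forward; its cluster point in [K] lies in the range, and
    openness of [f] brings it back. *)
Lemma open_embedding_preimage_compact (X Y : topologicalType) (f : X -> Y) (K : set Y) :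
  injective f -> (forall x V, nbhs x V -> nbhs (f x) (f @` V)) ->
  K `<=` range f -> compact K -> compact (f @^-1` K).
Proof.
move=> fi fo Kf cK F FF FK.
have [y [Ky cl]] := cK (f @ F) _ FK.
have [x _ xy] := Kf _ Ky; exists x; split; first by rewrite /preimage /= xy.
move=> A B FA nB.
have FfA : F (f @^-1` (f @` A)) by apply: filterS FA => a Aa; exists a.
have nfB : nbhs y (f @` B) by rewrite -xy; exact: fo.
have [_ [[a Aa <-] [b Bb /fi ab]]] := cl _ _ FfA nfB.
by exists a; split=> //; rewrite -ab.
Qed.

Section Reduction.
Variables (G : etale_groupoid) (G' : open_subgroupoid G).
Variables (A : gsheaf G) (R : soft_resolution A).
Local Notation C := (groupoid_coefficients R).
Local Notation Cr := (relative_coefficients G' R).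

Lemma induced_class (V W : zmodType) (K : subgroup V) (L : subgroup W) (f : V -> W) a :
  zmod_morphism f -> (forall a, K a -> L (f a)) ->
  @induced _ _ K L f (\pi_(quotient_group K)%qT a) = (\pi_(quotient_group L)%qT (f a)).
Proof.
move=> fB fKL; apply/eqP; rewrite /induced -Quotient.idealrBE -fB.
apply/subgroup_predP; apply: fKL; apply/subgroup_predP.
by rewrite Quotient.idealrBE reprK.
Qed.

Lemma quotient_family_zmod p q : zmod_morphism
  (quotient_family (relative_subsheaf G' R p q) :
    dprod (stalk (csheaf C p q)) -> dprod (stalk (csheaf Cr p q))).
Proof. by move=> s t; apply: dprod_eq => g; exact: quotient_class_zmod. Qed.

Lemma quotient_family_delta_face p q (i : 'I_p.+2) (t : dprod (stalk (csheaf C p.+1 q))) :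
  compact_section t ->
  @delta_face G Cr p q i (quotient_family (relative_subsheaf G' R p.+1 q) t) =
  quotient_family (relative_subsheaf G' R p q) (delta_face i t).
Proof.
move=> ct; apply: dprod_eq => h.
have [r [ur rB]] := finite_set_seq (finite_face_support i h ct).
rewrite (@delta_face_sum G Cr _ _ _ _ _ r); first last.
- move=> k kh tk; rewrite rB inE; split=> //=; apply: contra_neq tk => tk.
  by rewrite /quotient_family tk -(subrr 0) quotient_class_zmod subrr.
- by move=> k; rewrite rB inE => -[].
- exact: ur.
rewrite /quotient_family (@delta_face_sum G C _ _ _ _ _ r); first last.
- by move=> k kh tk; rewrite rB inE.
- by move=> k; rewrite rB inE => -[].
- exact: ur.
rewrite (zmod_morphism_sum (@quotient_class_zmod _ _ (relative_subsheaf G' R p q) h)).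
rewrite big_seq [RHS]big_seq; apply: eq_bigr => k; rewrite rB inE => -[/= <- _].
rewrite !stalk_at_germ; apply: induced_class; first exact: res_face_zmod.
exact: relative_face_sub.
Qed.

Lemma quotient_family_delta p q (t : dprod (stalk (csheaf C p.+1 q))) :
  compact_section t ->
  @delta G Cr p q (quotient_family (relative_subsheaf G' R p.+1 q) t) =
  quotient_family (relative_subsheaf G' R p q) (delta t).
Proof.
move=> ct; rewrite /delta (zmod_morphism_sum (@quotient_family_zmod p q)).
apply: eq_bigr => i _; rewrite quotient_family_delta_face //.
have qB (x y : dprod (stalk (csheaf C p q))) (_ : True) (_ : True) :=
  @quotient_family_zmod p q x y.
by rewrite (partial_raddf_sign I (fun _ _ _ _ => I) qB i I).2.
Qed.

Lemma quotient_family_vertical p q (t : dprod (stalk (csheaf C p q))) :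
  @vertical G Cr p q (quotient_family (relative_subsheaf G' R p q) t) =
  quotient_family (relative_subsheaf G' R p q.+1) (vertical t).
Proof.
apply: dprod_eq => h; apply: induced_class; first exact: res_diff_zmod.
exact: relative_diff_sub.
Qed.

Lemma reduces_toE n (c : groupoid_chains R n) (c' : relative_chains G' R n) :
  reduces_to c c' <-> forall p q,
    chain_val c' p q = quotient_family (relative_subsheaf G' R p q) (chain_val c p q).
Proof.
split=> cc' p q; first by apply: dprod_eq => g; exact: cc'.
by move=> g; rewrite cc'.
Qed.

Lemma reduces_to_tot_d n (c : groupoid_chains R n) (c' : relative_chains G' R n) p q :
  reduces_to c c' ->
  (tot_d c' : families Cr) p q =
  quotient_family (relative_subsheaf G' R p q) ((tot_d c : families C) p q).
Proof.
move=> /reduces_toE cc'; rewrite /tot_d !cc'.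
rewrite quotient_family_delta; last exact: chain_val_compact.
have qB (x y : dprod (stalk (csheaf C p q))) (_ : True) (_ : True) :=
  @quotient_family_zmod p q x y.
rewrite (partial_raddfD I (fun _ _ _ _ => I) qB I I).2; congr (_ + _).
case: q qB => [|q] qB; first by rewrite (partial_raddf0 I qB).
by rewrite (partial_raddf_sign I (fun _ _ _ _ => I) qB p I).2 cc' quotient_family_vertical.
Qed.

Lemma reduces_toB n (c d : groupoid_chains R n) (c' d' : relative_chains G' R n) :
  reduces_to c c' -> reduces_to d d' -> reduces_to (c - d) (c' - d').
Proof.
move=> /reduces_toE cc' /reduces_toE dd'; apply/reduces_toE => p q.
by rewrite -[LHS]/(chain_val c' p q - chain_val d' p q) cc' dd' -quotient_family_zmod.
Qed.

Lemma reduction_ex n (c : groupoid_chains R n) :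
  exists c' : relative_chains G' R n, reduces_to c c'.
Proof.
pose f : families Cr := fun p q =>
  quotient_family (relative_subsheaf G' R p q) (chain_val c p q).
have f0 p q : f p q != 0 -> chain_val c p q != 0.
  apply: contra_neq => c0; rewrite /f c0.
  by rewrite -[X in quotient_family _ X](subrr 0) quotient_family_zmod subrr.
have [|||c' c'f] := @chain_ex G Cr n f.
- move=> p q; exact: (@quotient_compact_section _ _
    (relative_subsheaf G' R p q) _ (chain_val_compact c p q)).
- by apply: sub_finite_set (chain_val_finite c) => -[p q] /= /f0.
- by move=> p q /f0 /chain_val_degree.
exists c'; apply/reduces_toE => p q.
exact: (congr1 (fun g : families Cr => g p q) c'f).
Qed.

Hypotheses (hausG : hausdorff_space (arr G)) (lcG : locally_compact [set: arr G]).

Lemma reduction_lift n (c' : relative_chains G' R n) :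
  exists c : groupoid_chains R n, reduces_to c c'.
Proof.
have H (pq : nat * nat) : exists s : dprod (stalk (csheaf C pq.1 pq.2)),
    [/\ compact_section s,
      quotient_family (relative_subsheaf G' R pq.1 pq.2) s = chain_val c' pq.1 pq.2 &
      s != 0 -> chain_val c' pq.1 pq.2 != 0].
  (* Zero is lifted by zero, so that the lift is nonzero in only finitely many bidegrees, all of the
     right degree. *)
  case: pq => p q /=; have [c0|c0] := eqVneq (chain_val c' p q) 0.
    exists 0; split; rewrite ?eqxx //; first exact: compact_section0.
    by rewrite c0 -[X in quotient_family _ X](subrr 0) quotient_family_zmod subrr.
  have [s cs sE] := quotient_lift (@nerve_hausdorff G hausG p)
    (@nerve_locally_compact G hausG lcG p)
    (@res_pullback_locally_soft G A R hausG lcG p q) (chain_val_compact c' p q).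
  by exists s.
pose f : families C := fun p q => projT1 (cid (H (p, q))).
have fP p q : [/\ compact_section (f p q),
    quotient_family (relative_subsheaf G' R p q) (f p q) = chain_val c' p q &
    f p q != 0 -> chain_val c' p q != 0].
  by rewrite /f; case: cid.
have [|||c cf] := @chain_ex G C n f.
- by move=> p q; case: (fP p q).
- by apply: sub_finite_set (chain_val_finite c') => -[p q] /=; case: (fP p q).
- by move=> p q fpq; apply: (@chain_val_degree _ _ _ c'); case: (fP p q) => _ _; exact.
exists c; apply/reduces_toE => p q.
have -> : chain_val c p q = f p q by exact: (congr1 (fun g : families C => g p q) cf).
by case: (fP p q).
Qed.

End Reduction.

(** * Extension by zero *)

Section Extension.
Variables (G : etale_groupoid) (G' : open_subgroupoid G).
Variables (A : gsheaf G) (R : soft_resolution A).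
Local Notation C := (groupoid_coefficients R).
Local Notation C' := (groupoid_coefficients (restrict_res G' R)).

Lemma string_incl_inj p : injective (@string_incl G G' p).
Proof.
move=> g h gh; apply: string_eq; first exact: (congr1 (@sobj G p) gh).
apply/funext => k; apply: val_inj.
exact: (congr1 (fun x => sarr x k) gh).
Qed.

Lemma string_incl_subnerve p (g : nerve (subgroupoid G') p) : subnerve G' (string_incl g).
Proof. by move=> k; apply: set_mem; exact: valP. Qed.

Definition string_restr p (g : nerve G p) (gU : subnerve G' g) : nerve (subgroupoid G') p :=
  @String (subgroupoid G') p (sobj g)
    (fun k => SigSub (mem_set (gU k)) : arr (subgroupoid G'))
    (fun k => sarr_rng g k) (fun k => sarr_src g k).

Lemma string_restrK p (g : nerve G p) (gU : subnerve G' g) : string_incl (string_restr gU) = g.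
Proof. exact: string_eq. Qed.

Lemma string_inclK p (g : nerve (subgroupoid G') p) (gU : subnerve G' (string_incl g)) :
  string_restr gU = g.
Proof. by apply: string_incl_inj; exact: string_restrK. Qed.

Lemma string_incl_continuous p : continuous (@string_incl G G' p : nerve _ p -> nerve G p).
Proof.
move=> g; apply: nerve_continuousP => k.
  exact: (@sobj_continuous (subgroupoid G') p k).
apply: (@continuous_comp _ _ _ (fun g : nerve (subgroupoid G') p => sarr g k)
  (@subgroupoid_val G G')); first exact: sarr_continuous.
exact: initial_continuous.
Qed.

Lemma string_incl_nbhs p (g : nerve (subgroupoid G') p) (W : set (nerve (subgroupoid G') p)) :
  nbhs g W -> nbhs (string_incl g : nerve G p) (@string_incl G G' p @` W).
Proof.
move=> /nerve_box [U [V [nU nV UVW]]].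
have H (k : 'I_p) : exists B : set (arr G), nbhs (subgroupoid_val (sarr g k)) B /\
    forall a : arr (subgroupoid G'), B (subgroupoid_val a) -> V k a.
  have := nV k; rewrite nbhsE => -[_ [[B oB <-] Bg] sB].
  by exists B; split; [exact: open_nbhs_nbhs|exact: sB].
have [B BP] := choice H.
have n1 := @nerve_box_nbhs G p (string_incl g) U B nU (fun k => (BP k).1).
have n2 : nbhs (string_incl g : nerve G p) (@subnerve G G' p).
  by apply: open_nbhs_nbhs; split; [exact: subnerve_open|exact: string_incl_subnerve].
move: n1 n2; apply: filterS2 => h [Uh Bh] hU.
exists (string_restr hU); last exact: string_restrK.
by apply: UVW => k; [exact: Uh|apply: (BP k).2; exact: Bh].
Qed.

Lemma string_incl_face p (i : 'I_p.+2) (g : nerve (subgroupoid G') p.+1) :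
  string_incl (face i g) = face i (string_incl g).
Proof.
apply: string_eq => //; apply/funext => k; rewrite /=.
case: (k.+1 < i)%N => //; case: (k.+1 == i)%N => //.
rewrite /subgroupoid_val insubdK //; apply: mem_set; apply: subarr_mul.
- exact: (string_incl_subnerve g (ordl k)).
- exact: (string_incl_subnerve g (ordr k)).
- exact: (sarr_composable g k).
Qed.

(** As a relation it serves both to extend [t'] and to restrict a given [t] that vanishes off the
    subnerve. *)
Definition extension_of p q (t' : dprod (stalk (csheaf C' p q)))
    (t : dprod (stalk (csheaf C p q))) : Prop :=
  (forall g : nerve (subgroupoid G') p, t (string_incl g) = t' g) /\
  (forall g : nerve G p, ~ subnerve G' g -> t g = 0).

Definition ext p q (t' : dprod (stalk (csheaf C' p q))) : dprod (stalk (csheaf C p q)) :=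
  fun g => match pselect (subnerve G' g) with
           | left gU => t' (string_restr gU)
           | right _ => 0
           end.

Section Fixed_degree.
Variables p q : nat.
Implicit Types (u v : dprod (stalk (csheaf C' p q))) (s t : dprod (stalk (csheaf C p q))).

Lemma ext_extension_of v : extension_of v (ext v).
Proof.
split=> g; last by rewrite /ext; case: pselect.
rewrite /ext; case: pselect => [gU|]; last by move/(_ (string_incl_subnerve g)).
(* The type of [v h] depends on [h], so [string_inclK] is used only after passing to the étale
   space. *)
apply: (@germ_inj (obj G) (res R q) (tau g)).
exact: (congr1 (fun h : nerve (subgroupoid G') p => base_germ (v h)) (string_inclK gU)).
Qed.

Lemma extension_of_ext v t : extension_of v t -> t = ext v.
Proof.
move=> [tU t0]; have [eU e0] := ext_extension_of v; apply: dprod_eq => g.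
have [gU|nU] := pselect (subnerve G' g); last by rewrite t0 ?e0.
by rewrite -(string_restrK gU) tU -eU.
Qed.

Lemma extension_ofB u v s t : extension_of u s -> extension_of v t ->
  extension_of (u - v) (s - t).
Proof.
move=> [sU s0] [tU t0]; split=> g; first by rewrite !dprodBE sU tU.
by move=> nU; rewrite dprodBE s0 // t0 // subrr.
Qed.

Lemma extension_of0 : extension_of (0 : dprod (stalk (csheaf C' p q))) 0.
Proof. by split. Qed.

Lemma extension_ofD u v s t : extension_of u s -> extension_of v t ->
  extension_of (u + v) (s + t).
Proof.
move=> es et; rewrite -[v]opprK -[- v]sub0r -[t]opprK -[- t]sub0r.
by apply: extension_ofB => //; apply: extension_ofB => //; exact: extension_of0.
Qed.

Lemma extension_of_sign n v t : extension_of v t ->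
  extension_of (v *~ (-1) ^+ n) (t *~ (-1) ^+ n).
Proof.
move=> et; rewrite -signr_odd; case: (odd n); rewrite ?expr0 ?expr1 ?mulr1z //.
by rewrite !mulrN1z -[- v]sub0r -[- t]sub0r; apply: extension_ofB => //; exact: extension_of0.
Qed.

Lemma extension_of_eq0 v t : extension_of v t -> t = 0 -> v = 0.
Proof. by move=> [tU _] t0; apply: dprod_eq => g; rewrite -tU t0. Qed.

Lemma ext0 : ext (0 : dprod (stalk (csheaf C' p q))) = 0.
Proof. by rewrite -(extension_of_ext extension_of0). Qed.

(** The image of the support is compact, hence closed in the Hausdorff nerve of [G]: off it the
    extension vanishes on an open set, and near it the inclusion is open. *)
Lemma ext_compact v : hausdorff_space (arr G) ->
  compact_section v -> compact_section (ext v).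
Proof.
move=> hausG [ct kt]; have [eU e0] := ext_extension_of v.
have cK : compact (@string_incl G G' p @` Defs.support v : set (nerve G p)).
  apply: continuous_compact kt; apply: continuous_subspaceT.
  exact: string_incl_continuous.
have clK := compact_closed (@nerve_hausdorff G hausG p) cK.
have eK g : ext v g != 0 -> (@string_incl G G' p @` Defs.support v) g.
  have [gU|/e0 ->] := pselect (subnerve G' g); last by rewrite eqxx.
  rewrite -(string_restrK gU) eU => tg; exists (string_restr gU) => //.
  exact: (@subset_closure _ [set g | v g != 0]).
apply: (compact_section_sub cK) => // g _.
have [[g' _ <-]|nK] := pselect ((@string_incl G G' p @` Defs.support v : set (nerve G p)) g).
  apply/base_germ_continuous => W nW.
  have nW' : nbhs (base_germ (v g')) W by move: nW; rewrite eU.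
  have n1 : nbhs g' [set h | W (base_germ (v h))].
    exact: ((base_germ_continuous v g').1 (ct g' I) _ nW').
  suff : nbhs (string_incl g' : nerve G p) [set h | W (base_germ (ext v h))] by [].
  apply: filterS (string_incl_nbhs n1) => _ [h Wh <-]; rewrite /= eU; exact: Wh.
apply: (@section_at_near_eq _ _ 0); last exact: section_at0.
have : nbhs g (~` (@string_incl G G' p @` Defs.support v : set (nerve G p))).
  by apply: open_nbhs_nbhs; split=> //; exact: closed_openC.
apply: filterS => h nKh; apply/esym; apply: contrapT => /eqP /eK; exact: nKh.
Qed.

(** The support of a section is exactly where it is nonzero, so that of [t] lies inside the open
    subnerve and stays compact there. *)
Lemma extension_of_compact v t : extension_of v t ->
  compact_section t -> compact_section v.
Proof.
move=> [tU t0] [ct kt].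
have tsupp : Defs.support t = [set g | t g != 0] by exact: section_support.
have cK : compact ((@string_incl G G' p : nerve _ p -> nerve G p) @^-1` Defs.support t).
  apply: open_embedding_preimage_compact kt.
  - exact: string_incl_inj.
  - exact: string_incl_nbhs.
  - rewrite tsupp => g /= tg; have [gU|/t0 tg0] := pselect (subnerve G' g).
      by exists (string_restr gU) => //; exact: string_restrK.
    by rewrite tg0 eqxx in tg.
apply: (compact_section_sub cK).
  move=> g _; apply/base_germ_continuous => W nW.
  have nW' : nbhs (base_germ (t (string_incl g))) W by rewrite tU.
  have n1 : nbhs (string_incl g : nerve G p) [set h | W (base_germ (t h))].
    exact: ((base_germ_continuous t _).1 (ct _ I) _ nW').
  have : nbhs g [set h | W (base_germ (t (string_incl h)))].
    exact: (@string_incl_continuous p g _ n1).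
  suff H : [set h : nerve _ p | W (base_germ (t (string_incl h)))] `<=`
      [set h | W (base_germ (v h))] by exact: filterS.
  by move=> h; rewrite /= tU.
by move=> g vg; rewrite /preimage /= tsupp /= tU.
Qed.

End Fixed_degree.

Lemma extension_of_restr p q (t : dprod (stalk (csheaf C p q))) :
  (forall g : nerve G p, ~ subnerve G' g -> t g = 0) ->
  exists t' : dprod (stalk (csheaf C' p q)), extension_of t' t.
Proof. by move=> t0; exists (fun g => t (string_incl g)); split. Qed.

(** Strings of [G'] have their faces in [G'], so the sum vanishes off the subnerve. Over a string of
    [G'], the part of the fibre outside the subnerve contributes zero and the rest is the fibre for
    [G']. *)
Lemma extension_of_delta_face p q (i : 'I_p.+2) (t' : dprod (stalk (csheaf C' p.+1 q)))
    (t : dprod (stalk (csheaf C p.+1 q))) :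
  extension_of t' t -> extension_of (delta_face i t') (delta_face i t).
Proof.
move=> [tU t0]; split=> h; last first.
  move=> nU; apply: delta_face_eq0 => g gh; apply: t0 => gU; apply: nU.
  by rewrite -gh; exact: subnerve_face.
rewrite /delta_face -(@fsbig_widen _ _ _ _
  ([set g : nerve G p.+1 | face i g = string_incl h] `&` @subnerve G G' p.+1)); first last.
- move=> g [gh /not_andP [//|nU]].
  change (stalk_at (string_incl h : nerve G p) (germ (cface i (t g))) = 0).
  by rewrite t0 // cface0 stalk_at0.
- by move=> g [].
rewrite (@reindex_fsbig _ _ _ _ _ (@string_incl G G' p.+1)
  [set g : nerve (subgroupoid G') p.+1 | face i g = h]); last first.
  split.
  - by move=> g /= <-; rewrite string_incl_face; split=> //; exact: string_incl_subnerve.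
  - by move=> g g' _ _; exact: string_incl_inj.
  - move=> g [/= gh gU]; exists (string_restr gU); last exact: string_restrK.
    by apply: string_incl_inj; rewrite string_incl_face string_restrK.
apply: eq_fsbigr => g /set_mem /= gh.
apply: (@germ_inj (obj G) (res R q) (tau h)).
have := @base_germ_stalk_at _ _ R p q _ (string_incl h) (cface i (t (string_incl g))).
rewrite /base_germ => ->; last by rewrite -string_incl_face gh.
have := @base_germ_stalk_at _ _ (restrict_res G' R) p q _ h (cface i (t' g)) gh.
rewrite {1}/base_germ => ->.
have := base_germ_face i (t (string_incl g)); rewrite {1}/base_germ => ->.
by rewrite base_germ_face -tU.
Qed.

Lemma extension_of_delta p q (t' : dprod (stalk (csheaf C' p.+1 q)))
    (t : dprod (stalk (csheaf C p.+1 q))) :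
  extension_of t' t -> extension_of (delta t') (delta t).
Proof.
move=> et; apply: (@big_ind2 _ _ (@extension_of p q)).
- exact: extension_of0.
- by move=> x1 x2 y1 y2; exact: extension_ofD.
- by move=> i _; apply: extension_of_sign; exact: extension_of_delta_face.
Qed.

Lemma extension_of_vertical p q (t' : dprod (stalk (csheaf C' p q)))
    (t : dprod (stalk (csheaf C p q))) :
  extension_of t' t -> extension_of (vertical t') (vertical t).
Proof.
move=> [tU t0]; split=> g; first by rewrite /vertical tU.
by move=> /t0 tg; rewrite /vertical tg -(subrr 0) cdiff_zmod subrr.
Qed.

Section Chain_extension.
Variable n : int.

Lemma extends_by_zeroE (c' : chains C' n) (c : chains C n) :
  @extends_by_zero G G' A R n c' c <->
  forall p q, extension_of (chain_val c' p q) (chain_val c p q).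
Proof. by split=> H p q; exact: H. Qed.

Lemma extends_by_zero_tot_d (c' : chains C' n) (c : chains C n) p q :
  @extends_by_zero G G' A R n c' c ->
  extension_of ((tot_d c' : families C') p q) ((tot_d c : families C) p q).
Proof.
move=> /extends_by_zeroE cc'; rewrite /tot_d; apply: extension_ofD.
  exact: extension_of_delta.
case: q => [|q]; first exact: extension_of0.
by apply: extension_of_sign; exact: extension_of_vertical.
Qed.

Lemma extends_by_zeroB (c' d' : chains C' n) (c d : chains C n) :
  @extends_by_zero G G' A R n c' c -> @extends_by_zero G G' A R n d' d ->
  @extends_by_zero G G' A R n (c' - d') (c - d).
Proof.
move=> /extends_by_zeroE cc' /extends_by_zeroE dd'; apply/extends_by_zeroE => p q.
exact: (@extension_ofB p q (chain_val c' p q) (chain_val d' p q)).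
Qed.

Lemma extension_ex (c' : chains C' n) : hausdorff_space (arr G) ->
  exists c, @extends_by_zero G G' A R n c' c.
Proof.
move=> hausG; pose f : families C := fun p q => ext (chain_val c' p q).
have f0 p q : f p q != 0 -> chain_val c' p q != 0.
  by apply: contra_neq => c0; rewrite /f c0 ext0.
have [|||c cf] := @chain_ex G C n f.
- by move=> p q; apply: ext_compact => //; exact: chain_val_compact.
- by apply: sub_finite_set (chain_val_finite c') => -[p q] /= /f0.
- by move=> p q /f0 /chain_val_degree.
exists c; apply/extends_by_zeroE => p q.
have -> : chain_val c p q = f p q by exact: (congr1 (fun g : families C => g p q) cf).
exact: ext_extension_of.
Qed.

Lemma restriction_ex (c : chains C n) :
  (forall p q (g : nerve G p), ~ subnerve G' g -> chain_val c p q g = 0) ->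
  exists c', @extends_by_zero G G' A R n c' c.
Proof.
move=> c0; pose f : families C' := fun p q => projT1 (cid (extension_of_restr (c0 p q))).
have fP p q : extension_of (f p q) (chain_val c p q) by rewrite /f; case: cid.
have f0 p q : f p q != 0 -> chain_val c p q != 0.
  by apply: contra_neq; exact: extension_of_eq0 (fP p q).
have [|||c' cf] := @chain_ex (subgroupoid G') C' n f.
- by move=> p q; apply: extension_of_compact (fP p q) (chain_val_compact c p q).
- by apply: sub_finite_set (chain_val_finite c) => -[p q] /= /f0.
- by move=> p q /f0 /chain_val_degree.
exists c'; apply/extends_by_zeroE => p q.
have -> : chain_val c' p q = f p q by exact: (congr1 (fun g : families C' => g p q) cf).
exact: fP.
Qed.

(** Middle exactness at chain level: off the subnerve the quotient stalk is the stalk itself, and on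
    it the quotient stalk is zero. *)
Lemma reduces_to0 (c : chains C n) : reduces_to c (0 : relative_chains G' R n) <->
  exists c', @extends_by_zero G G' A R n c' c.
Proof.
have q0 p q (g : nerve G p) :
    quotient_class (relative_subsheaf G' R p q) (0 : stalk (csheaf C p q) g) = 0.
  by rewrite -[X in quotient_class _ X](subrr 0) quotient_class_zmod subrr.
have z0 p q (g : nerve G p) : chain_val (0 : relative_chains G' R n) p q g = 0 by [].
split=> [c0|[c' /extends_by_zeroE cc'] p q g].
  apply: restriction_ex => p q g nU.
  have := c0 p q g; rewrite z0 -(q0 p q g) => /esym.
  by move/(quotient_class_outside (@subnerve_open G G' p) _ _ nU).
rewrite z0 -(q0 p q g); have [gU|nU] := pselect (subnerve G' g).
  exact: (quotient_class_inside (@subnerve_open G G' p)).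
by rewrite (cc' p q).2.
Qed.

End Chain_extension.

End Extension.

(** * The long exact sequence *)

(** If [a] and [a'] differ by an element of [K], the elements related to them differ by one related
    to it, hence by an element of [L]; the chosen images are thus independent of choices. *)
Lemma quotient_relation_map (V W : zmodType) (K : subgroup V) (L : subgroup W)
    (Q : V -> W -> Prop) :
  (forall a, exists b, Q a b) ->
  (forall a b a' b', Q a b -> Q a' b' -> Q (a - a') (b - b')) ->
  (forall a b, Q a b -> K a -> L b) ->
  exists f : {additive quotient_group K -> quotient_group L}, forall a b, Q a b ->
    f (\pi_(quotient_group K)%qT a) = \pi_(quotient_group L)%qT b.
Proof.
move=> Qtot QB QKL; have [h hP] := choice Qtot.
pose f (x : quotient_group K) : quotient_group L := \pi_(quotient_group L)%qT (h (repr x)).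
have fE a b : Q a b -> f (\pi_(quotient_group K)%qT a) = \pi_(quotient_group L)%qT b.
  move=> Qab; apply/eqP; rewrite /f -Quotient.idealrBE; apply/subgroup_predP.
  apply: QKL (QB _ _ _ _ (hP _) Qab) _; apply/subgroup_predP.
  by rewrite Quotient.idealrBE reprK.
have fB : zmod_morphism f.
  move=> x y; rewrite -[x]reprK -[y]reprK -raddfB.
  by rewrite (fE _ _ (QB _ _ _ _ (hP _) (hP _))) !(fE _ _ (hP _)) raddfB.
pose fM := GRing.isZmodMorphism.Build (quotient_group K) (quotient_group L) f fB.
pose g : {additive quotient_group K -> quotient_group L} := HB.pack f fM.
by exists g.
Qed.

(** * Cycles and their classes *)

Section Homology_classes.
Variables (G : etale_groupoid) (C : coefficients G) (n : int).

Lemma cycle_ex (c : chains C n) : tot_d c = 0 -> exists z : cycles C n, cycle_chain z = c.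
Proof.
move=> c0; exists (exist _ c (introT (subgroup_predP
  (Subgroup (tot_d0 C n) (@cycle_setB _ C n)) c) c0)).
by [].
Qed.

Lemma tot_d_cycle (z : cycles C n) : tot_d (cycle_chain z) = 0.
Proof. by apply: asboolW; exact: (valP z). Qed.

Lemma homology_class_surj (x : homology C n) : exists z, homology_class z = x.
Proof. by exists (repr x); exact: reprK. Qed.

Lemma homology_class_eq (y z : cycles C n) :
  homology_class y = homology_class z <-> boundary_set (y - z).
Proof.
rewrite /homology_class; split.
  by move/eqP; rewrite -Quotient.idealrBE => /subgroup_predP.
by move=> yz; apply/eqP; rewrite -Quotient.idealrBE; apply/subgroup_predP.
Qed.

Lemma homology_class_eq0 (z : cycles C n) : homology_class z = 0 <-> boundary_set z.
Proof.
have -> : 0 = homology_class (0 : cycles C n) by rewrite /homology_class raddf0.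
by rewrite homology_class_eq subr0.
Qed.

End Homology_classes.

Section Long_exact_sequence.
Variables (G : etale_groupoid).
Hypotheses (hausG : hausdorff_space (arr G)) (lcG : locally_compact [set: arr G]).
Variables (G' : open_subgroupoid G) (A : gsheaf G) (R : soft_resolution A).
Local Notation C := (groupoid_coefficients R).
Local Notation C' := (groupoid_coefficients (restrict_res G' R)).
Local Notation Cr := (relative_coefficients G' R).

(** Extension by zero is an injective chain map, which gives both directions. Leaving [n] and [m]
    independent lets the lemma cover boundaries and, with zero chains on the right, cycles. *)
Lemma extends_tot_d_eq n m (c' : chains C' n) (c : chains C n) (b' : chains C' m) (b : chains C m) :
  @extends_by_zero G G' A R n c' c -> @extends_by_zero G G' A R m b' b ->
  (tot_d c' = chain_families b' <-> tot_d c = chain_families b).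
Proof.
move=> cc' bb'; split=> E; apply: dprod_eq => p; apply: dprod_eq => q.
  have := extends_by_zero_tot_d p q cc'; rewrite E => /extension_of_ext ->.
  by rewrite -(extension_of_ext (bb' p q)).
apply: dprod_eq => g; rewrite -(extends_by_zero_tot_d p q cc').1 E.
exact: (bb' p q).1.
Qed.

Lemma extends_tot_d_eq0 n (c' : chains C' n) (c : chains C n) :
  @extends_by_zero G G' A R n c' c -> (tot_d c' = 0 <-> tot_d c = 0).
Proof.
move=> cc'; apply: (@extends_tot_d_eq n n c' c 0 0 cc').
by apply/extends_by_zeroE => p q; exact: extension_of0.
Qed.

Lemma reduces_tot_d_eq n m (c : chains C n) (cr : chains Cr n) (b : chains C m) (br : chains Cr m) :
  reduces_to c cr -> reduces_to b br ->
  tot_d c = chain_families b -> tot_d cr = chain_families br.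
Proof.
move=> ccr /reduces_toE bbr E; apply: dprod_eq => p; apply: dprod_eq => q.
by rewrite (reduces_to_tot_d p q ccr) E /chain_families bbr.
Qed.

Lemma reduces_to00 n : reduces_to (0 : chains C n) (0 : chains Cr n).
Proof.
apply/reduces_to0; exists 0.
by apply/extends_by_zeroE => p q; exact: extension_of0.
Qed.

Lemma reduces_tot_d_eq0 n (c : chains C n) (cr : chains Cr n) :
  reduces_to c cr -> tot_d c = 0 -> tot_d cr = 0.
Proof. by move=> ccr; exact: (@reduces_tot_d_eq n n c cr 0 0 ccr (@reduces_to00 n)). Qed.

Lemma reduces_to_boundary n m (c : chains C n) (cr : chains Cr n) (b : chains C m)
    (br : chains Cr m) :
  reduces_to c cr -> tot_d c = chain_families b -> tot_d cr = chain_families br ->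
  reduces_to b br.
Proof.
move=> ccr cb crbr; have [dr bdr] := reduction_ex G' b.
suff <- : dr = br by [].
by apply: chain_eq; rewrite -(reduces_tot_d_eq ccr bdr cb).
Qed.

Lemma cycle_extension n (z' : cycles C' n) : exists z : cycles C n,
  @extends_by_zero G G' A R n (cycle_chain z') (cycle_chain z).
Proof.
have [c z'c] := extension_ex (cycle_chain z') hausG.
have [|z zc] := @cycle_ex _ _ _ c; last by exists z; rewrite zc.
by apply/(extends_tot_d_eq0 z'c); exact: tot_d_cycle.
Qed.

Lemma cycle_reduction n (z : cycles C n) : exists zr : cycles Cr n,
  reduces_to (cycle_chain z) (cycle_chain zr).
Proof.
have [c zc] := reduction_ex G' (cycle_chain z).
have [|zr zrc] := @cycle_ex _ _ _ c; last by exists zr; rewrite zrc.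
by apply: (reduces_tot_d_eq0 zc); exact: tot_d_cycle.
Qed.

(** The zigzag of the snake lemma, kept as a relation since the lift [c] is not unique. *)
Definition connects n (zr : cycles Cr (n + 1)) (z' : cycles C' n) : Prop :=
  exists (c : chains C (n + 1)) (b : chains C n), [/\ reduces_to c (cycle_chain zr),
    tot_d c = chain_families b & @extends_by_zero G G' A R n (cycle_chain z') b].

Lemma connects_ex n (zr : cycles Cr (n + 1)) : exists z' : cycles C' n, connects zr z'.
Proof.
have [c czr] := reduction_lift hausG lcG (cycle_chain zr).
have [b bc] := tot_d_chain hausG lcG c.
have b0 : reduces_to b (0 : chains Cr n).
  by apply: (reduces_to_boundary czr (esym bc)); exact: tot_d_cycle.
have /reduces_to0 [c' c'b] := b0.
have [|z' z'c] := @cycle_ex _ _ _ c'; last by exists z', c, b; rewrite z'c.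
by apply/(extends_tot_d_eq0 c'b); exact: (tot_d_tot_d hausG lcG bc).
Qed.

Lemma boundary_lift n (cr : chains Cr n) (er : chains Cr (n + 1)) :
  tot_d er = chain_families cr ->
  exists (e : chains C (n + 1)) (b : chains C n),
    chain_families b = tot_d e /\ reduces_to b cr.
Proof.
move=> ercr; have [e eer] := reduction_lift hausG lcG er.
have [b be] := tot_d_chain hausG lcG e; exists e, b; split=> //.
exact: (reduces_to_boundary eer (esym be)).
Qed.

Lemma iota_ex n : exists f : {additive homology C' n -> homology C n},
  forall (z' : cycles C' n) (z : cycles C n),
    @extends_by_zero G G' A R n (cycle_chain z') (cycle_chain z) ->
    f (homology_class z') = homology_class z.
Proof.
apply: (@quotient_relation_map _ _ _ _ (fun (z' : cycles C' n) (z : cycles C n) =>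
  @extends_by_zero G G' A R n (cycle_chain z') (cycle_chain z))).
- exact: cycle_extension.
- by move=> a b a' b'; exact: extends_by_zeroB.
- move=> z' z z'z [e' e'z]; have [e e'e] := extension_ex e' hausG.
  by exists e; apply/(extends_tot_d_eq e'e z'z).
Qed.

Lemma rho_ex n : exists f : {additive homology C n -> homology Cr n},
  forall (z : cycles C n) (zr : cycles Cr n),
    reduces_to (cycle_chain z) (cycle_chain zr) ->
    f (homology_class z) = homology_class zr.
Proof.
apply: (@quotient_relation_map _ _ _ _
  (fun (z : cycles C n) (zr : cycles Cr n) => reduces_to (cycle_chain z) (cycle_chain zr))).
- exact: cycle_reduction.
- by move=> a b a' b'; exact: reduces_toB.
- move=> z zr zzr [e ez]; have [er eer] := reduction_ex G' e.
  by exists er; exact: (reduces_tot_d_eq eer zzr).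
Qed.

Lemma conn_ex n : exists f : {additive homology Cr (n + 1) -> homology C' n},
  forall (zr : cycles Cr (n + 1)) (z' : cycles C' n), connects zr z' ->
    f (homology_class zr) = homology_class z'.
Proof.
apply: (@quotient_relation_map _ _ _ _ (@connects n)).
- exact: connects_ex.
- move=> zr z' yr y' [c [b [czr cb z'b]]] [d [e [dyr de y'e]]].
  exists (c - d), (b - e); split; first exact: reduces_toB.
    by rewrite tot_dB cb de.
  exact: extends_by_zeroB.
- move=> zr z' [c [b [czr cb z'b]]] [er erzr].
  have [e [f [fe fzr]]] := boundary_lift erzr.
  (* [f] is a boundary with the same reduction as [c]. Thus [c - f] comes from [G'] and still has
     boundary [b], which makes [z'] a boundary in [G']. *)
  have := reduces_toB czr fzr; rewrite subrr => /reduces_to0 [c'' c''cf].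
  exists c''; apply/(extends_tot_d_eq c''cf z'b).
  by rewrite tot_dB (tot_d_tot_d hausG lcG fe) subr0.
Qed.

(** * Exactness at the three places *)

Section Exactness.
Variables (n : int) (iota : {additive homology C' n -> homology C n}).
Variable rho : forall n, {additive homology C n -> homology Cr n}.
Variable conn : {additive homology Cr (n + 1) -> homology C' n}.
Hypothesis iotaE : forall (z' : cycles C' n) (z : cycles C n),
  @extends_by_zero G G' A R n (cycle_chain z') (cycle_chain z) ->
  iota (homology_class z') = homology_class z.
Hypothesis rhoE : forall n (z : cycles C n) (zr : cycles Cr n),
  reduces_to (cycle_chain z) (cycle_chain zr) ->
  rho n (homology_class z) = homology_class zr.
Hypothesis connE : forall (zr : cycles Cr (n + 1)) (z' : cycles C' n),
  connects zr z' -> conn (homology_class zr) = homology_class z'.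

Lemma exact_iota_rho : exact_at iota (rho n).
Proof.
move=> y; have [z <-] := homology_class_surj y; split.
  have [zr zzr] := cycle_reduction z; rewrite (rhoE zzr) => /homology_class_eq0 [er erzr].
  have [e [b [be bzr]]] := boundary_lift erzr.
  (* Subtracting the boundary [b] keeps the class of [z] and makes its reduction vanish. *)
  have := reduces_toB zzr bzr; rewrite subrr => /reduces_to0 [c' c'zb].
  have zb0 : tot_d (cycle_chain z - b) = 0.
    by rewrite tot_dB tot_d_cycle (tot_d_tot_d hausG lcG be) subr0.
  have [w wE] := cycle_ex zb0.
  have [z' z'E] := cycle_ex ((extends_tot_d_eq0 c'zb).2 zb0).
  exists (homology_class z'); rewrite (@iotaE z' w); last by rewrite wE z'E.
  apply/esym/homology_class_eq; exists e.
  rewrite -be; congr chain_families.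
  by rewrite -[RHS]/(cycle_chain z - cycle_chain w) wE subKr.
move=> [x]; have [z' <-] := homology_class_surj x.
have [w z'w] := cycle_extension z'; rewrite (iotaE z'w) => <-.
have w0 : reduces_to (cycle_chain w) (0 : chains Cr n).
  by apply/reduces_to0; exists (cycle_chain z').
by rewrite (@rhoE _ w 0) // /homology_class raddf0.
Qed.

Lemma exact_rho_conn : exact_at (rho (n + 1)) conn.
Proof.
move=> y; have [zr <-] := homology_class_surj y; split.
  have [z' zrz'] := connects_ex zr; rewrite (connE zrz') => /homology_class_eq0 [e' e'z'].
  have [c [b [czr cb z'b]]] := zrz'; have [e e'e] := extension_ex e' hausG.
  have eb := (extends_tot_d_eq e'e z'b).1 e'z'.
  (* [e] comes from [G'] and has the same boundary as the lift [c], so [c - e] is a cycle that still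
     reduces to [zr]. *)
  have ce0 : tot_d (c - e) = 0 by rewrite tot_dB eb cb subrr.
  have [z zE] := cycle_ex ce0; exists (homology_class z); apply: rhoE.
  have e0 : reduces_to e (0 : chains Cr (n + 1)) by apply/reduces_to0; exists e'.
  by have := reduces_toB czr e0; rewrite subr0 zE.
move=> [x]; have [z <-] := homology_class_surj x.
have [wr zwr] := cycle_reduction z; rewrite (rhoE zwr) => <-.
rewrite (@connE wr 0); first by rewrite /homology_class raddf0.
(* A cycle of [G] is itself a lift of its reduction, and its boundary is zero. *)
exists (cycle_chain z), 0; split=> //; exact: tot_d_cycle.
Qed.

Lemma exact_conn_iota : exact_at conn iota.
Proof.
move=> y; have [z' <-] := homology_class_surj y; split.
  have [z z'z] := cycle_extension z'; rewrite (iotaE z'z) => /homology_class_eq0 [c cz].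
  have [cr ccr] := reduction_ex G' c.
  have z0 : reduces_to (cycle_chain z) (0 : chains Cr n).
    by apply/reduces_to0; exists (cycle_chain z').
  (* A chain [c] bounding the extension of [z'] is a cycle after reduction, and it witnesses the
     zigzag from that cycle to [z']. *)
  have [zr zrE] := cycle_ex (reduces_tot_d_eq ccr z0 cz).
  exists (homology_class zr); apply: connE.
  by exists c, (cycle_chain z); rewrite zrE.
move=> [x]; have [zr <-] := homology_class_surj x.
have [w' zrw'] := connects_ex zr; rewrite (connE zrw') => <-.
have [c [b [czr cb w'b]]] := zrw'.
have [z zb] := cycle_ex (tot_d_tot_d hausG lcG (esym cb)).
rewrite (@iotaE w' z); last by rewrite zb.
by apply/homology_class_eq0; exists c; rewrite zb cb.
Qed.

End Exactness.
End Long_exact_sequence.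

(** The first two clauses tie [iota] and [rho] to extension by zero and reduction, so exactness is
    not about arbitrary maps. Every integer has the form [n + 1], so the three exactness clauses
    cover all degrees. *)
Theorem proposition7p2 (G : etale_groupoid)
    (hausG : hausdorff_space (arr G)) (lcG : locally_compact [set: arr G])
    (G' : open_subgroupoid G) (A : gsheaf G) (R : soft_resolution A) :
  exists (iota : forall n : int,
            {additive groupoid_homology (restrict_res G' R) n ->
                      groupoid_homology R n})
         (rho : forall n : int,
            {additive groupoid_homology R n -> relative_homology G' R n})
         (conn : forall n : int,
            {additive relative_homology G' R (n + 1) ->
                      groupoid_homology (restrict_res G' R) n}),
  [/\ (forall n (z' : groupoid_cycles (restrict_res G' R) n),
         exists z : groupoid_cycles R n,
           extends_by_zero (cycle_chain z') (cycle_chain z) /\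
           iota n (homology_class z') = homology_class z),
      (forall n (z : groupoid_cycles R n),
         exists zr : relative_cycles G' R n,
           reduces_to (cycle_chain z) (cycle_chain zr) /\
           rho n (homology_class z) = homology_class zr),
      (forall n, exact_at (iota n) (rho n)),
      (forall n, exact_at (rho (n + 1)) (conn n)) &
      (forall n, exact_at (conn n) (iota n))].
Proof.
pose iota n := projT1 (cid (iota_ex hausG G' R n)).
pose rho n := projT1 (cid (rho_ex G' R n)).
pose conn n := projT1 (cid (conn_ex hausG lcG G' R n)).
have iotaE n := projT2 (cid (iota_ex hausG G' R n)).
have rhoE n := projT2 (cid (rho_ex G' R n)).
have connE n := projT2 (cid (conn_ex hausG lcG G' R n)).
exists iota, rho, conn; split.
- move=> n z'; have [z z'z] := cycle_extension hausG z'.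
  by exists z; split=> //; exact: iotaE.
- move=> n z; have [zr zzr] := cycle_reduction G' z.
  by exists zr; split=> //; exact: rhoE.
- by move=> n; exact: (exact_iota_rho hausG lcG (@iotaE n) rhoE).
- by move=> n; exact: (exact_rho_conn hausG lcG rhoE (@connE n)).
- by move=> n; exact: (exact_conn_iota hausG lcG (@iotaE n) (@connE n)).
Qed.
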